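(* Let $n\in\mathbb{N}$. The zeta function of the quantum harmonic oscillator is given, as a meromorphic function of $s\in\mathbb{C}$, by $$\zeta_{H^{2n}}(s)=\frac{2^{-s}}{(2n-1)!}\sum_{i=1}^{n}u(n,i)\,\zeta(s-2i+1),$$ $$\zeta_{H^{2n-1}}(s)=\frac{1}{4^n(2n-2)!}\sum_{i=1}^{n}v(n,i)\left(4-2^{-s+2i}\right)\zeta(s-2i+2),$$ and the corresponding determinants satisfy $$-\log\left[\det(H^{2n})\right]=\frac{1}{(2n-1)!}\sum_{i=1}^n u(n,i)\left[\zeta'(-2i+1)-\log(2)\,\zeta(-2i+1)\right]$$ and $$-\log\left[\det(H^{2n-1})\right]=\frac{1}{4^n(2n-2)!}\sum_{i=2}^n\left(4-4^{i}\right)v(n,i)\,\zeta'(-2i+2)+\frac{(-1)^{n}\,8\log(2)\,(2n-2)!}{16^n\big((n-1)!\big)^2}.$$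
   Context: $\mathbb{N}=\{1,2,3,\dots\}$, $\zeta$ is the Riemann zeta function with derivative $\zeta'$, and empty sums are $0$. For $N\ge1$, the spectrum of the quantum harmonic oscillator $H^N$ in $\mathbb{R}^N$ consists of the eigenvalues $2k+N$, $k=0,1,2,\dots$, with multiplicities $\binom{N+k-1}{k}$. Its zeta function is $\zeta_{H^N}(s):=\sum_{k=0}^\infty\binom{N+k-1}{k}(2k+N)^{-s}$ for $\mathrm{Re}(s)>N$, extended meromorphically to $\mathbb{C}$; it is analytic at $0$ and $\det(H^N):=e^{-\zeta'_{H^N}(0)}$. The central factorial numbers are given for $n\ge1$ by $\sum_{k=1}^nu(n,k)x^k=\prod_{i=0}^{n-1}(x-i^2)$ and $\sum_{k=1}^nv(n,k)x^k=x\prod_{i=1}^{n-1}\big(x-(2i-1)^2\big)$. *)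

(* Defs.v *)
From Stdlib Require Export Reals ZArith List ClassicalEpsilon.
From Stdlib Require Import Lra Lia.
From Coquelicot Require Export Coquelicot.

(* In this file [C] is Coquelicot's type of complex numbers; the binomial
   coefficient of the standard library is always written [Binomial.C]. *)

Open Scope R_scope.

Definition Cexp (z : C) : C :=
  (exp (Re z) * cos (Im z), exp (Re z) * sin (Im z)).

(* [a ^ s] for a positive real base [a]; meaningless for [a <= 0]. *)
Definition Cpower (a : R) (s : C) : C := Cexp (s * RtoC (ln a))%C.

(* Principal argument, with values in (-PI, PI]; meaningless at [0]. *)
Definition Carg (z : C) : R :=
  if Rle_dec 0 (Im z) then acos (Re z / Cmod z) else - acos (Re z / Cmod z).

Definition Clog (z : C) : C := (ln (Cmod z), Carg z).

Definition analytic_at (f : C -> C) (a : C) : Prop :=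
  exists (c : nat -> C) (r : R), 0 < r /\
    forall z : C, Cmod (z - a)%C < r ->
      @is_pseries C_AbsRing C_NormedModule c (z - a)%C (f z).

(* The value of [f] at the pole [a] itself is irrelevant. *)
Definition has_pole (f : C -> C) (a : C) : Prop :=
  exists (m : nat) (g : C -> C) (r : R),
    (1 <= m)%nat /\ analytic_at g a /\ g a <> RtoC 0 /\ 0 < r /\
    forall z : C, 0 < Cmod (z - a)%C < r -> f z = (g z / (z - a) ^ m)%C.

(* A meromorphic function is represented by a total function that is analytic
   except at its poles, where it takes arbitrary values. *)
Definition meromorphic (f : C -> C) : Prop :=
  forall a : C, analytic_at f a \/ has_pole f a.

Definition mero_eq (f g : C -> C) : Prop :=
  meromorphic f /\ meromorphic g /\
  (forall s : C, has_pole f s <-> has_pole g s) /\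
  (forall s : C, ~ has_pole f s -> f s = g s).

Definition is_continuation (a : nat -> C -> C) (sigma : R) (F : C -> C) : Prop :=
  meromorphic F /\
  forall s : C, sigma < Re s ->
    @is_series C_AbsRing C_NormedModule (fun k => a k s) (F s).

(* The meromorphic continuation to the whole plane of the sum of the series
   [a] on the half-plane [sigma < Re s]; by the identity theorem it is unique
   away from its poles. *)
Definition continuation (a : nat -> C -> C) (sigma : R) : C -> C :=
  epsilon (inhabits (fun _ : C => RtoC 0)) (is_continuation a sigma).

Definition zeta : C -> C :=
  continuation (fun k s => Cpower (INR (k + 1)) (- s)%C) 1.

Definition zeta_H (N : nat) : C -> C :=
  continuation
    (fun k s => (RtoC (Binomial.C (N + k - 1) k)
                 * Cpower (INR (2 * k + N)) (- s))%C)
    (INR N).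

Definition det_H (N : nat) : C := Cexp (- C_derive (zeta_H N) (RtoC 0))%C.

(* Coefficient of [x ^ k] in the product of the factors [x - c], [c] in [l]. *)
Fixpoint prod_coef (l : list Z) (k : nat) : Z :=
  match l with
  | nil => if Nat.eqb k 0 then 1%Z else 0%Z
  | c :: l' =>
      ((match k with O => 0 | S j => prod_coef l' j end) - c * prod_coef l' k)%Z
  end.

Definition u (n k : nat) : Z :=
  prod_coef (map (fun i => (Z.of_nat i ^ 2)%Z) (seq 0 n)) k.

Definition v (n k : nat) : Z :=
  prod_coef (0%Z :: map (fun i => ((2 * Z.of_nat i - 1) ^ 2)%Z) (seq 1 (n - 1))) k.

Lemma prod_coef_spec (l : list Z) (x : R) (m : nat) :
  (length l <= m)%nat ->
  sum_n (fun k => IZR (prod_coef l k) * x ^ k) m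
  = fold_right (fun c p => (x - IZR c) * p) 1 l.
Proof.
  revert m; induction l as [|c l IH]; intros m Hm.
  - simpl fold_right. unfold sum_n. rewrite sum_Sn_m by lia.
    rewrite (sum_n_m_ext_loc _ (fun _ => 0)), sum_n_m_const.
    + unfold plus; simpl; ring.
    + intros [|k] Hk; [lia|]; simpl; ring.
  - simpl in Hm. destruct m as [|m]; [lia|].
    change (fold_right _ 1 (c :: l)) with
      ((x - IZR c) * fold_right (fun c p => (x - IZR c) * p) 1 l).
    rewrite Rmult_minus_distr_r.
    rewrite <- (IH m) at 1 by lia. rewrite <- (IH (S m)) by lia.
    rewrite <- (sum_n_mult_l (K := R_Ring) x), <- (sum_n_mult_l (K := R_Ring) (IZR c)).
    unfold sum_n. rewrite (sum_Sn_m _ 0 (S m)) by lia.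
    rewrite (sum_Sn_m (fun k => mult (IZR c) _) 0 (S m)) by lia.
    rewrite <- !sum_n_m_S.
    rewrite (sum_n_m_ext _ (fun k => plus (mult x (IZR (prod_coef l k) * x ^ k))
      (opp (mult (IZR c) (IZR (prod_coef l (S k)) * x ^ (S k)))))).
    + rewrite sum_n_m_plus.
      rewrite (sum_n_m_ext (fun k => opp _)
        (fun k => mult (- 1) (mult (IZR c) (IZR (prod_coef l (S k)) * x ^ (S k))))),
        (sum_n_m_mult_l (K := R_Ring) (-1)).
      * unfold plus, mult, opp; cbn [prod_coef pow]. rewrite minus_IZR, mult_IZR. simpl; ring.
      * intros k; unfold mult, opp; simpl; ring.
    + intros k; unfold plus, mult, opp; cbn [prod_coef pow].
      rewrite minus_IZR, mult_IZR. simpl; ring.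
Qed.

Lemma u_spec (n : nat) (x : R) : (1 <= n)%nat ->
  sum_n_m (fun k => IZR (u n k) * x ^ k) 1 n
  = fold_right (fun i p => (x - INR i ^ 2) * p) 1 (seq 0 n).
Proof.
  intros Hn.
  assert (H0 : u n 0 = 0%Z) by (destruct n as [|n]; [lia|reflexivity]).
  assert (H : sum_n (fun k => IZR (u n k) * x ^ k) n
              = sum_n_m (fun k => IZR (u n k) * x ^ k) 1 n).
  { unfold sum_n. rewrite sum_Sn_m by lia. rewrite H0.
    unfold plus; simpl; ring. }
  rewrite <- H. unfold u. rewrite prod_coef_spec.
  - induction (seq 0 n) as [|i l IH]; [reflexivity|].
    cbn [map fold_right]. rewrite IH, INR_IZR_INZ, pow_IZR. reflexivity.
  - rewrite length_map, length_seq; lia.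
Qed.

Lemma v_spec (n : nat) (x : R) : (1 <= n)%nat ->
  sum_n_m (fun k => IZR (v n k) * x ^ k) 1 n
  = x * fold_right (fun i p => (x - (2 * INR i - 1) ^ 2) * p) 1 (seq 1 (n - 1)).
Proof.
  intros Hn.
  assert (H : sum_n (fun k => IZR (v n k) * x ^ k) n
              = sum_n_m (fun k => IZR (v n k) * x ^ k) 1 n).
  { unfold sum_n. rewrite sum_Sn_m by lia.
    change (v n 0) with 0%Z.
    unfold plus; simpl; ring. }
  rewrite <- H. unfold v. rewrite prod_coef_spec.
  - cbn [fold_right]. rewrite Rminus_0_r. f_equal.
    induction (seq 1 (n - 1)) as [|i l IH]; [reflexivity|].
    cbn [map fold_right]. rewrite IH, INR_IZR_INZ.
    f_equal. f_equal. rewrite <- mult_IZR, <- minus_IZR, pow_IZR. reflexivity.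
  - simpl. rewrite length_map, length_seq; lia.
Qed.

(* Main.v *)
Require Import Defs.
From Stdlib Require Import Lra Lia Psatz.

(* Put [eta s = (s - 1) zeta s]. Expanding [(n - 1/2)^(1-s) - (n + 1/2)^(1-s)] in powers of
   [1/(2n)] by the binomial series and summing the telescoping differences over [n >= 1]
   gives, with the rising factorial [(x)_j],
     [sum_(k >= 0) (s-1)_(2k) / ((2k+1)! 4^k) eta (s + 2k) = 2^(s-1)].
   Solving for the term [k = 0] defines [eta] on the whole plane from its values further to
   the right, and shows that it is entire, real on the real axis, and that [eta 1 = 1],
   [eta 0 = 1/2] and [eta (-2p) = 0] for [p >= 1], hence [zeta 0 = -1/2] and
   [zeta (-2p) = 0].
   In half-planes of convergence the formulas for [zeta_H] are rearrangements of Dirichlet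
   series: the multiplicity is a polynomial in the eigenvalue whose coefficients are central
   factorial numbers, and it vanishes at the missing indices. The identity theorem for
   meromorphic functions extends them to the plane, and differentiating at [0] gives the
   determinants, where the imaginary parts vanish, so that [Clog] inverts [Cexp]. *)

(** * Double series *)

(** The encoding by total functions is the main obstacle. At a removable singularity with a wrong
    stored value a function is neither analytic nor has a pole, so [meromorphic] is not stable under
    sums and products. The finite sums of translates of [zeta] pass because distinct translates have
    their poles at distinct points, and the factor in front of a translate does not vanish at its
    pole unless it vanishes identically. The recursion compares half-integers because the symmetric
    difference keeps only odd powers: it moves in steps of 2, and at [s = 1 - N] the rising
    factorials cut it down to a finite sum. The coefficients decay like [4^(-k)] up to a power of
    [k], so linear growth of [eta (s + 2k)] in [k] is all that has to be controlled. The trivial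
    zeros serve the odd determinant. Differentiating [4 - 2^(2i-s)] at 0 yields multiples of
    [zeta (2 - 2i)], which vanish for [i >= 2]; for [i = 1] the factor [4 - 4^i] removes the
    derivative of [zeta] at 0 and leaves [zeta 0], the source of the closed term with [ln 2]. *)

Notation CS := (@is_series C_AbsRing C_NormedModule).

Lemma sum_n_R_S (a : nat -> R) n : sum_n a (S n) = sum_n a n + a (S n).
Proof. exact (sum_Sn a n). Qed.

Lemma sum_n_R_nonneg (a : nat -> R) n :
  (forall k, 0 <= a k) -> 0 <= sum_n a n.
Proof.
  intros H; induction n as [|n IH]; [rewrite sum_O; apply H|].
  rewrite sum_n_R_S; specialize (H (S n)); lra.
Qed.

Lemma sum_n_R_le (a b : nat -> R) n :
  (forall k, a k <= b k) -> sum_n a n <= sum_n b n.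
Proof.
  intros H; induction n as [|n IH]; [rewrite !sum_O; apply H|].
  rewrite !sum_n_R_S; specialize (H (S n)); lra.
Qed.

Lemma sum_n_R_scal (c : R) (a : nat -> R) n :
  sum_n (fun k => c * a k) n = c * sum_n a n.
Proof. exact (sum_n_mult_l (K := R_Ring) c a n). Qed.

Lemma ex_series_bounded (a : nat -> R) M :
  (forall k, 0 <= a k) -> (forall n, sum_n a n <= M) -> ex_series a.
Proof.
  intros H0 HM.
  destruct (ex_finite_lim_seq_incr (sum_n a) M) as [l Hl].
  - intros n. rewrite sum_n_R_S. specialize (H0 (S n)); lra.
  - exact HM.
  - exists l. exact Hl.
Qed.

Lemma sum_n_le_series (a : nat -> R) l n :
  (forall k, 0 <= a k) -> is_series a l -> sum_n a n <= l.
Proof.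
  intros H0 Hl. apply (is_lim_seq_incr_compare (sum_n a) l).
  - exact Hl.
  - intros m. rewrite sum_n_R_S. specialize (H0 (S m)); lra.
Qed.

Lemma series_le_bound (a : nat -> R) l M :
  (forall n, sum_n a n <= M) -> is_series a l -> l <= M.
Proof.
  intros H Hl.
  apply (is_lim_seq_le (sum_n a) (fun _ => M) l M H); [exact Hl|apply is_lim_seq_const].
Qed.

Lemma series_nonneg (a : nat -> R) l :
  (forall k, 0 <= a k) -> is_series a l -> 0 <= l.
Proof.
  intros H Hl. apply Rle_trans with (sum_n a 0); [|now apply sum_n_le_series].
  rewrite sum_O. apply H.
Qed.

Lemma term_le_sum_n (a : nat -> R) n :
  (forall k, 0 <= a k) -> a n <= sum_n a n.
Proof.
  intros H. destruct n as [|n]; [rewrite sum_O; lra|].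
  rewrite sum_n_R_S. pose proof (sum_n_R_nonneg a n H). lra.
Qed.

Lemma is_series_R_ext (a b : nat -> R) l :
  (forall n, a n = b n) -> is_series a l -> is_series b l.
Proof. exact (is_series_ext a b l). Qed.

Lemma is_series_R_plus (a b : nat -> R) la lb :
  is_series a la -> is_series b lb -> is_series (fun k => a k + b k) (la + lb).
Proof. exact (is_series_plus a b la lb). Qed.

Lemma is_series_R_minus (a b : nat -> R) la lb :
  is_series a la -> is_series b lb -> is_series (fun k => a k - b k) (la - lb).
Proof. exact (is_series_minus a b la lb). Qed.

Lemma ex_series_R_le (a b : nat -> R) :
  (forall k, Rabs (a k) <= b k) -> ex_series b -> ex_series a.
Proof. exact (ex_series_le a b). Qed.

Lemma is_series_sum_n (a : nat -> nat -> R) (l : nat -> R) K :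
  (forall k, is_series (a k) (l k)) ->
  is_series (fun n => sum_n (fun k => a k n) K) (sum_n l K).
Proof.
  intros H. induction K as [|K IH].
  - rewrite sum_O. apply is_series_R_ext with (a 0%nat); [|apply H].
    intros n. now rewrite sum_O.
  - rewrite sum_n_R_S.
    apply is_series_R_ext with (fun n => sum_n (fun k => a k n) K + a (S K) n).
    + intros n. now rewrite sum_n_R_S.
    + now apply is_series_R_plus.
Qed.

(** Finitely many columns can be added inside the row series, so each partial sum of column sums is
    at most the total of the row sums. The same argument with rows and columns exchanged gives the
    opposite inequality. *)
Lemma tonelli_series (a : nat -> nat -> R) (M : nat -> R) :
  (forall n k, 0 <= a n k) ->
  (forall n K, sum_n (a n) K <= M n) -> ex_series M ->
  (forall k, ex_series (fun n => a n k)) /\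
  ex_series (fun n => Series (a n)) /\
  is_series (fun k => Series (fun n => a n k)) (Series (fun n => Series (a n))).
Proof.
  intros H0 HM HMs.
  assert (Hr : forall n, is_series (a n) (Series (a n))).
  { intros n. apply Series_correct, ex_series_bounded with (M n); auto. }
  assert (Hr0 : forall n, 0 <= Series (a n)).
  { intros n. apply (series_nonneg (a n)); auto. }
  assert (HrM : forall n, Series (a n) <= M n).
  { intros n. apply (series_le_bound (a n)); auto. }
  assert (Hrs : ex_series (fun n => Series (a n))).
  { apply ex_series_R_le with M; [|exact HMs].
    intros n. rewrite Rabs_pos_eq; auto. }
  assert (Hc : forall k, ex_series (fun n => a n k)).
  { intros k. apply ex_series_R_le with M; [|exact HMs].
    intros n. rewrite Rabs_pos_eq by auto.
    apply Rle_trans with (sum_n (a n) k); [|apply HM].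
    now apply term_le_sum_n. }
  pose proof (fun k => Series_correct _ (Hc k)) as Hc'.
  assert (Hc0 : forall k, 0 <= Series (fun n => a n k)).
  { intros k. apply (series_nonneg (fun n => a n k)); auto. }
  assert (Hup : forall K, sum_n (fun k => Series (fun n => a n k)) K
                          <= Series (fun n => Series (a n))).
  { intros K.
    pose proof (is_series_sum_n (fun k n => a n k) _ K Hc') as H.
    rewrite <- (is_series_unique _ _ H).
    apply Series_le; [|exact Hrs].
    intros n. split; [now apply sum_n_R_nonneg|].
    apply (sum_n_le_series (a n)); auto. }
  assert (He : ex_series (fun k => Series (fun n => a n k))).
  { apply ex_series_bounded with (Series (fun n => Series (a n))); auto. }
  split; [exact Hc|split; [exact Hrs|]].
  pose proof (Series_correct _ He) as He'.
  replace (Series (fun n => Series (a n)))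
    with (Series (fun k => Series (fun n => a n k))); [exact He'|].
  apply Rle_antisym.
  - now apply (series_le_bound _ _ _ Hup).
  - apply (series_le_bound (fun n => Series (a n))); [|now apply Series_correct].
    intros N.
    pose proof (is_series_sum_n a _ N Hr) as H.
    rewrite <- (is_series_unique _ _ H).
    apply Series_le; [|exact He].
    intros k. split; [now apply sum_n_R_nonneg|].
    apply (sum_n_le_series (fun n => a n k)); auto.
Qed.

(** Tonelli is applied to the nonnegative families [|a|] and [|a| - a], whose difference is [a]. *)
Lemma fubini_series (a : nat -> nat -> R) (M : nat -> R) :
  (forall n K, sum_n (fun k => Rabs (a n k)) K <= M n) -> ex_series M ->
  (forall k, ex_series (fun n => a n k)) /\
  ex_series (fun n => Series (a n)) /\
  is_series (fun k => Series (fun n => a n k)) (Series (fun n => Series (a n))).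
Proof.
  intros HM HMs.
  assert (H1 := tonelli_series (fun n k => Rabs (a n k)) M
                  (fun n k => Rabs_pos (a n k)) HM HMs).
  destruct H1 as (A1 & B1 & C1).
  assert (H2 : forall n k, 0 <= Rabs (a n k) - a n k <= 2 * Rabs (a n k)).
  { intros n k. pose proof (Rle_abs (a n k)). pose proof (Rle_abs (- a n k)).
    rewrite Rabs_Ropp in *. lra. }
  destruct (tonelli_series (fun n k => Rabs (a n k) - a n k) (fun n => 2 * M n))
    as (A2 & B2 & C2).
  { intros; apply H2. }
  { intros n K. apply Rle_trans with (sum_n (fun k => 2 * Rabs (a n k)) K).
    - apply sum_n_R_le; intros; apply H2.
    - rewrite sum_n_R_scal. specialize (HM n K); lra. }
  { exact (ex_series_scal 2 M HMs). }
  assert (Hra : forall n, ex_series (fun k => Rabs (a n k))).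
  { intros n. apply ex_series_bounded with (M n); [intros; apply Rabs_pos|apply HM]. }
  assert (Hr : forall n, Series (a n) = Series (fun k => Rabs (a n k))
                             - Series (fun k => Rabs (a n k) - a n k)).
  { intros n. rewrite <- Series_minus; [|apply Hra|].
    - apply Series_ext; intros; ring.
    - apply ex_series_R_le with (fun k => 2 * Rabs (a n k)).
      + intros k. rewrite Rabs_pos_eq; apply H2.
      + exact (ex_series_scal 2 _ (Hra n)). }
  assert (Hc : forall k, is_series (fun n => a n k)
     (Series (fun n => Rabs (a n k)) - Series (fun n => Rabs (a n k) - a n k))).
  { intros k.
    apply is_series_R_ext with (fun n => Rabs (a n k) - (Rabs (a n k) - a n k));
      [intros; ring|].
    apply is_series_R_minus; apply Series_correct; auto. }
  split; [intros k; eexists; apply Hc|].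
  assert (Hs : is_series (fun n => Series (a n))
     (Series (fun n => Series (fun k => Rabs (a n k)))
      - Series (fun n => Series (fun k => Rabs (a n k) - a n k)))).
  { apply is_series_R_ext with (fun n => Series (fun k => Rabs (a n k))
                             - Series (fun k => Rabs (a n k) - a n k)).
    - intros n; symmetry; apply Hr.
    - apply is_series_R_minus; now apply Series_correct. }
  split; [eexists; exact Hs|].
  rewrite (is_series_unique _ _ Hs).
  apply is_series_R_ext with (fun k => Series (fun n => Rabs (a n k))
                             - Series (fun n => Rabs (a n k) - a n k)).
  - intros k. symmetry. apply is_series_unique, Hc.
  - now apply is_series_R_minus.
Qed.

(** * Series of complex numbers through their components *)

Lemma sum_n_fst (a : nat -> C) n :
  fst (sum_n (G := C_AbelianMonoid) a n) = sum_n (fun k => fst (a k)) n.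
Proof.
  induction n as [|n IH]; [now rewrite !sum_O|].
  rewrite sum_n_R_S, sum_Sn, <- IH. reflexivity.
Qed.

Lemma sum_n_snd (a : nat -> C) n :
  snd (sum_n (G := C_AbelianMonoid) a n) = sum_n (fun k => snd (a k)) n.
Proof.
  induction n as [|n IH]; [now rewrite !sum_O|].
  rewrite sum_n_R_S, sum_Sn, <- IH. reflexivity.
Qed.

Lemma CS_components (a : nat -> C) (l : C) :
  CS a l <-> is_series (fun k => fst (a k)) (fst l) /\
             is_series (fun k => snd (a k)) (snd l).
Proof.
  unfold is_series. split.
  - intros H. split; intros P [e He].
    + assert (Hl : locally (T := C_UniformSpace) l (fun z => P (fst z))).
      { exists e. intros z [Hz _]. now apply He. }
      destruct (H _ Hl) as [N HN]. exists N. intros n Hn.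
      rewrite <- sum_n_fst. exact (HN n Hn).
    + assert (Hl : locally (T := C_UniformSpace) l (fun z => P (snd z))).
      { exists e. intros z [_ Hz]. now apply He. }
      destruct (H _ Hl) as [N HN]. exists N. intros n Hn.
      rewrite <- sum_n_snd. exact (HN n Hn).
  - intros [H1 H2] P [e He].
    assert (L1 : locally (T := R_UniformSpace) (fst l) (ball (fst l) e)) by now exists e.
    assert (L2 : locally (T := R_UniformSpace) (snd l) (ball (snd l) e)) by now exists e.
    destruct (H1 _ L1) as [N1 B1], (H2 _ L2) as [N2 B2].
    exists (max N1 N2). intros n Hn. apply He. split.
    + specialize (B1 n ltac:(lia)). rewrite <- sum_n_fst in B1. exact B1.
    + specialize (B2 n ltac:(lia)). rewrite <- sum_n_snd in B2. exact B2.
Qed.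

(** Total, because [Series] is; this lets a function be defined by a series before convergence is
    known, as in [eta_iter]. *)
Definition CSeries (a : nat -> C) : C :=
  (Series (fun k => fst (a k)), Series (fun k => snd (a k))).

Lemma CS_unique (a : nat -> C) (l : C) : CS a l -> CSeries a = l.
Proof.
  intros [H1 H2]%CS_components. unfold CSeries.
  rewrite (is_series_unique _ _ H1), (is_series_unique _ _ H2). now destruct l.
Qed.

Lemma CS_inj (a : nat -> C) (l l' : C) : CS a l -> CS a l' -> l = l'.
Proof. intros H H'. now rewrite <- (CS_unique _ _ H), <- (CS_unique _ _ H'). Qed.

Lemma CSeries_ext (a b : nat -> C) : (forall k, a k = b k) -> CSeries a = CSeries b.
Proof. intros H. unfold CSeries. f_equal; apply Series_ext; intros; now rewrite H. Qed.

Lemma CS_ext (a b : nat -> C) (l : C) : (forall k, a k = b k) -> CS a l -> CS b l.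
Proof. exact (is_series_ext a b l). Qed.

Lemma CS_plus (a b : nat -> C) (la lb : C) :
  CS a la -> CS b lb -> CS (fun k => a k + b k)%C (la + lb)%C.
Proof. exact (is_series_plus a b la lb). Qed.

Lemma CS_minus (a b : nat -> C) (la lb : C) :
  CS a la -> CS b lb -> CS (fun k => a k - b k)%C (la - lb)%C.
Proof. exact (is_series_minus a b la lb). Qed.

Lemma CS_scal (c : C) (a : nat -> C) (l : C) : CS a l -> CS (fun k => c * a k)%C (c * l)%C.
Proof. exact (is_series_scal (K := C_AbsRing) (V := C_NormedModule) c a l). Qed.

Lemma CS_zero : CS (fun _ => RtoC 0) (RtoC 0).
Proof.
  apply CS_components; simpl.
  assert (H : is_series (fun _ : nat => 0) 0).
  { apply (is_lim_seq_ext (fun _ => 0) (sum_n (fun _ : nat => 0)) 0);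
      [|apply is_lim_seq_const].
    intros n. induction n as [|n IH]; [now rewrite sum_O|].
    rewrite sum_n_R_S, <- IH. ring. }
  split; exact H.
Qed.

Lemma snd_le_Cmod (z : C) : Rabs (snd z) <= Cmod z.
Proof. eapply Rle_trans; [apply Rmax_r|apply Rmax_Cmod]. Qed.

Lemma fst_le_Cmod (z : C) : Rabs (fst z) <= Cmod z.
Proof. eapply Rle_trans; [apply Rmax_l|apply Rmax_Cmod]. Qed.

Lemma CS_abs (a : nat -> C) :
  ex_series (fun k => Cmod (a k)) -> CS a (CSeries a).
Proof.
  intros H. apply CS_components; split; apply Series_correct.
  - apply ex_series_R_le with (fun k => Cmod (a k)); [intros; apply fst_le_Cmod|exact H].
  - apply ex_series_R_le with (fun k => Cmod (a k)); [intros; apply snd_le_Cmod|exact H].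
Qed.

(* Multiplying by [Cconj l] reduces the bound to a series of reals. *)
Lemma Cmod_CS_le (a : nat -> C) (l : C) M :
  CS a l -> (forall n, sum_n (fun k => Cmod (a k)) n <= M) -> Cmod l <= M.
Proof.
  intros H HM.
  destruct (Req_dec (Cmod l) 0) as [H0|H0].
  { rewrite H0. apply Rle_trans with (sum_n (fun k => Cmod (a k)) 0); [|apply HM].
    rewrite sum_O. apply Cmod_ge_0. }
  assert (Hp : 0 < Cmod l) by (pose proof (Cmod_ge_0 l); lra).
  assert (Hs := CS_scal (Cconj l) _ _ H).
  apply CS_components in Hs. destruct Hs as [Hs _].
  assert (Hle : fst (Cconj l * l)%C <= Cmod l * M).
  { refine (series_le_bound _ _ _ _ Hs). intros n.
    apply Rle_trans with (sum_n (fun k => Cmod l * Cmod (a k)) n).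
    - apply sum_n_R_le. intros k. eapply Rle_trans; [apply Rle_abs|].
      eapply Rle_trans; [apply fst_le_Cmod|].
      rewrite Cmod_mult, Cmod_conj. apply Rle_refl.
    - rewrite sum_n_R_scal. apply Rmult_le_compat_l; [lra|apply HM]. }
  assert (E : fst (Cconj l * l)%C = Cmod l ^ 2).
  { rewrite Cmod2_alt. unfold Re, Im. simpl. ring. }
  rewrite E in Hle. nra.
Qed.

(** Fubini on real and imaginary parts. The last clause, which comes from Tonelli on the moduli, is
    what gives the rearranged coefficients in [pser_series] a majorant again. *)
Lemma fubini_CS (a : nat -> nat -> C) (M : nat -> R) (s : nat -> C) :
  (forall n K, sum_n (fun k => Cmod (a n k)) K <= M n) -> ex_series M ->
  (forall n, CS (a n) (s n)) ->
  (forall k, CS (fun n => a n k) (CSeries (fun n => a n k))) /\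
  CS s (CSeries s) /\
  CS (fun k => CSeries (fun n => a n k)) (CSeries s) /\
  (forall K, sum_n (fun k => Cmod (CSeries (fun n => a n k))) K <= Series M).
Proof.
  intros HM HMs Hs.
  assert (H1 : forall n K, sum_n (fun k => Rabs (fst (a n k))) K <= M n).
  { intros n K. eapply Rle_trans; [|apply (HM n K)].
    apply sum_n_R_le; intros; apply fst_le_Cmod. }
  assert (H2 : forall n K, sum_n (fun k => Rabs (snd (a n k))) K <= M n).
  { intros n K. eapply Rle_trans; [|apply (HM n K)].
    apply sum_n_R_le; intros; apply snd_le_Cmod. }
  destruct (fubini_series _ M H1 HMs) as (A1 & B1 & C1).
  destruct (fubini_series _ M H2 HMs) as (A2 & B2 & C2).
  assert (E1 : forall n, Series (fun k => fst (a n k)) = fst (s n)).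
  { intros n. apply is_series_unique. now destruct (proj1 (CS_components _ _) (Hs n)). }
  assert (E2 : forall n, Series (fun k => snd (a n k)) = snd (s n)).
  { intros n. apply is_series_unique. now destruct (proj1 (CS_components _ _) (Hs n)). }
  assert (Hcol : forall k, CS (fun n => a n k) (CSeries (fun n => a n k))).
  { intros k. apply CS_components; split; apply Series_correct; [apply A1|apply A2]. }
  split; [exact Hcol|split; [|split]].
  - apply CS_components; split; apply Series_correct.
    + apply (ex_series_ext _ _ E1 B1).
    + apply (ex_series_ext _ _ E2 B2).
  - apply CS_components; split; simpl.
    + rewrite <- (Series_ext _ _ E1). exact C1.
    + rewrite <- (Series_ext _ _ E2). exact C2.
  - intros K.
    destruct (tonelli_series (fun n k => Cmod (a n k)) M) as (A3 & B3 & C3);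
      [intros; apply Cmod_ge_0|exact HM|exact HMs|].
    apply Rle_trans with (Series (fun n => sum_n (fun k => Cmod (a n k)) K)).
    + pose proof (is_series_sum_n (fun k n => Cmod (a n k)) _ K
                    (fun k => Series_correct _ (A3 k))) as H.
      rewrite (is_series_unique _ _ H).
      apply sum_n_R_le. intros k. apply (Cmod_CS_le _ _ _ (Hcol k)).
      intros n. apply sum_n_le_series; [intros; apply Cmod_ge_0|].
      now apply Series_correct.
    + apply Series_le; [|exact HMs]. intros n. split; [|apply HM].
      apply sum_n_R_nonneg; intros; apply Cmod_ge_0.
Qed.

(** * Power series with a majorant *)

(* The majorant [sum |c_k| r^k] is subadditive and submultiplicative; this replaces uniform
   convergence on discs and Cauchy estimates. *)
Definition pser (f : C -> C) (a : C) (r M : R) : Prop :=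
  0 < r /\ exists c : nat -> C,
    (forall K, sum_n (fun k => Cmod (c k) * r ^ k) K <= M) /\
    forall z, Cmod (z - a) < r -> CS (fun k => c k * (z - a) ^ k)%C (f z).

Lemma C_pow_n (z : C) k : @pow_n C_AbsRing z k = (z ^ k)%C.
Proof.
  induction k as [|k IH]; [reflexivity|].
  exact (f_equal (Cmult z) IH).
Qed.

Lemma is_pseries_CS (c : nat -> C) (z l : C) :
  @is_pseries C_AbsRing C_NormedModule c z l <-> CS (fun k => c k * z ^ k)%C l.
Proof.
  assert (E : forall k, @scal C_AbsRing C_NormedModule (pow_n z k) (c k)
                        = (c k * z ^ k)%C).
  { intros k. transitivity (z ^ k * c k)%C; [|apply Cmult_comm].
    exact (f_equal (fun w => Cmult w (c k)) (C_pow_n z k)). }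
  split; apply CS_ext; intros k; [|symmetry]; apply E.
Qed.

Lemma pser_analytic f a r M : pser f a r M -> analytic_at f a.
Proof.
  intros (Hr & c & _ & H). exists c, r. split; [exact Hr|]. intros z Hz.
  now apply is_pseries_CS, H.
Qed.

Lemma Cmod_minus_self a : Cmod (a - a) = 0.
Proof. replace (a - a)%C with (RtoC 0) by ring. apply Cmod_0. Qed.

Lemma geometric_sum_le K : sum_n (fun k => (1/2) ^ k) K <= 2.
Proof.
  assert (H : sum_n (fun k => (1/2) ^ k) K = 2 - (1/2) ^ K).
  { induction K as [|K IH]; [rewrite sum_O; simpl; lra|].
    rewrite sum_n_R_S, IH. simpl. lra. }
  assert (0 < (1/2) ^ K) by (apply pow_lt; lra). lra.
Qed.

(** Convergence at distance [r/2] only bounds the terms there, by some [B]. Halving the radius once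
    more brings in the factor [(1/2)^k], so the majorant at [r/4] is at most [2 B]. *)
Lemma analytic_pser f a : analytic_at f a -> exists r M, pser f a r M.
Proof.
  intros (c & r & Hr & H).
  assert (Hc : CS (fun k => c k * RtoC (r/2) ^ k)%C (f (a + RtoC (r/2))%C)).
  { assert (E : (a + RtoC (r/2) - a)%C = RtoC (r/2)) by ring.
    specialize (H (a + RtoC (r/2))%C). rewrite E in H.
    assert (Hlt : Cmod (RtoC (r/2)) < r) by (rewrite Cmod_R, Rabs_pos_eq; lra).
    now apply is_pseries_CS, H. }
  assert (exists B, 0 <= B /\ forall k, Cmod (c k) * (r/2) ^ k <= B) as (B & HB0 & HB).
  { apply CS_components in Hc as [H1 H2].
    assert (forall (x : nat -> R) l, is_series x l ->
              exists B, 0 <= B /\ forall k, Rabs (x k) <= B) as Hbd.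
    { intros x l Hx.
      assert (E' : is_lim_seq x 0) by (apply ex_series_lim_0; now exists l).
      apply is_lim_seq_Reals in E'.
      destruct (maj_by_pos x) as (B & HB & HB'); [exists 0; exact E'|].
      exists B. split; [lra|]. exact HB'. }
    destruct (Hbd _ _ H1) as (B1 & HB1 & HB1'), (Hbd _ _ H2) as (B2 & HB2 & HB2').
    exists (sqrt 2 * (B1 + B2)). split.
    { apply Rmult_le_pos; [apply sqrt_pos|lra]. }
    intros k. specialize (HB1' k). specialize (HB2' k).
    assert (E : Cmod (c k) * (r/2) ^ k = Cmod (c k * RtoC (r/2) ^ k)%C).
    { rewrite Cmod_mult, Cmod_pow, Cmod_R, (Rabs_pos_eq (r/2)) by lra. reflexivity. }
    rewrite E. eapply Rle_trans; [apply Cmod_2Rmax|].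
    apply Rmult_le_compat_l; [apply sqrt_pos|]. apply Rmax_lub; lra. }
  exists (r/4), (B * 2). split; [lra|]. exists c. split.
  - intros K. apply Rle_trans with (sum_n (fun k => B * (1/2) ^ k) K).
    + apply sum_n_R_le. intros k.
      replace (r/4) with (r/2 * (1/2)) by field. rewrite Rpow_mult_distr, <- Rmult_assoc.
      apply Rmult_le_compat_r; [apply pow_le; lra|apply HB].
    + rewrite sum_n_R_scal. apply Rmult_le_compat_l; [lra|apply geometric_sum_le].
  - intros z Hz. assert (Hz' : Cmod (z - a) < r) by lra.
    now apply is_pseries_CS, H.
Qed.

Lemma pser_weaken f a r r' M M' :
  0 < r' <= r -> M <= M' -> pser f a r M -> pser f a r' M'.
Proof.
  intros Hr HM (_ & c & H1 & H2). split; [lra|]. exists c. split.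
  - intros K. apply Rle_trans with (2 := HM). eapply Rle_trans; [|apply (H1 K)].
    apply sum_n_R_le. intros k. apply Rmult_le_compat_l; [apply Cmod_ge_0|].
    apply pow_incr; lra.
  - intros z Hz. apply H2. lra.
Qed.

Lemma pser_ext f g a r M :
  (forall z, Cmod (z - a) < r -> f z = g z) -> pser f a r M -> pser g a r M.
Proof.
  intros E (Hr & c & H1 & H2). split; [exact Hr|]. exists c. split; [exact H1|].
  intros z Hz. rewrite <- (E z Hz). now apply H2.
Qed.

Lemma pser_nonneg f a r M : pser f a r M -> 0 <= M.
Proof.
  intros (_ & c & H1 & _). specialize (H1 0%nat). rewrite sum_O in H1.
  pose proof (Cmod_ge_0 (c 0%nat)). simpl in H1. lra.
Qed.

Lemma Cmod_term_le (c z : C) r k : Cmod z <= r -> Cmod (c * z ^ k) <= Cmod c * r ^ k.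
Proof.
  intros H. rewrite Cmod_mult, Cmod_pow. apply Rmult_le_compat_l; [apply Cmod_ge_0|].
  apply pow_incr. split; [apply Cmod_ge_0|exact H].
Qed.

Lemma pser_bound f a r M z : pser f a r M -> Cmod (z - a) < r -> Cmod (f z) <= M.
Proof.
  intros (_ & c & H1 & H2) Hz. apply (Cmod_CS_le _ _ _ (H2 z Hz)).
  intros n. eapply Rle_trans; [|apply (H1 n)]. apply sum_n_R_le. intros k.
  apply Cmod_term_le. lra.
Qed.

(** The Weierstrass theorem on series of analytic functions: with summable majorants the double
    series of coefficients may be summed in the other order. *)
Lemma pser_series (F : nat -> C -> C) a r (M : nat -> R) :
  (forall n, pser (F n) a r (M n)) -> ex_series M ->
  pser (fun z => CSeries (fun n => F n z)) a r (Series M) /\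
  (forall z, Cmod (z - a) < r ->
     CS (fun n => F n z) (CSeries (fun n => F n z))).
Proof.
  intros HF HM. assert (Hr : 0 < r) by apply (HF 0%nat).
  assert (HF' := fun n => proj2 (HF n)).
  set (c := fun n => proj1_sig (constructive_indefinite_description _ (HF' n))).
  assert (H1 : forall n K, sum_n (fun k => Cmod (c n k) * r ^ k) K <= M n).
  { intros n. unfold c. destruct (constructive_indefinite_description _ (HF' n)); simpl.
    tauto. }
  assert (H2 : forall n z, Cmod (z - a) < r ->
            CS (fun k => c n k * (z - a) ^ k)%C (F n z)).
  { intros n. unfold c. destruct (constructive_indefinite_description _ (HF' n)); simpl.
    tauto. }
  clearbody c. clear HF HF'.
  assert (Hr' : RtoC r <> 0) by (intros E; apply RtoC_inj in E; lra).
  assert (Hmod : forall n k, Cmod (c n k * RtoC r ^ k) = Cmod (c n k) * r ^ k).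
  { intros n k. rewrite Cmod_mult, Cmod_pow, Cmod_R, Rabs_pos_eq; lra. }
  assert (Habs : forall n K, sum_n (fun k => Cmod (c n k * RtoC r ^ k)) K <= M n).
  { intros n K. eapply Rle_trans; [|apply (H1 n K)]. apply sum_n_R_le.
    intros k. rewrite Hmod. lra. }
  (* Fubini is used twice: at [r], where the majorants are attained, to form the new coefficients
     and bound them; below at [z], to identify the sum. The coefficients carry [r ^ k] here and are
     divided by it afterwards. *)
  destruct (fubini_CS (fun n k => c n k * RtoC r ^ k)%C M
              (fun n => CSeries (fun k => c n k * RtoC r ^ k)%C) Habs HM)
    as (Hcol & _ & _ & Hsum).
  { intros n. apply CS_abs, ex_series_bounded with (M n); [intros; apply Cmod_ge_0|].
    apply Habs. }
  assert (Hz : forall z, Cmod (z - a) < r ->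
     CS (fun n => F n z) (CSeries (fun n => F n z)) /\
     CS (fun k => CSeries (fun n => c n k * (z - a) ^ k)%C) (CSeries (fun n => F n z))).
  { intros z Hz.
    destruct (fubini_CS (fun n k => c n k * (z - a) ^ k)%C M (fun n => F n z))
      as (_ & A & B & _); [|exact HM|intros; now apply H2|now split].
    intros n K. eapply Rle_trans; [|apply (H1 n K)]. apply sum_n_R_le.
    intros k. apply Cmod_term_le. lra. }
  split; [|intros z Hz'; now apply Hz].
  split; [exact Hr|].
  exists (fun k => CSeries (fun n => c n k * RtoC r ^ k)%C / RtoC r ^ k)%C. split.
  - intros K. eapply Rle_trans; [|apply (Hsum K)]. apply sum_n_R_le. intros k.
    rewrite Cmod_div by now apply Cpow_nz.
    rewrite Cmod_pow, Cmod_R, Rabs_pos_eq by lra.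
    assert (0 < r ^ k) by now apply pow_lt.
    right. field. lra.
  - intros z Hz'. eapply CS_ext; [|apply (proj2 (Hz z Hz'))].
    intros k. cbv beta. apply CS_unique.
    pose proof (CS_scal ((z - a) ^ k / RtoC r ^ k)%C _ _ (Hcol k)) as Hk.
    assert (Hrk : (RtoC r ^ k)%C <> 0) by now apply Cpow_nz.
    replace (CSeries (fun n => c n k * RtoC r ^ k) / RtoC r ^ k * (z - a) ^ k)%C
      with ((z - a) ^ k / RtoC r ^ k * CSeries (fun n => c n k * RtoC r ^ k))%C
      by (field; exact Hrk).
    eapply CS_ext; [|exact Hk]. intros n. cbv beta. field. exact Hrk.
Qed.

Lemma pser_scal (w : C) f a r M :
  pser f a r M -> pser (fun z => w * f z)%C a r (Cmod w * M).
Proof.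
  intros (Hr & c & H1 & H2). split; [exact Hr|]. exists (fun k => w * c k)%C. split.
  - intros K. apply Rle_trans with (Cmod w * sum_n (fun k => Cmod (c k) * r ^ k) K).
    + rewrite <- sum_n_R_scal. apply sum_n_R_le. intros k. rewrite Cmod_mult. lra.
    + apply Rmult_le_compat_l; [apply Cmod_ge_0|apply H1].
  - intros z Hz. eapply CS_ext; [|apply (CS_scal w _ _ (H2 z Hz))].
    intros k. cbv beta. ring.
Qed.

Lemma sum_n_R_plus (a b : nat -> R) n :
  sum_n (fun k => a k + b k) n = sum_n a n + sum_n b n.
Proof. exact (sum_n_plus a b n). Qed.

Lemma pser_plus f g a r M N :
  pser f a r M -> pser g a r N -> pser (fun z => f z + g z)%C a r (M + N).
Proof.
  intros (Hr & c & H1 & H2) (_ & d & H3 & H4). split; [exact Hr|].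
  exists (fun k => c k + d k)%C. split.
  - intros K.
    apply Rle_trans with (sum_n (fun k => Cmod (c k) * r ^ k + Cmod (d k) * r ^ k) K).
    + apply sum_n_R_le. intros k. rewrite <- Rmult_plus_distr_r.
      apply Rmult_le_compat_r; [apply pow_le; lra|apply Cmod_triangle].
    + rewrite sum_n_R_plus. specialize (H1 K). specialize (H3 K). lra.
  - intros z Hz. eapply CS_ext; [|apply (CS_plus _ _ _ _ (H2 z Hz) (H4 z Hz))].
    intros k. cbv beta. ring.
Qed.

Lemma CS_decr (a : nat -> C) (l : C) :
  CS (fun k => a (S k)) l -> CS a (a 0%nat + l)%C.
Proof.
  intros H. apply (is_series_decr_1 (K := C_AbsRing) (V := C_NormedModule) a).
  refine (eq_ind l (fun x => CS (fun k => a (S k)) x) H _ _).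
  change (l = a 0%nat + l + - a 0%nat)%C. ring.
Qed.

Lemma CS_incr (a : nat -> C) (l : C) :
  CS a l -> CS (fun k => a (S k)) (l - a 0%nat)%C.
Proof.
  intros H. apply (is_series_incr_1 (K := C_AbsRing) (V := C_NormedModule) a).
  refine (eq_ind l (fun x => CS a x) H _ _).
  change (l = l - a 0%nat + a 0%nat)%C. ring.
Qed.

Lemma sum_n_R_shift (a : nat -> R) n :
  sum_n a (S n) = a 0%nat + sum_n (fun k => a (S k)) n :> R.
Proof.
  induction n as [|n IH]; [now rewrite sum_n_R_S, !sum_O|].
  rewrite sum_n_R_S, IH, sum_n_R_S. ring.
Qed.

Lemma CS_single (w : C) : CS (fun k => match k with O => w | _ => RtoC 0 end) w.
Proof.
  rewrite <- (Cplus_0_r w) at 1.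
  apply (CS_decr (fun k => match k with O => w | _ => RtoC 0 end)), CS_zero.
Qed.

Lemma pser_const (w : C) a r : 0 < r -> pser (fun _ => w) a r (Cmod w).
Proof.
  intros Hr. split; [exact Hr|].
  exists (fun k => match k with O => w | _ => RtoC 0 end). split.
  - intros K. right. induction K as [|K IH]; [rewrite sum_O; simpl; ring|].
    rewrite sum_n_R_S, IH, Cmod_0. ring.
  - intros z _. eapply CS_ext; [|apply CS_single].
    intros [|k]; simpl; ring.
Qed.

Lemma pser_shift f a r M :
  pser f a r M -> pser (fun z => (z - a) * f z)%C a r (r * M).
Proof.
  intros (Hr & c & H1 & H2). split; [exact Hr|].
  assert (HM := pser_nonneg _ _ _ _ (conj Hr (ex_intro _ c (conj H1 H2)))).
  exists (fun k => match k with O => RtoC 0 | S j => c j end). split.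
  - intros [|K].
    + rewrite sum_O, Cmod_0, Rmult_0_l. nra.
    + rewrite sum_n_R_shift, Cmod_0, Rmult_0_l, Rplus_0_l.
      apply Rle_trans with (r * sum_n (fun k => Cmod (c k) * r ^ k) K).
      * rewrite <- sum_n_R_scal. apply sum_n_R_le. intros k. simpl. lra.
      * apply Rmult_le_compat_l; [lra|apply H1].
  - intros z Hz.
    set (d := fun k => (match k with O => RtoC 0 | S j => c j end * (z - a) ^ k)%C).
    replace ((z - a) * f z)%C with (d 0%nat + (z - a) * f z)%C by (unfold d; ring).
    apply CS_decr. eapply CS_ext; [|apply (CS_scal (z - a)%C _ _ (H2 z Hz))].
    intros k. unfold d. rewrite Cpow_S. ring.
Qed.

Lemma pser_lin (b : C) a r : 0 < r -> pser (fun z => z - b)%C a r (Cmod (a - b) + r).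
Proof.
  intros Hr.
  apply pser_ext with (fun z => (a - b) + (z - a) * 1)%C; [intros; ring|].
  apply pser_plus; [now apply pser_const|].
  replace r with (r * Cmod 1) at 2 by (rewrite Cmod_1; ring).
  now apply (pser_shift (fun _ => RtoC 1)), pser_const.
Qed.

Lemma pser_pow f a r M k : pser f a r M ->
  pser (fun z => (z - a) ^ k * f z)%C a r (r ^ k * M).
Proof.
  intros H. induction k as [|k IH].
  - apply pser_ext with f; [intros; simpl; ring|]. simpl. now rewrite Rmult_1_l.
  - apply pser_ext with (fun z => (z - a) * ((z - a) ^ k * f z))%C;
      [intros; rewrite Cpow_S; ring|].
    simpl. rewrite Rmult_assoc. now apply pser_shift.
Qed.

(** The product is the series of the functions [c n * (z - a) ^ n * g z], each with majorant
    [|c n| r^n N]. [pser_series] thus takes the place of the Cauchy product. *)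
Lemma pser_mult f g a r M N :
  pser f a r M -> pser g a r N -> pser (fun z => f z * g z)%C a r (M * N).
Proof.
  intros Hf Hg. assert (HN := pser_nonneg _ _ _ _ Hg).
  destruct Hf as (Hr & c & H1 & H2).
  assert (Hn : forall n, 0 <= Cmod (c n) * r ^ n).
  { intros n. apply Rmult_le_pos; [apply Cmod_ge_0|apply pow_le; lra]. }
  assert (He : ex_series (fun n => Cmod (c n) * r ^ n)).
  { apply ex_series_bounded with M; auto. }
  destruct (pser_series (fun n z => c n * ((z - a) ^ n * g z))%C a r
              (fun n => Cmod (c n) * r ^ n * N)) as [H _].
  - intros n. rewrite Rmult_assoc. now apply pser_scal, pser_pow.
  - now apply ex_series_scal_r.
  - apply pser_ext with (fun z => CSeries (fun n => c n * ((z - a) ^ n * g z))%C).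
    + intros z Hz. apply CS_unique. rewrite Cmult_comm.
      eapply CS_ext; [|apply (CS_scal (g z) _ _ (H2 z Hz))]. intros; cbv beta; ring.
    + eapply pser_weaken; [| |exact H]; [lra|].
      rewrite Series_scal_r. apply Rmult_le_compat_r; [exact HN|].
      apply (series_le_bound _ _ _ H1). now apply Series_correct.
Qed.

Lemma CS_at_center (c : nat -> C) a : CS (fun k => c k * (a - a) ^ k)%C (c 0%nat).
Proof.
  eapply CS_ext; [|apply (CS_single (c 0%nat))].
  intros [|k]; cbv beta; [simpl; ring|]. rewrite Cpow_S. ring.
Qed.

(** The quotient is the series with its first coefficient dropped and the others shifted. Its value
    at the centre is recorded because it is the derivative of [f] there; [has_der_Cpower_opp] reads
    it off. *)
Lemma pser_div_coef (c : nat -> C) f a r M : 0 < r ->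
  (forall K, sum_n (fun k => Cmod (c k) * r ^ k) K <= M) ->
  (forall z, Cmod (z - a) < r -> CS (fun k => c k * (z - a) ^ k)%C (f z)) ->
  exists g, pser g a r (M / r) /\ g a = c 1%nat /\
    forall z, Cmod (z - a) < r -> f z = (f a + (z - a) * g z)%C.
Proof.
  intros Hr H1 H2.
  exists (fun z => CSeries (fun k => c (S k) * (z - a) ^ k)%C).
  assert (Hb : forall K, sum_n (fun k => Cmod (c (S k)) * r ^ k) K <= M / r).
  { intros K. apply Rmult_le_reg_l with r; [exact Hr|].
    replace (r * (M / r)) with M by (field; lra).
    rewrite <- sum_n_R_scal. apply Rle_trans with (2 := H1 (S K)).
    rewrite sum_n_R_shift. pose proof (Cmod_ge_0 (c 0%nat)).
    apply Rle_trans with (sum_n (fun k => Cmod (c (S k)) * r ^ S k) K).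
    - apply sum_n_R_le. intros k. simpl. lra.
    - simpl (r ^ 0). lra. }
  assert (Hc : forall z, Cmod (z - a) < r ->
     CS (fun k => c (S k) * (z - a) ^ k)%C (CSeries (fun k => c (S k) * (z - a) ^ k)%C)).
  { intros z Hz. apply CS_abs, ex_series_bounded with (M / r); [intros; apply Cmod_ge_0|].
    intros n. eapply Rle_trans; [|apply (Hb n)]. apply sum_n_R_le. intros k.
    apply Cmod_term_le. lra. }
  split; [|split].
  - split; [exact Hr|]. exists (fun k => c (S k)). now split.
  - apply CS_unique, (CS_at_center (fun k => c (S k))).
  - intros z Hz. apply (CS_inj _ _ _ (H2 z Hz)).
    assert (H0 : f a = c 0%nat).
    { specialize (H2 a). rewrite Cmod_minus_self in H2.
      exact (CS_inj _ _ _ (H2 Hr) (CS_at_center c a)). }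
    rewrite H0.
    replace (c 0%nat) with (c 0%nat * (z - a) ^ 0)%C by (simpl; ring).
    apply (CS_decr (fun k => c k * (z - a) ^ k)%C).
    eapply CS_ext; [|apply (CS_scal (z - a)%C _ _ (Hc z Hz))].
    intros k. cbv beta. rewrite Cpow_S. ring.
Qed.

Lemma pser_div f a r M : pser f a r M ->
  exists g, pser g a r (M / r) /\
    forall z, Cmod (z - a) < r -> f z = (f a + (z - a) * g z)%C.
Proof.
  intros (Hr & c & H1 & H2).
  destruct (pser_div_coef c f a r M Hr H1 H2) as (g & Hg & _ & E). now exists g.
Qed.

(** * Stability of analyticity at a point *)

Lemma analytic_ext_loc f g a d : 0 < d ->
  (forall z, Cmod (z - a) < d -> f z = g z) -> analytic_at f a -> analytic_at g a.
Proof.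
  intros Hd E (c & r & Hr & H). exists c, (Rmin r d).
  split; [now apply Rmin_glb_lt|]. intros z Hz.
  rewrite <- E; [apply H|]; eapply Rlt_le_trans; try exact Hz; [apply Rmin_l|apply Rmin_r].
Qed.

Lemma analytic_pser2 f g a : analytic_at f a -> analytic_at g a ->
  exists r M N, pser f a r M /\ pser g a r N.
Proof.
  intros (r & M & H)%analytic_pser (r' & N & H')%analytic_pser.
  assert (0 < r) by apply H. assert (0 < r') by apply H'.
  exists (Rmin r r'), M, N. split; eapply pser_weaken; try eassumption; try lra;
  split; try (apply Rmin_l || apply Rmin_r); now apply Rmin_glb_lt.
Qed.

Lemma analytic_plus f g a : analytic_at f a -> analytic_at g a ->
  analytic_at (fun z => f z + g z)%C a.
Proof.
  intros Hf Hg. destruct (analytic_pser2 f g a Hf Hg) as (r & M & N & H & H').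
  eapply pser_analytic, pser_plus; eassumption.
Qed.

Lemma analytic_mult f g a : analytic_at f a -> analytic_at g a ->
  analytic_at (fun z => f z * g z)%C a.
Proof.
  intros Hf Hg. destruct (analytic_pser2 f g a Hf Hg) as (r & M & N & H & H').
  eapply pser_analytic, pser_mult; eassumption.
Qed.

Lemma analytic_const w a : analytic_at (fun _ => w) a.
Proof. apply (pser_analytic _ _ 1 (Cmod w)), pser_const. lra. Qed.

Lemma analytic_lin b a : analytic_at (fun z => z - b)%C a.
Proof. apply (pser_analytic _ _ 1 (Cmod (a - b) + 1)), pser_lin. lra. Qed.

Lemma analytic_lin_pow b a m : analytic_at (fun z => (z - b) ^ m)%C a.
Proof.
  induction m as [|m IH]; [exact (analytic_const 1 a)|].
  apply (analytic_mult (fun z => z - b)%C); [apply analytic_lin|exact IH].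
Qed.

Lemma analytic_shift f a b :
  analytic_at f (a + b)%C -> analytic_at (fun z => f (z + b)%C) a.
Proof.
  intros (c & r & Hr & H). exists c, r. split; [exact Hr|]. intros z Hz.
  replace (z - a)%C with (z + b - (a + b))%C in * by ring. now apply H.
Qed.

Lemma analytic_quotient f a : analytic_at f a ->
  exists g d, 0 < d /\ analytic_at g a /\
    forall z, Cmod (z - a) < d -> f z = (f a + (z - a) * g z)%C.
Proof.
  intros (r & M & H)%analytic_pser. assert (Hr : 0 < r) by apply H.
  destruct (pser_div _ _ _ _ H) as (g & Hg & E). exists g, r.
  split; [exact Hr|split; [|exact E]]. now apply pser_analytic in Hg.
Qed.

Lemma analytic_continuous f a : analytic_at f a ->
  forall e, 0 < e -> exists d, 0 < d /\ forall z, Cmod (z - a) < d -> Cmod (f z - f a) < e.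
Proof.
  intros (r & M & H)%analytic_pser e He. assert (Hr : 0 < r) by apply H.
  assert (HM := pser_nonneg _ _ _ _ H).
  destruct (pser_div _ _ _ _ H) as (g & Hg & E).
  assert (HN := pser_nonneg _ _ _ _ Hg). set (N := M / r) in *.
  exists (Rmin r (e / (N + 1))). assert (0 < e / (N + 1)) by (apply Rdiv_lt_0_compat; lra).
  split; [now apply Rmin_glb_lt|].
  intros z Hz. assert (Cmod (z - a) < r) by (eapply Rlt_le_trans; [exact Hz|apply Rmin_l]).
  assert (Hz2 : Cmod (z - a) < e / (N + 1)) by (eapply Rlt_le_trans; [exact Hz|apply Rmin_r]).
  rewrite (E z) by assumption. replace (f a + (z - a) * g z - f a)%C with ((z - a) * g z)%C by ring.
  rewrite Cmod_mult. apply Rle_lt_trans with (Cmod (z - a) * N).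
  - apply Rmult_le_compat_l; [apply Cmod_ge_0|]. now apply (pser_bound _ _ _ _ _ Hg).
  - apply Rle_lt_trans with (Cmod (z - a) * (N + 1)).
    { pose proof (Cmod_ge_0 (z - a)). nra. }
    apply Rmult_lt_reg_r with (/ (N + 1)); [apply Rinv_0_lt_compat; lra|].
    rewrite Rmult_assoc, Rinv_r, Rmult_1_r by lra. exact Hz2.
Qed.

(** * Complex powers and the binomial series *)

(** With [F = A + iB] the equations say [F' = lam (p + iq) F]. The functions [U] and [V] are the
    real and imaginary parts of [F exp(-(p + iq) L)], which has derivative 0 and value 1 at 0;
    multiplying back gives [F]. *)
Lemma linear_ode_solution (p q rho : R) (A B L lam : R -> R) :
  (forall t, Rabs t < rho ->
     is_derive A t (lam t * (p * A t - q * B t)) /\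
     is_derive B t (lam t * (p * B t + q * A t)) /\
     is_derive L t (lam t)) ->
  A 0 = 1 -> B 0 = 0 -> L 0 = 0 ->
  forall t, Rabs t < rho ->
    A t = exp (p * L t) * cos (q * L t) /\ B t = exp (p * L t) * sin (q * L t).
Proof.
  intros H A0 B0 L0 t Ht.
  set (U := fun t => exp (- p * L t) * (A t * cos (q * L t) + B t * sin (q * L t))).
  set (V := fun t => exp (- p * L t) * (B t * cos (q * L t) - A t * sin (q * L t))).
  assert (HU : forall x, Rabs x < rho -> is_derive U x 0 /\ is_derive V x 0).
  { intros x Hx. destruct (H x Hx) as (HA & HB & HL).
    unfold U, V. split; auto_derive;
      try (repeat split; eexists; eassumption);
      apply is_derive_unique in HA, HB, HL;
      change (fun x => A x) with A; change (fun x => B x) with B;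
      change (fun x => L x) with L; rewrite HA, HB, HL; ring. }
  assert (Hc : U t = 1 /\ V t = 0).
  { assert (E : U 0 = 1 /\ V 0 = 0).
    { unfold U, V. rewrite A0, B0, L0, !Rmult_0_r, exp_0, cos_0, sin_0. split; ring. }
    destruct E as [EU EV].
    destruct (Rtotal_order t 0) as [Hlt|[->|Hgt]]; [| now split |].
    - rewrite <- EU, <- EV. split; apply (eq_is_derive (V := R_NormedModule)); try lra;
      intros x Hx; apply HU; rewrite Rabs_left1 by lra; rewrite Rabs_left in Ht; lra.
    - rewrite <- EU, <- EV. split; symmetry;
      apply (eq_is_derive (V := R_NormedModule)); try lra;
      intros x Hx; apply HU; rewrite Rabs_pos_eq by lra; rewrite Rabs_pos_eq in Ht; lra. }
  destruct Hc as [EU EV].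
  assert (EE : exp (p * L t) * exp (- p * L t) = 1).
  { rewrite <- exp_plus. replace (p * L t + - p * L t) with 0 by ring. apply exp_0. }
  assert (EC : cos (q * L t) * cos (q * L t) + sin (q * L t) * sin (q * L t) = 1).
  { pose proof (sin2_cos2 (q * L t)) as E. unfold Rsqr in E. lra. }
  unfold U in EU. unfold V in EV.
  set (e := exp (p * L t)) in *. set (e' := exp (- p * L t)) in *.
  set (c := cos (q * L t)) in *. set (s := sin (q * L t)) in *.
  split.
  - transitivity (e * (c * (e' * (A t * c + B t * s)) - s * (e' * (B t * c - A t * s)))).
    + transitivity ((e * e') * (c * c + s * s) * A t); [rewrite EE, EC; ring|ring].
    + rewrite EU, EV. ring.
  - transitivity (e * (s * (e' * (A t * c + B t * s)) + c * (e' * (B t * c - A t * s)))).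
    + transitivity ((e * e') * (c * c + s * s) * B t); [rewrite EE, EC; ring|ring].
    + rewrite EU, EV. ring.
Qed.

Lemma CV_radius_ge_of_bounded (a : nat -> R) r M :
  (forall n, Rabs (a n) * r ^ n <= M) -> 0 <= r -> Rbar_le r (CV_radius a).
Proof.
  intros H Hr. apply (proj1 (CV_radius_bounded a)). exists M. intros n.
  rewrite Rabs_mult, (Rabs_pos_eq (r ^ n)) by now apply pow_le. apply H.
Qed.

Lemma is_series_PSeries (a : nat -> R) x : Rbar_lt (Rabs x) (CV_radius a) ->
  is_series (fun k => a k * x ^ k) (PSeries a x).
Proof.
  intros H. apply Series_correct. apply ex_pseries_R. now apply CV_radius_inside.
Qed.

Lemma fst_mult_R (w : C) (x : R) : fst (w * RtoC x)%C = fst w * x.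
Proof. simpl. ring. Qed.

Lemma snd_mult_R (w : C) (x : R) : snd (w * RtoC x)%C = snd w * x.
Proof. simpl. ring. Qed.

(** A power series in a real variable is identified with an exponential through its differential
    equation. [F] and [D] stand for the sum and for the termwise derivative. Both the exponential
    series and the binomial series are instances. *)
Lemma CS_Cexp_of_ode (c : nat -> C) (al : C) (rho M : R) (L lam : R -> R) :
  0 < rho -> (forall k, Cmod (c k) * rho ^ k <= M) -> c 0%nat = 1 -> L 0 = 0 ->
  (forall t, Rabs t < rho -> is_derive L t (lam t)) ->
  (forall t (F D : C), Rabs t < rho -> CS (fun k => c k * RtoC t ^ k)%C F ->
     CS (fun k => RtoC (INR (S k)) * c (S k) * RtoC t ^ k)%C D ->
     D = (RtoC (lam t) * (al * F))%C) ->
  forall t, Rabs t < rho -> CS (fun k => c k * RtoC t ^ k)%C (Cexp (al * RtoC (L t))).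
Proof.
  intros Hrho Hb Hc0 HL0 HL Hode t Ht.
  set (a := fun k => fst (c k)). set (b := fun k => snd (c k)).
  assert (Ra : Rbar_le rho (CV_radius a)).
  { apply CV_radius_ge_of_bounded with M; [|lra]. intros n. apply Rle_trans with (2 := Hb n).
    apply Rmult_le_compat_r; [apply pow_le; lra|apply fst_le_Cmod]. }
  assert (Rb : Rbar_le rho (CV_radius b)).
  { apply CV_radius_ge_of_bounded with M; [|lra]. intros n. apply Rle_trans with (2 := Hb n).
    apply Rmult_le_compat_r; [apply pow_le; lra|apply snd_le_Cmod]. }
  assert (Ha : forall x, Rabs x < rho -> Rbar_lt (Rabs x) (CV_radius a)).
  { intros x Hx. now apply Rbar_lt_le_trans with rho. }
  assert (Hb' : forall x, Rabs x < rho -> Rbar_lt (Rabs x) (CV_radius b)).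
  { intros x Hx. now apply Rbar_lt_le_trans with rho. }
  assert (HF : forall x, Rabs x < rho ->
     CS (fun k => c k * RtoC x ^ k)%C (PSeries a x, PSeries b x)).
  { intros x Hx. apply CS_components; cbn [fst snd]. split.
    - eapply is_series_R_ext; [|apply is_series_PSeries, (Ha x Hx)].
      intros k. cbv beta. rewrite <- RtoC_pow, fst_mult_R. reflexivity.
    - eapply is_series_R_ext; [|apply is_series_PSeries, (Hb' x Hx)].
      intros k. cbv beta. rewrite <- RtoC_pow, snd_mult_R. reflexivity. }
  assert (HD : forall x, Rabs x < rho ->
     CS (fun k => RtoC (INR (S k)) * c (S k) * RtoC x ^ k)%C
        (PSeries (PS_derive a) x, PSeries (PS_derive b) x)).
  { intros x Hx. apply CS_components; cbn [fst snd]. split.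
    - eapply is_series_R_ext; [|apply is_series_PSeries; rewrite CV_radius_derive; apply (Ha x Hx)].
      intros k. cbv beta. rewrite <- RtoC_pow, fst_mult_R. unfold PS_derive, a.
      rewrite (Cmult_comm (RtoC _)), fst_mult_R. ring.
    - eapply is_series_R_ext; [|apply is_series_PSeries; rewrite CV_radius_derive; apply (Hb' x Hx)].
      intros k. cbv beta. rewrite <- RtoC_pow, snd_mult_R. unfold PS_derive, b.
      rewrite (Cmult_comm (RtoC _)), snd_mult_R. ring. }
  destruct (linear_ode_solution (fst al) (snd al) rho (PSeries a) (PSeries b) L lam)
    with (t := t) as [EA EB]; [| | |exact HL0|exact Ht|].
  - intros x Hx. specialize (Hode x _ _ Hx (HF x Hx) (HD x Hx)).
    assert (E1 := f_equal fst Hode). assert (E2 := f_equal snd Hode).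
    cbn [fst snd] in E1, E2.
    split; [|split; [|now apply HL]].
    + replace (lam x * _) with (PSeries (PS_derive a) x).
      * now apply is_derive_PSeries, Ha.
      * rewrite E1. simpl. ring.
    + replace (lam x * _) with (PSeries (PS_derive b) x).
      * now apply is_derive_PSeries, Hb'.
      * rewrite E2. simpl. ring.
  - rewrite PSeries_0. unfold a. now rewrite Hc0.
  - rewrite PSeries_0. unfold b. now rewrite Hc0.
  - replace (Cexp (al * RtoC (L t))) with (PSeries a t, PSeries b t); [now apply HF|].
    unfold Cexp. rewrite EA, EB. unfold Re, Im. rewrite fst_mult_R, snd_mult_R. reflexivity.
Qed.

Lemma ex_series_ratio (a : nat -> R) (N : nat) (q : R) :
  0 <= q < 1 -> (forall k, 0 <= a k) ->
  (forall k, (N <= k)%nat -> a (S k) <= q * a k) -> ex_series a.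
Proof.
  intros Hq H0 H. apply (ex_series_incr_n a N).
  apply ex_series_R_le with (fun k => a N * q ^ k).
  - intros k. rewrite Rabs_pos_eq by apply H0. induction k as [|k IH].
    + rewrite Nat.add_0_r. simpl. lra.
    + rewrite Nat.add_succ_r. eapply Rle_trans; [apply H; lia|]. simpl. nra.
  - apply (ex_series_scal_l (K := R_AbsRing) (V := R_NormedModule) (a N)), ex_series_geom. rewrite Rabs_pos_eq; lra.
Qed.

Lemma ex_series_term_bounded (a : nat -> R) : (forall k, 0 <= a k) -> ex_series a ->
  exists M, forall k, a k <= M.
Proof.
  intros H0 He. exists (Series a). intros k.
  eapply Rle_trans; [apply (term_le_sum_n a k H0)|].
  apply sum_n_le_series; [exact H0|now apply Series_correct].
Qed.

Lemma RtoC_INR_neq_0 n : (0 < n)%nat -> RtoC (INR n) <> 0.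
Proof. intros H E. apply RtoC_inj in E. apply lt_0_INR in H. lra. Qed.

Lemma RtoC_neq_0 x : x <> 0 -> RtoC x <> 0.
Proof. intros H E. now apply RtoC_inj in E. Qed.

Lemma Cmod_INR n : Cmod (RtoC (INR n)) = INR n.
Proof. rewrite Cmod_R. apply Rabs_pos_eq, pos_INR. Qed.

Definition exp_coef (z : C) (k : nat) : C := (z ^ k / RtoC (INR (fact k)))%C.

Lemma exp_coef_S z k : (RtoC (INR (S k)) * exp_coef z (S k) = z * exp_coef z k)%C.
Proof.
  unfold exp_coef. rewrite fact_simpl, mult_INR, RtoC_mult, Cpow_S. field.
  split; apply RtoC_INR_neq_0; [apply lt_O_fact|lia].
Qed.

Lemma Cmod_exp_coef z k : Cmod (exp_coef z k) = Cmod z ^ k / INR (fact k).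
Proof.
  unfold exp_coef. rewrite Cmod_div by apply RtoC_INR_neq_0, lt_O_fact.
  now rewrite Cmod_pow, Cmod_INR.
Qed.

Lemma exp_series_R x : is_series (fun k => x ^ k / INR (fact k)) (exp x).
Proof.
  eapply is_series_R_ext; [|apply (is_exp_Reals x)]. intros k. cbv beta.
  rewrite pow_n_pow. reflexivity.
Qed.

Lemma Cexp_series z : CS (exp_coef z) (Cexp z).
Proof.
  replace z with (z * RtoC 1)%C at 2 by ring.
  (* The series is needed at [t = 1], so the radius 2 is taken and the terms are bounded by those of
     the series of [exp (2 |z|)]. *)
  destruct (ex_series_term_bounded (fun k => (2 * Cmod z) ^ k / INR (fact k))) as [M HM].
  { intros k. apply Rmult_le_pos; [apply pow_le; pose proof (Cmod_ge_0 z); lra|].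
    left. apply Rinv_0_lt_compat, lt_0_INR, lt_O_fact. }
  { eexists; apply exp_series_R. }
  eapply CS_ext; [|apply (CS_Cexp_of_ode (exp_coef z) z 2 M (fun t => t) (fun _ => 1))].
  - intros k. cbv beta. rewrite Cpow_1_l. ring.
  - lra.
  - intros k. apply Rle_trans with (2 := HM k). rewrite Cmod_exp_coef, Rpow_mult_distr.
    right. unfold Rdiv. ring.
  - unfold exp_coef. simpl. field.
  - reflexivity.
  - intros t _. auto_derive; [exact I|reflexivity].
  - intros t F D _ HF HD. apply (CS_inj _ _ _ HD). rewrite Cmult_1_l.
    eapply CS_ext; [|apply (CS_scal z _ _ HF)].
    intros k. cbv beta. rewrite exp_coef_S. ring.
  - rewrite Rabs_R1. lra.
Qed.

Lemma Cexp_plus z w : Cexp (z + w) = (Cexp z * Cexp w)%C.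
Proof.
  unfold Cexp, Cmult, Re, Im. cbn [fst snd Cplus].
  rewrite exp_plus, cos_plus, sin_plus. f_equal; ring.
Qed.

Lemma Cexp_0 : Cexp 0 = 1.
Proof. unfold Cexp, Re, Im. simpl. rewrite exp_0, cos_0, sin_0. unfold RtoC. f_equal; ring. Qed.

Lemma Cexp_R x : Cexp (RtoC x) = RtoC (exp x).
Proof. unfold Cexp, Re, Im, RtoC. simpl. rewrite cos_0, sin_0. f_equal; ring. Qed.

Lemma Cmod_Cexp z : Cmod (Cexp z) = exp (Re z).
Proof.
  unfold Cexp, Cmod. cbn [fst snd].
  replace _ with (sqrt (Rsqr (exp (Re z)))); [apply sqrt_Rsqr; left; apply exp_pos|].
  f_equal. pose proof (sin2_cos2 (Im z)) as E. unfold Rsqr in *. nra.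
Qed.

Lemma Cpower_plus x s t : Cpower x (s + t) = (Cpower x s * Cpower x t)%C.
Proof. unfold Cpower. rewrite <- Cexp_plus. f_equal. ring. Qed.

Lemma Cpower_0 x : Cpower x 0 = 1.
Proof. unfold Cpower. rewrite Cmult_0_l. apply Cexp_0. Qed.

Lemma Cpower_opp x s : (Cpower x s * Cpower x (- s) = 1)%C.
Proof. rewrite <- Cpower_plus, Cplus_opp_r. apply Cpower_0. Qed.

Lemma Cpower_neq_0 x s : Cpower x s <> 0.
Proof. intros E. pose proof (Cpower_opp x s) as H. rewrite E, Cmult_0_l in H.
  apply RtoC_inj in H. lra. Qed.

Lemma Cpower_mult x y s : 0 < x -> 0 < y ->
  Cpower (x * y) s = (Cpower x s * Cpower y s)%C.
Proof.
  intros Hx Hy. unfold Cpower. rewrite <- Cexp_plus, ln_mult, RtoC_plus by assumption.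
  f_equal. ring.
Qed.

Lemma Cpower_INR x n : 0 < x -> Cpower x (RtoC (INR n)) = RtoC (x ^ n).
Proof.
  intros Hx. unfold Cpower. rewrite <- RtoC_mult, Cexp_R. f_equal.
  rewrite <- (Rpower_pow n x Hx). reflexivity.
Qed.

Lemma Cpower_R x y : Cpower x (RtoC y) = RtoC (Rpower x y).
Proof. unfold Cpower. now rewrite <- RtoC_mult, Cexp_R. Qed.

Lemma Cmod_Cpower x s : Cmod (Cpower x s) = Rpower x (Re s).
Proof. unfold Cpower. rewrite Cmod_Cexp, re_scal_r. reflexivity. Qed.

Lemma pser_Cexp_lin (l : R) a r : 0 < r ->
  pser (fun s => Cexp (s * RtoC l)) a r (exp (Re a * l + r * Rabs l)).
Proof.
  intros Hr. split; [exact Hr|].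
  exists (fun k => Cexp (a * RtoC l) * exp_coef (RtoC l) k)%C. split.
  - intros K.
    apply Rle_trans with (exp (Re a * l) * sum_n (fun k => (r * Rabs l) ^ k / INR (fact k)) K).
    + rewrite <- sum_n_R_scal. apply sum_n_R_le. intros k.
      rewrite Cmod_mult, Cmod_Cexp, Cmod_exp_coef, Cmod_R, re_scal_r, Rpow_mult_distr.
      right. unfold Rdiv. ring.
    + rewrite exp_plus. apply Rmult_le_compat_l; [left; apply exp_pos|].
      apply sum_n_le_series; [|apply exp_series_R]. intros k.
      apply Rmult_le_pos; [|left; apply Rinv_0_lt_compat, lt_0_INR, lt_O_fact].
      apply pow_le, Rmult_le_pos; [lra|apply Rabs_pos].
  - intros z _. replace (z * RtoC l)%C with (a * RtoC l + RtoC l * (z - a))%C by ring.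
    rewrite Cexp_plus. eapply CS_ext; [|apply (CS_scal _ _ _ (Cexp_series (RtoC l * (z - a))))].
    intros k. unfold exp_coef. rewrite Cpow_mult_l. cbv beta. field.
    apply RtoC_INR_neq_0, lt_O_fact.
Qed.

(** The base is at least 1, hence its logarithm is nonnegative and the majorant is a pure power of
    [n + 1]. These majorants are summable over [n] as soon as the disc stays in [Re s > 1]. *)
Lemma pser_Cpower_opp (n : nat) a r : 0 < r ->
  pser (fun s => Cpower (INR (n + 1)) (- s)) a r (Rpower (INR (n + 1)) (r - Re a)).
Proof.
  intros Hr. assert (H1 : 1 <= INR (n + 1)).
  { apply (le_INR 1). lia. }
  assert (Hl : 0 <= ln (INR (n + 1))).
  { rewrite <- ln_1. apply ln_le; lra. }
  apply pser_ext with (fun s => Cexp (s * RtoC (- ln (INR (n + 1))))).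
  { intros z _. unfold Cpower. f_equal. rewrite RtoC_opp. ring. }
  eapply pser_weaken; [| |exact (pser_Cexp_lin _ a r Hr)]; [lra|].
  rewrite Rabs_Ropp, Rabs_pos_eq by exact Hl. unfold Rpower. right. f_equal. ring.
Qed.

Lemma analytic_Cpower_opp x (b : C) a : analytic_at (fun s => Cpower x (- s + b)) a.
Proof.
  assert (H : analytic_at (fun s => Cexp (s * RtoC (- ln x))) a).
  { eapply pser_analytic, (pser_Cexp_lin (- ln x) a 1). lra. }
  apply analytic_ext_loc with (f := fun s => (Cpower x b * Cexp (s * RtoC (- ln x)))%C) (d := 1).
  - lra.
  - intros z _. unfold Cpower. rewrite <- Cexp_plus. f_equal. rewrite RtoC_opp. ring.
  - apply analytic_mult; [apply analytic_const|exact H].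
Qed.

(** * The binomial series *)

Fixpoint rise (z : C) (k : nat) : C :=
  match k with O => 1 | S j => (rise z j * (z + RtoC (INR j)))%C end.

(* The binomial coefficient of [- z] over [k]. *)
Definition bin_coef (z : C) (k : nat) : C :=
  (RtoC ((-1) ^ k) * rise z k / RtoC (INR (fact k)))%C.

Lemma bin_coef_S z k :
  (RtoC (INR (S k)) * bin_coef z (S k) = - (z + RtoC (INR k)) * bin_coef z k)%C.
Proof.
  unfold bin_coef. rewrite fact_simpl, mult_INR, RtoC_mult. cbn [rise pow].
  rewrite RtoC_mult. replace (RtoC (-1)) with (- RtoC 1)%C by (now rewrite <- RtoC_opp). field.
  split; apply RtoC_INR_neq_0; [apply lt_O_fact|lia].
Qed.

Lemma Cmod_bin_coef_S z k :
  INR (S k) * Cmod (bin_coef z (S k)) <= (Cmod z + INR k) * Cmod (bin_coef z k).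
Proof.
  rewrite <- (Cmod_INR (S k)), <- Cmod_mult, bin_coef_S, Cmod_mult, Cmod_opp.
  apply Rmult_le_compat_r; [apply Cmod_ge_0|].
  eapply Rle_trans; [apply Cmod_triangle|]. rewrite Cmod_INR. lra.
Qed.

Lemma exists_INR_ge (x : R) : exists N, x <= INR N.
Proof. destruct (nfloor_ex (Rabs x)) as [N HN]; [apply Rabs_pos|].
  exists (S N). rewrite S_INR. pose proof (Rle_abs x). lra. Qed.

Lemma ex_series_bin_coef z (rho : R) : 0 <= rho < 1 ->
  ex_series (fun k => Cmod (bin_coef z k) * rho ^ k).
Proof.
  intros Hrho. set (q := (1 + rho) / 2).
  (* [q] lies halfway between [rho] and 1, and from [N] on [rho (|z| + k) <= q k], which bounds the
     ratio of consecutive terms by [q]. *)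
  destruct (exists_INR_ge (rho * Cmod z / (q - rho))) as [N HN].
  apply ex_series_ratio with N q; [unfold q; lra| |].
  { intros k. apply Rmult_le_pos; [apply Cmod_ge_0|apply pow_le; lra]. }
  intros k Hk. assert (Hk' : rho * Cmod z / (q - rho) <= INR k).
  { eapply Rle_trans; [exact HN|]. now apply le_INR. }
  assert (Hq : 0 < q - rho) by (unfold q; lra).
  assert (Hk2 : rho * Cmod z <= (q - rho) * INR k).
  { replace (rho * Cmod z) with (rho * Cmod z / (q - rho) * (q - rho)) by (field; lra).
    rewrite (Rmult_comm (q - rho)). apply Rmult_le_compat_r; lra. }
  assert (H := Cmod_bin_coef_S z k).
  set (x := Cmod (bin_coef z (S k))) in *. set (y := Cmod (bin_coef z k)) in *.
  assert (Hy : 0 <= y) by apply Cmod_ge_0.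
  simpl (rho ^ S k). rewrite S_INR in H.
  assert (Hrk : 0 <= rho ^ k) by (apply pow_le; lra).
  assert (Hn : 0 <= INR k) by apply pos_INR.
  assert (Hx : rho * x <= q * y).
  { apply Rmult_le_reg_l with (INR k + 1); [lra|].
    apply Rle_trans with (rho * ((Cmod z + INR k) * y)); [nra|].
    replace (rho * ((Cmod z + INR k) * y)) with ((rho * Cmod z + rho * INR k) * y) by ring.
    replace ((INR k + 1) * (q * y)) with (((INR k + 1) * q) * y) by ring.
    apply Rmult_le_compat_r; [exact Hy|]. unfold q in *. nra. }
  replace (x * (rho * rho ^ k)) with ((rho * x) * rho ^ k) by ring.
  rewrite <- Rmult_assoc. apply Rmult_le_compat_r; assumption.
Qed.

Lemma binomial_series z t : Rabs t < 1 ->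
  CS (fun k => bin_coef z k * RtoC t ^ k)%C (Cpower (1 + t) (- z)).
Proof.
  intros Ht. set (rho := (1 + Rabs t) / 2). pose proof (Rabs_pos t).
  assert (Hrho : 0 <= rho < 1) by (unfold rho; lra).
  destruct (ex_series_term_bounded (fun k => Cmod (bin_coef z k) * rho ^ k)) as [M HM].
  { intros k. apply Rmult_le_pos; [apply Cmod_ge_0|apply pow_le; lra]. }
  { now apply ex_series_bin_coef. }
  apply (CS_Cexp_of_ode (bin_coef z) (- z)%C rho M (fun t => ln (1 + t)) (fun t => / (1 + t))).
  - unfold rho; lra.
  - exact HM.
  - unfold bin_coef. simpl. field.
  - rewrite Rplus_0_r. apply ln_1.
  - intros x Hx. apply Rabs_lt_between in Hx. auto_derive; [lra|]. field. lra.
  - intros x F D Hx HF HD. apply Rabs_lt_between in Hx.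
    assert (Hx' : RtoC (1 + x) <> 0) by (apply RtoC_neq_0; lra).
    rewrite RtoC_inv.
    (* The differential equation [(1 + x) F' = - z F], read on coefficients: by [bin_coef_S],
       [(k+1) b_(k+1) + k b_k = - z b_k]. *)
    assert (E : ((1 + RtoC x) * D)%C = (- z * F)%C).
    { assert (HxD : CS (fun k => RtoC (INR k) * bin_coef z k * RtoC x ^ k)%C (RtoC x * D)%C).
      { replace (RtoC x * D)%C with (RtoC (INR 0) * bin_coef z 0 * RtoC x ^ 0 + RtoC x * D)%C
          by (simpl; ring).
        apply (CS_decr (fun k => RtoC (INR k) * bin_coef z k * RtoC x ^ k)%C).
        eapply CS_ext; [|apply (CS_scal (RtoC x) _ _ HD)]. intros k. cbv beta.
        rewrite Cpow_S. ring. }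
      replace ((1 + RtoC x) * D)%C with (D + RtoC x * D)%C by ring.
      apply (CS_inj _ _ _ (CS_plus _ _ _ _ HD HxD)).
      eapply CS_ext; [|apply (CS_scal (- z)%C _ _ HF)].
      intros k. cbv beta. rewrite bin_coef_S. ring. }
    rewrite <- E, RtoC_plus. rewrite RtoC_plus in Hx'. field. exact Hx'.
  - unfold rho; lra.
  - unfold rho; lra.
Qed.

Lemma ln_le_sub_1 x : 0 < x -> ln x <= x - 1.
Proof.
  intros Hx. apply Rnot_lt_le. intros H. apply exp_increasing in H.
  rewrite exp_ln in H by exact Hx. pose proof (exp_ineq1_le (x - 1)). lra.
Qed.

(** A discrete comparison with the integral of [x^(-p)], whose right side telescopes. After division
    by [x^(1-p)] it is [1 + (p-1)/x <= (1 - 1/x)^(1-p)], which follows from [ln y <= y - 1] and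
    [1 + t <= exp t]. *)
Lemma Rpower_telescope p x : 1 < p -> 1 < x ->
  (p - 1) * Rpower x (- p) <= Rpower (x - 1) (1 - p) - Rpower x (1 - p).
Proof.
  intros Hp Hx.
  set (y := 1 - / x).
  assert (Hix : 0 < / x < 1).
  { split; [apply Rinv_0_lt_compat; lra|]. rewrite <- Rinv_1. apply Rinv_lt_contravar; lra. }
  assert (Hy : 0 < y) by (unfold y; lra).
  replace (x - 1) with (x * y) by (unfold y; field; lra).
  replace (- p) with ((1 - p) + - (1)) by ring.
  rewrite Rpower_plus, Rpower_Ropp, Rpower_1 by lra.
  rewrite <- Rpower_mult_distr by lra.
  assert (Hy' : 1 + (p - 1) * / x <= Rpower y (1 - p)).
  { unfold Rpower. eapply Rle_trans; [|apply exp_ineq1_le].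
    pose proof (ln_le_sub_1 y Hy) as Hl.
    assert (ln y <= - / x) by (unfold y in *; lra). nra. }
  assert (0 < Rpower x (1 - p)) by apply exp_pos.
  nra.
Qed.

Lemma ex_series_Rpower p : 1 < p -> ex_series (fun n => Rpower (INR (n + 1)) (- p)).
Proof.
  intros Hp. apply ex_series_bounded with (1 + / (p - 1)).
  { intros k. left. apply exp_pos. }
  assert (H : forall n, sum_n (fun n => Rpower (INR (n + 1)) (- p)) n
            <= 1 + / (p - 1) * (1 - Rpower (INR (n + 1)) (1 - p))).
  { induction n as [|n IH].
    - rewrite sum_O. simpl. unfold Rpower. rewrite ln_1, !Rmult_0_r, exp_0. lra.
    - rewrite sum_n_R_S. eapply Rle_trans; [apply Rplus_le_compat_r, IH|].
      assert (Hx : 1 < INR (S n + 1)).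
      { replace (S n + 1)%nat with (S (S n)) by lia. rewrite !S_INR.
        pose proof (pos_INR n). lra. }
      pose proof (Rpower_telescope p _ Hp Hx) as T.
      replace (INR (S n + 1) - 1) with (INR (n + 1)) in T
        by (replace (S n + 1)%nat with (S (n + 1)) by lia; rewrite S_INR; ring).
      apply (Rmult_le_compat_l (/ (p - 1))) in T; [|left; apply Rinv_0_lt_compat; lra].
      rewrite <- Rmult_assoc, Rinv_l, Rmult_1_l in T by lra. lra. }
  intros n. eapply Rle_trans; [apply H|].
  assert (0 < / (p - 1)) by (apply Rinv_0_lt_compat; lra).
  assert (0 < Rpower (INR (n + 1)) (1 - p)) by apply exp_pos. nra.
Qed.

(** * The recursion for the zeta function *)

Definition dirichlet (s : C) : C := CSeries (fun n => Cpower (INR (n + 1)) (- s)).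

Lemma INR_succ_ge_1 n : 1 <= INR (n + 1).
Proof. apply (le_INR 1). lia. Qed.

Lemma CS_dirichlet s : 1 < Re s -> CS (fun n => Cpower (INR (n + 1)) (- s)) (dirichlet s).
Proof.
  intros Hs. apply CS_abs.
  eapply ex_series_ext; [|apply (ex_series_Rpower (Re s) Hs)].
  intros n. cbv beta. now rewrite Cmod_Cpower, re_opp.
Qed.

Lemma Rpower_anti x p q : 1 <= x -> p <= q -> Rpower x p <= Rpower x q.
Proof.
  intros Hx Hpq. destruct (Req_dec x 1) as [->|].
  - unfold Rpower. rewrite ln_1, !Rmult_0_r. lra.
  - apply Rle_Rpower; lra.
Qed.

Lemma pser_dirichlet a r : 0 < r -> 1 < Re a - r ->
  pser dirichlet a r (Series (fun n => Rpower (INR (n + 1)) (r - Re a))).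
Proof.
  intros Hr Ha.
  apply (pser_series (fun n s => Cpower (INR (n + 1)) (- s)) a r).
  - intros n. now apply pser_Cpower_opp.
  - eapply ex_series_ext; [|apply (ex_series_Rpower _ Ha)]. intros n. cbv beta. f_equal. ring.
Qed.

Fixpoint Rrise (x : R) (k : nat) : R :=
  match k with O => 1 | S j => Rrise x j * (x + INR j) end.

Lemma Rrise_nonneg x k : 0 <= x -> 0 <= Rrise x k.
Proof.
  intros Hx. induction k as [|k IH]; simpl; [lra|].
  apply Rmult_le_pos; [exact IH|]. pose proof (pos_INR k). lra.
Qed.

Lemma Cmod_rise z k : Cmod (rise z k) <= Rrise (Cmod z) k.
Proof.
  induction k as [|k IH]; [simpl; rewrite Cmod_1; lra|].
  cbn [rise Rrise]. rewrite Cmod_mult. apply Rmult_le_compat; try apply Cmod_ge_0; [exact IH|].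
  eapply Rle_trans; [apply Cmod_triangle|]. rewrite Cmod_INR. lra.
Qed.

Lemma pser_rise (b : C) a r k : 0 < r ->
  pser (fun s => rise (s - b) k) a r (Rrise (Cmod (a - b) + r) k).
Proof.
  intros Hr. induction k as [|k IH].
  - cbn [rise Rrise]. pose proof (pser_const 1 a r Hr) as H.
    now rewrite Cmod_1 in H.
  - cbn [rise Rrise]. apply pser_mult; [exact IH|].
    apply pser_ext with (fun s => s - (b - RtoC (INR k)))%C; [intros; ring|].
    eapply pser_weaken; [| |exact (pser_lin (b - RtoC (INR k)) a r Hr)]; [lra|].
    replace (a - (b - RtoC (INR k)))%C with ((a - b) + RtoC (INR k))%C by ring.
    pose proof (Cmod_triangle (a - b) (RtoC (INR k))) as H. rewrite Cmod_INR in H. lra.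
Qed.

Definition eta_maj (x : R) (k : nat) : R :=
  Rrise x (2 * k) / (INR (fact (2 * k + 1)) * 4 ^ k).

Definition eta_coef (s : C) (k : nat) : C :=
  (rise (s - 1) (2 * k) / RtoC (INR (fact (2 * k + 1)) * 4 ^ k))%C.

Lemma eta_den_pos k : 0 < INR (fact (2 * k + 1)) * 4 ^ k.
Proof. apply Rmult_lt_0_compat; [apply lt_0_INR, lt_O_fact|apply pow_lt; lra]. Qed.

Lemma eta_maj_nonneg x k : 0 <= x -> 0 <= eta_maj x k.
Proof.
  intros Hx. apply Rmult_le_pos; [now apply Rrise_nonneg|].
  left. apply Rinv_0_lt_compat, eta_den_pos.
Qed.

Lemma Cmod_eta_coef s k : Cmod (eta_coef s k) <= eta_maj (Cmod (s - 1)) k.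
Proof.
  unfold eta_coef, eta_maj. pose proof (eta_den_pos k).
  rewrite Cmod_div by (apply RtoC_neq_0; lra).
  rewrite Cmod_R, Rabs_pos_eq by lra.
  apply Rmult_le_compat_r; [left; now apply Rinv_0_lt_compat|apply Cmod_rise].
Qed.

Lemma pser_eta_coef a r k : 0 < r ->
  pser (fun s => eta_coef s k) a r (eta_maj (Cmod (a - 1) + r) k).
Proof.
  intros Hr. pose proof (eta_den_pos k).
  set (w := RtoC (/ (INR (fact (2 * k + 1)) * 4 ^ k))).
  apply pser_ext with (fun s => w * rise (s - 1) (2 * k))%C.
  { intros z _. unfold eta_coef, w. rewrite RtoC_inv by lra. apply Cmult_comm. }
  replace (eta_maj (Cmod (a - 1) + r) k) with (Cmod w * Rrise (Cmod (a - 1) + r) (2 * k)).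
  - now apply pser_scal, pser_rise.
  - unfold w, eta_maj. rewrite Cmod_R, Rabs_pos_eq; [unfold Rdiv; ring|].
    left. now apply Rinv_0_lt_compat.
Qed.

(** The ratio of consecutive terms tends to 1/4, the quotient of rising factorial and factorial
    contributing only a power of [k]. The factor [k + 1] makes room for the linear growth of
    [eta (s + 2k)]. *)
Lemma ex_series_eta_maj x : 0 <= x -> ex_series (fun k => eta_maj x k * (INR k + 1)).
Proof.
  (* For [k >= 10 x + 10] one has [x + 2k <= (21/10) k], which is enough to bring the ratio below
     1/2. *)
  intros Hx. destruct (exists_INR_ge (10 * x + 10)) as [N HN].
  apply ex_series_ratio with N (1/2); [lra| |].
  { intros k. apply Rmult_le_pos; [now apply eta_maj_nonneg|]. pose proof (pos_INR k); lra. }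
  intros k Hk. apply le_INR in Hk.
  assert (E : eta_maj x (S k) = eta_maj x k *
     ((x + 2 * INR k) * (x + 2 * INR k + 1) / ((2 * INR k + 2) * (2 * INR k + 3) * 4))).
  { unfold eta_maj. replace (2 * S k)%nat with (S (S (2 * k))) by lia.
    replace (S (S (2 * k)) + 1)%nat with (S (S (2 * k + 1))) by lia.
    rewrite (fact_simpl (S (2 * k + 1))), (fact_simpl (2 * k + 1)), (mult_INR (S _)), (mult_INR (S (2 * k + 1)) (fact _)). cbn [Rrise pow].
    replace (INR (S (2 * k))) with (2 * INR k + 1) by (rewrite S_INR, mult_INR; simpl; ring).
    replace (INR (2 * k)) with (2 * INR k) by (rewrite mult_INR; simpl; ring).
    replace (INR (S (S (2 * k + 1)))) with (2 * INR k + 3)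
      by (rewrite !S_INR, plus_INR, mult_INR; simpl; ring).
    replace (INR (S (2 * k + 1))) with (2 * INR k + 2)
      by (rewrite S_INR, plus_INR, mult_INR; simpl; ring).
    field. pose proof (pos_INR k). repeat split; try lra.
    - apply pow_nonzero; lra.
    - apply not_0_INR, fact_neq_0. }
  rewrite E, S_INR. pose proof (eta_maj_nonneg x k Hx). set (m := eta_maj x k) in *.
  set (n := INR k) in *.
  assert (Hn : 10 * x + 10 <= n) by lra.
  replace (m * ((x + 2 * n) * (x + 2 * n + 1) / ((2 * n + 2) * (2 * n + 3) * 4)) * (n + 1 + 1))
    with (m * ((x + 2 * n) * (x + 2 * n + 1) * (n + 2) / ((2 * n + 2) * (2 * n + 3) * 4)))
    by (field; lra).
  replace (1 / 2 * (m * (n + 1))) with (m * (1 / 2 * (n + 1))) by ring.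
  apply Rmult_le_compat_l; [assumption|].
  apply Rmult_le_reg_r with ((2 * n + 2) * (2 * n + 3) * 4); [nra|].
  unfold Rdiv at 1. rewrite Rmult_assoc, Rinv_l by nra. rewrite Rmult_1_r.
  assert (H1 : x + 2 * n <= 21/10 * n) by lra.
  assert (H2 : x + 2 * n + 1 <= 21/10 * n + 2) by lra.
  assert (H3 : (x + 2 * n) * (x + 2 * n + 1) <= (21/10 * n) * (21/10 * n + 2))
    by (apply Rmult_le_compat; lra).
  apply Rle_trans with ((21/10 * n) * (21/10 * n + 2) * (n + 2)); [apply Rmult_le_compat_r; lra|].
  nra.
Qed.

Lemma ex_series_eta_maj_lin x c d : 0 <= x -> 0 <= c -> 0 <= d ->
  ex_series (fun k => eta_maj x k * (c * INR k + d)).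
Proof.
  intros Hx Hc Hd. apply ex_series_R_le with (fun k => (c + d) * (eta_maj x k * (INR k + 1))).
  - intros k. pose proof (eta_maj_nonneg x k Hx). pose proof (pos_INR k).
    rewrite Rabs_pos_eq by (apply Rmult_le_pos; nra).
    replace ((c + d) * (eta_maj x k * (INR k + 1)))
      with (eta_maj x k * ((c + d) * (INR k + 1))) by ring.
    apply Rmult_le_compat_l; nra.
  - apply (ex_series_scal_l (K := R_AbsRing) (V := R_NormedModule) (c + d)).
    now apply ex_series_eta_maj.
Qed.

Lemma sum_n_R_pair (a : nat -> R) n :
  sum_n a (2 * n + 1) = sum_n (fun k => a (2 * k)%nat + a (2 * k + 1)%nat) n :> R.
Proof.
  induction n as [|n IH].
  - simpl. rewrite sum_n_R_S, !sum_O. reflexivity.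
  - replace (2 * S n + 1)%nat with (S (S (2 * n + 1))) by lia.
    rewrite !sum_n_R_S, IH.
    replace (2 * S n)%nat with (S (2 * n + 1)) by lia.
    replace (S (2 * n + 1) + 1)%nat with (S (S (2 * n + 1))) by lia. ring.
Qed.

Lemma is_series_pair (a : nat -> R) l : is_series a l ->
  is_series (fun k => a (2 * k)%nat + a (2 * k + 1)%nat) l.
Proof.
  intros H. apply (is_lim_seq_ext (fun n => sum_n a (2 * n + 1)) _ l).
  - intros n. apply sum_n_R_pair.
  - apply (is_lim_seq_subseq (sum_n a) l (fun n => 2 * n + 1)%nat); [|exact H].
    apply eventually_subseq. intros n. lia.
Qed.

Lemma CS_pair (a : nat -> C) (l : C) : CS a l ->
  CS (fun k => a (2 * k)%nat + a (2 * k + 1)%nat)%C l.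
Proof.
  intros [H1 H2]%CS_components. apply CS_components. split.
  - exact (is_series_pair _ _ H1).
  - exact (is_series_pair _ _ H2).
Qed.

Lemma CS_of_error (a : nat -> C) (l : C) (e : nat -> R) :
  (forall n, Cmod (sum_n (G := C_AbelianMonoid) a n - l)%C <= e n) -> is_lim_seq e 0 ->
  CS a l.
Proof.
  intros H He.
  assert (R : forall (x : nat -> R) y, (forall n, Rabs (x n - y) <= e n) -> is_lim_seq x y).
  { intros x y Hx. apply (is_lim_seq_ext (fun n => (x n - y) + y)); [intros; ring|].
    replace (Finite y) with (Finite (0 + y)) by (f_equal; ring).
    apply is_lim_seq_plus'; [|apply is_lim_seq_const].
    apply is_lim_seq_abs_0. apply (is_lim_seq_le_le (fun _ => 0) _ e 0);
      [|apply is_lim_seq_const|exact He].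
    intros n. split; [apply Rabs_pos|apply Hx]. }
  apply CS_components. split.
  - apply (R (sum_n (fun k => fst (a k)))). intros n. rewrite <- sum_n_fst.
    eapply Rle_trans; [|apply (H n)].
    exact (fst_le_Cmod (sum_n (G := C_AbelianMonoid) a n - l)%C).
  - apply (R (sum_n (fun k => snd (a k)))). intros n. rewrite <- sum_n_snd.
    eapply Rle_trans; [|apply (H n)].
    exact (snd_le_Cmod (sum_n (G := C_AbelianMonoid) a n - l)%C).
Qed.

Lemma is_lim_seq_Rpower_0 p c : 0 < p -> 0 < c ->
  is_lim_seq (fun n => Rpower (INR n + c) (- p)) 0.
Proof.
  intros Hp Hc. apply is_lim_seq_spec. intros [e He]. simpl.
  destruct (exists_INR_ge (Rpower e (- / p))) as [N HN].
  exists N. intros n Hn. rewrite Rminus_0_r, Rabs_pos_eq by (left; apply exp_pos).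
  assert (H1 : Rpower e (- / p) < INR n + c).
  { apply le_INR in Hn. lra. }
  assert (He0 : 0 < Rpower e (- / p)) by apply exp_pos.
  assert (E : e = Rpower (Rpower e (- / p)) (- p)).
  { rewrite Rpower_mult. replace (- / p * - p) with 1 by (field; lra).
    now rewrite Rpower_1. }
  rewrite E. unfold Rpower at 1 2. apply exp_increasing.
  assert (ln (Rpower e (- / p)) < ln (INR n + c)) by now apply ln_increasing.
  nra.
Qed.

Lemma pow_m1_odd j : (-1) ^ (2 * j + 1) = -1.
Proof. rewrite Nat.add_1_r. apply pow_1_odd. Qed.

(** With [m = n + 1] and [x = 1/(2m)], the two powers are [m^(1-s)] times [(1 - x)^(1-s)] and
    [(1 + x)^(1-s)]. In the difference the even powers of [x] cancel and the odd ones double;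
    [CS_pair] groups the exponents [2j] and [2j + 1]. The last factor [s - 1 + 2j] of the rising
    factorial is kept apart, since with the Dirichlet series at [s + 2j] it forms a value of
    [eta]. *)
Lemma half_integer_difference s n :
  CS (fun j => eta_coef s j * (s + RtoC (2 * INR j) - 1)
               * Cpower (INR (n + 1)) (- (s + RtoC (2 * INR j))))%C
     (Cpower (INR n + 1/2) (1 - s) - Cpower (INR n + 1 + 1/2) (1 - s))%C.
Proof.
  set (m := INR (n + 1)). pose proof (INR_succ_ge_1 n) as Hm. fold m in Hm.
  set (x := / (2 * m)).
  assert (Hx : 0 < x < 1).
  { unfold x. split; [apply Rinv_0_lt_compat; lra|].
    rewrite <- Rinv_1. apply Rinv_lt_contravar; lra. }
  assert (B1 := binomial_series (s - 1) x ltac:(rewrite Rabs_pos_eq; lra)).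
  assert (B2 := binomial_series (s - 1) (- x) ltac:(rewrite Rabs_Ropp, Rabs_pos_eq; lra)).
  assert (B := CS_scal (Cpower m (- (s - 1))) _ _ (CS_pair _ _ (CS_minus _ _ _ _ B2 B1))).
  replace (Cpower (INR n + 1/2) (1 - s) - Cpower (INR n + 1 + 1/2) (1 - s))%C
    with (Cpower m (- (s - 1)) *
          (Cpower (1 + - x) (- (s - 1)) - Cpower (1 + x) (- (s - 1))))%C.
  - eapply CS_ext; [|exact B]. intros j. cbv beta.
    replace (- (s - 1))%C with (- (s + RtoC (2 * INR j)) + RtoC (INR (2 * j + 1)))%C
      by (replace (INR (2 * j + 1)) with (2 * INR j + 1)
            by (rewrite plus_INR, mult_INR; simpl; ring); rewrite RtoC_plus; ring).
    rewrite Cpower_plus, Cpower_INR by lra.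
    rewrite <- !RtoC_pow.
    replace ((- x) ^ (2 * j)) with (x ^ (2 * j)) by (rewrite !pow_mult; f_equal; ring).
    replace ((- x) ^ (2 * j + 1)) with (- x ^ (2 * j + 1))
      by (rewrite !pow_add, !pow_mult; replace ((-x)^2) with (x^2) by ring; ring).
    (* Since [m x = 1/2], the doubled odd power is [2 / 2^(2j+1)]: the origin of [4 ^ k] in
       [eta_coef]. *)
    assert (E : m ^ (2 * j + 1) * (2 * x ^ (2 * j + 1)) = / 4 ^ j).
    { replace (m ^ (2 * j + 1) * (2 * x ^ (2 * j + 1)))
        with (2 * (m * x) ^ (2 * j + 1)) by (rewrite Rpow_mult_distr; ring).
      replace (m * x) with (/ 2) by (unfold x; field; lra).
      rewrite pow_add, pow_mult. replace ((/ 2) ^ 2) with (/ 4) by field.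
      rewrite pow_inv. field. apply pow_nonzero; lra. }
    assert (E' : (RtoC (m ^ (2 * j + 1)) * (2 * RtoC (x ^ (2 * j + 1))) = RtoC (/ 4 ^ j))%C).
    { rewrite <- E, !RtoC_mult. ring. }
    unfold eta_coef, bin_coef.
    rewrite pow_m1_odd, RtoC_opp.
    replace (rise (s - 1) (2 * j + 1)) with (rise (s - 1) (2 * j) * (s - 1 + RtoC (2 * INR j)))%C
      by (rewrite Nat.add_1_r; cbn [rise]; now rewrite mult_INR).
    rewrite (RtoC_mult (INR (fact _))).
    rewrite RtoC_inv in E' by (apply pow_nonzero; lra).
    replace (rise (s - 1) (2 * j) / (RtoC (INR (fact (2 * j + 1))) * RtoC (4 ^ j)))%C
      with (rise (s - 1) (2 * j) / RtoC (INR (fact (2 * j + 1))) * (/ RtoC (4 ^ j)))%C.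
    + rewrite <- E'. replace (RtoC (-1)) with (- RtoC 1)%C by (now rewrite <- RtoC_opp).
      field. split; apply RtoC_INR_neq_0, lt_O_fact.
    + field. split; [apply RtoC_neq_0, pow_nonzero; lra|apply RtoC_INR_neq_0, lt_O_fact].
  - transitivity (Cpower m (- (s - 1)) * Cpower (1 + - x) (- (s - 1)) - Cpower m (- (s - 1)) * Cpower (1 + x) (- (s - 1)))%C; [ring|].
    rewrite <- !Cpower_mult by lra.
    replace (m * (1 + - x)) with (INR n + 1/2) by (unfold x, m in *; rewrite plus_INR in *; simpl (INR 1) in *; field; lra).
    replace (m * (1 + x)) with (INR n + 1 + 1/2) by (unfold x, m in *; rewrite plus_INR in *; simpl (INR 1) in *; field; lra).
    replace (- (s - 1))%C with (1 - s)%C by ring. reflexivity.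
Qed.

(** * The entire function (s - 1) zeta(s) *)

Lemma CS_telescope (T : nat -> C) : is_lim_seq (fun n => Cmod (T n)) 0 ->
  CS (fun n => T n - T (S n))%C (T 0%nat).
Proof.
  intros H. apply CS_of_error with (fun n => Cmod (T (S n))).
  - intros n. right. transitivity (Cmod (- T (S n))); [|apply Cmod_opp]. f_equal.
    induction n as [|n IH].
    + rewrite sum_O. cbv beta. ring.
    + rewrite sum_Sn. unfold plus; cbn -[sum_n].
      set (S := sum_n _ n) in *. change (S - T 0%nat = - T (Datatypes.S n))%C in IH.
      change (S + (T (Datatypes.S n) - T (Datatypes.S (Datatypes.S n))) - T 0%nat
              = - T (Datatypes.S (Datatypes.S n)))%C.
      replace S with (T 0%nat + - T (Datatypes.S n))%C by (rewrite <- IH; ring).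
      ring.
  - now apply is_lim_seq_incr_1 in H.
Qed.

Definition eta_half (s : C) : C := ((s - 1) * dirichlet s)%C.

Lemma re_shift s x : Re (s + RtoC x) = Re s + x.
Proof. reflexivity. Qed.

(** The expansions of [half_integer_difference] are summed over [n]. By rows the differences
    telescope to [(1/2)^(1-s) = 2^(s-1)]; by columns the sum over [n] is the Dirichlet series at
    [s + 2k]. *)
Lemma functional_equation_half s : 1 < Re s ->
  CS (fun k => eta_coef s k * eta_half (s + RtoC (2 * INR k)))%C (Cpower 2 (s - 1)).
Proof.
  intros Hs.
  set (M := fun k => eta_maj (Cmod (s - 1)) k * (2 * INR k + Cmod (s - 1))).
  assert (HM0 : forall k, 0 <= M k).
  { intros k. pose proof (Cmod_ge_0 (s - 1)). pose proof (pos_INR k).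
    apply Rmult_le_pos; [now apply eta_maj_nonneg|lra]. }
  assert (HM : ex_series M).
  { apply ex_series_eta_maj_lin; try lra; apply Cmod_ge_0. }
  set (a := fun n k => (eta_coef s k * (s + RtoC (2 * INR k) - 1)
               * Cpower (INR (n + 1)) (- (s + RtoC (2 * INR k))))%C).
  destruct (fubini_CS a (fun n => Series M * Rpower (INR (n + 1)) (- Re s))
     (fun n => Cpower (INR n + 1/2) (1 - s) - Cpower (INR n + 1 + 1/2) (1 - s))%C)
    as (_ & H1 & H2 & _).
  (* The modulus of [(n+1)^(-(s+2k))] is at most [(n+1)^(- Re s)] for every [k], so a row is bounded
     by this power times the sum of the coefficient bounds [M k]. *)
  - intros n K. rewrite Rmult_comm.
    apply Rle_trans with (sum_n (fun k => Rpower (INR (n + 1)) (- Re s) * M k) K).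
    + apply sum_n_R_le. intros k. unfold a. rewrite !Cmod_mult, Cmod_Cpower, Rmult_comm.
      apply Rmult_le_compat.
      * left; apply exp_pos.
      * apply Rmult_le_pos; apply Cmod_ge_0.
      * apply Rpower_anti; [apply INR_succ_ge_1|]. rewrite re_opp, re_shift.
        pose proof (pos_INR k). lra.
      * apply Rmult_le_compat; try apply Cmod_ge_0; [apply Cmod_eta_coef|].
        replace (s + RtoC (2 * INR k) - 1)%C with (RtoC (2 * INR k) + (s - 1))%C by ring.
        eapply Rle_trans; [apply Cmod_triangle|].
        rewrite Cmod_R, Rabs_pos_eq; [lra|]. pose proof (pos_INR k). lra.
    + rewrite sum_n_R_scal. apply Rmult_le_compat_l; [left; apply exp_pos|].
      apply sum_n_le_series; [exact HM0|now apply Series_correct].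
  - apply (ex_series_scal_l (K := R_AbsRing) (V := R_NormedModule)).
    now apply ex_series_Rpower.
  - intros n. apply half_integer_difference.
  - replace (Cpower 2 (s - 1)) with (Cpower (1/2) (1 - s)).
    + rewrite (CS_unique _ (Cpower (1/2) (1 - s))) in H2.
      * eapply CS_ext; [|exact H2]. intros k. cbv beta. apply CS_unique. unfold eta_half, a.
        replace (eta_coef s k * ((s + RtoC (2 * INR k) - 1) * dirichlet (s + RtoC (2 * INR k))))%C
          with (eta_coef s k * (s + RtoC (2 * INR k) - 1) * dirichlet (s + RtoC (2 * INR k)))%C
          by ring.
        apply CS_scal, CS_dirichlet. rewrite re_shift. pose proof (pos_INR k). lra.
      * assert (E0 : INR 0 + 1/2 = 1/2) by (simpl; ring).
        assert (T := CS_telescope (fun n => Cpower (INR n + 1/2) (1 - s))).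
        cbv beta in T. rewrite E0 in T.
        eapply CS_ext; [|apply T].
        { intros n. cbv beta. rewrite (S_INR n). reflexivity. }
        eapply is_lim_seq_ext; [|apply (is_lim_seq_Rpower_0 (Re s - 1) (1/2)); lra].
        intros n. cbv beta. rewrite Cmod_Cpower. f_equal. unfold Cminus.
        rewrite re_plus, re_opp, re_RtoC. ring.
    + unfold Cpower. f_equal. replace (1/2) with (/2) by field. rewrite ln_Rinv by lra.
      rewrite RtoC_opp. ring.
Qed.

(** [m] is fuel: level [m] is correct for [Re s > 1 - 2m], because the recursion uses only values at
    [s + 2], [s + 4] and so on, which are correct one level below. Returning the half-plane formula
    whenever [Re s > 1] makes all levels agree where they are correct. *)
Fixpoint eta_iter (m : nat) (s : C) : C :=
  match m with
  | O => eta_half s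
  | S m =>
      if Rlt_dec 1 (Re s) then eta_half s
      else (Cpower 2 (s - 1)
            - CSeries (fun k => eta_coef s (S k) * eta_iter m (s + RtoC (2 * INR (S k)))))%C
  end.

(** The fuel depends on [s] and exceeds [1 - Re s]; by [eta_eq] every sufficient amount gives the
    same value. *)
Definition eta (s : C) : C := eta_iter (Z.to_nat (up (1 - Re s))) s.

Lemma eta_iter_S m s : 1 - 2 * INR m < Re s -> eta_iter m s = eta_iter (S m) s.
Proof.
  revert s; induction m as [|m IH]; intros s Hs.
  - simpl in Hs. cbn [eta_iter]. destruct (Rlt_dec 1 (Re s)); [reflexivity|lra].
  - change (eta_iter (S (S m)) s) with
      (if Rlt_dec 1 (Re s) then eta_half s
      else (Cpower 2 (s - 1)
            - CSeries (fun k => eta_coef s (S k) * eta_iter (S m) (s + RtoC (2 * INR (S k)))))%C).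
    change (eta_iter (S m) s) with
      (if Rlt_dec 1 (Re s) then eta_half s
      else (Cpower 2 (s - 1)
            - CSeries (fun k => eta_coef s (S k) * eta_iter m (s + RtoC (2 * INR (S k)))))%C).
    destruct (Rlt_dec 1 (Re s)); [reflexivity|].
    f_equal. apply CSeries_ext. intros k. f_equal. apply IH.
    rewrite re_shift. rewrite !S_INR in *. pose proof (pos_INR k). lra.
Qed.

Lemma eta_iter_le m n s : 1 - 2 * INR m < Re s -> (m <= n)%nat ->
  eta_iter m s = eta_iter n s.
Proof.
  intros Hs Hmn. induction Hmn as [|n Hmn IH]; [reflexivity|].
  rewrite IH. apply eta_iter_S. apply le_INR in Hmn. lra.
Qed.

Lemma eta_eq m s : 1 - 2 * INR m < Re s -> eta s = eta_iter m s.
Proof.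
  intros Hs. unfold eta. set (f := Z.to_nat _).
  assert (Hf : 1 - 2 * INR f < Re s).
  { unfold f. destruct (archimed (1 - Re s)) as [A _].
    assert (B : IZR (up (1 - Re s)) <= INR (Z.to_nat (up (1 - Re s)))).
    { rewrite INR_IZR_INZ. apply IZR_le. lia. }
    pose proof (pos_INR (Z.to_nat (up (1 - Re s)))). lra. }
  rewrite (eta_iter_le f (max f m)) by (auto; lia).
  rewrite (eta_iter_le m (max f m)) by (auto; lia). reflexivity.
Qed.

Lemma eta_half_eq s : 1 < Re s -> eta s = eta_half s.
Proof. intros Hs. rewrite (eta_eq 0) by (simpl; lra). reflexivity. Qed.

(** For [Re s > 1] this is [functional_equation_half] with the term [k = 0], whose coefficient is 1,
    moved to the other side. Elsewhere it is the definition, with the fuel of the translates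
    readjusted. *)
Lemma eta_equation s : eta s = (Cpower 2 (s - 1)
  - CSeries (fun k => eta_coef s (S k) * eta (s + RtoC (2 * INR (S k)))))%C.
Proof.
  destruct (Rlt_dec 1 (Re s)) as [Hs|Hs].
  - rewrite (CSeries_ext _ (fun k => eta_coef s (S k) * eta_half (s + RtoC (2 * INR (S k))))%C).
    + pose proof (functional_equation_half s Hs) as H.
      apply CS_incr in H. rewrite (CS_unique _ _ H), eta_half_eq by exact Hs.
      replace (s + RtoC (2 * INR 0))%C with s by (simpl (INR 0); rewrite Rmult_0_r; ring).
      replace (eta_coef s 0) with (RtoC 1); [ring|].
      unfold eta_coef. simpl. rewrite Rmult_1_r. field.
    + intros k. rewrite eta_half_eq; [reflexivity|].
      rewrite re_shift. pose proof (pos_INR (S k)). lra.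
  - destruct (exists_INR_ge (1 - Re s)) as [m Hm].
    assert (Hm' : 1 - 2 * INR (S m) < Re s).
    { rewrite S_INR. pose proof (pos_INR m). lra. }
    rewrite (eta_eq (S m) s Hm'). cbn [eta_iter].
    destruct (Rlt_dec 1 (Re s)) as [Hs'|_]; [now apply Hs in Hs'|].
    f_equal. apply CSeries_ext. intros k. f_equal. symmetry. apply eta_eq.
    rewrite re_shift. rewrite S_INR in *. pose proof (pos_INR k). lra.
Qed.

(** * Analyticity of [eta] on the whole plane *)

Lemma pser_translate f a b r M :
  pser f (a + b) r M -> pser (fun z => f (z + b)%C) a r M.
Proof.
  intros (Hr & c & H1 & H2). split; [exact Hr|]. exists c. split; [exact H1|].
  intros z Hz. replace (z - a)%C with (z + b - (a + b))%C in * by ring. now apply H2.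
Qed.

(* Uniform control of all the translates [eta (s + 2 k)] is what the recursion propagates. *)
Definition eta_bounded_at (a : C) : Prop :=
  exists r M, 0 < r <= 1 /\ 0 <= M /\
    forall k, pser (fun s => eta (s + RtoC (2 * INR k))) a r (M * (INR k + 1)).

Lemma eta_bounded_half a : 1 < Re a -> eta_bounded_at a.
Proof.
  (* The disc reaches at most halfway to the line [Re s = 1], so [Re a - r > 1] and the Dirichlet
     majorant [K] is finite. Moving right by [2k] only decreases it, while the linear factor is at
     most [|a-1| + 2k + 1 <= (|a-1| + 2)(k+1)]. *)
  intros Ha. set (r := Rmin 1 ((Re a - 1) / 2)).
  assert (Hr : 0 < r <= 1 /\ r <= (Re a - 1) / 2).
  { unfold r. split; [split; [apply Rmin_glb_lt; lra|apply Rmin_l]|apply Rmin_r]. }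
  set (K := Series (fun n => Rpower (INR (n + 1)) (r - Re a))).
  assert (He : ex_series (fun n => Rpower (INR (n + 1)) (r - Re a))).
  { eapply ex_series_ext; [|apply (ex_series_Rpower (Re a - r)); lra].
    intros n. cbv beta. f_equal. ring. }
  assert (HK : 0 <= K).
  { apply (series_nonneg (fun n => Rpower (INR (n + 1)) (r - Re a))).
    - intros k. left; apply exp_pos.
    - now apply Series_correct. }
  exists r, ((Cmod (a - 1) + 2) * K). pose proof (Cmod_ge_0 (a - 1)).
  split; [lra|split; [apply Rmult_le_pos; lra|]].
  intros k. pose proof (pos_INR k).
  apply pser_ext with (fun s => (s - (1 - RtoC (2 * INR k))) * dirichlet (s + RtoC (2 * INR k)))%C.
  - intros z Hz. rewrite eta_half_eq; [unfold eta_half; ring|].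
    rewrite re_shift. pose proof (re_le_Cmod (z - a)) as Hre. unfold Cminus in Hre at 1.
    rewrite re_plus, re_opp in Hre. apply Rabs_le_between in Hre. lra.
  - eapply pser_weaken; [split; [apply Hr|apply Rle_refl]| |].
    2: { apply pser_mult; [apply pser_lin, Hr|].
         apply pser_translate, pser_dirichlet; [apply Hr|]. rewrite re_shift. lra. }
    rewrite Rmult_assoc, (Rmult_comm K), <- Rmult_assoc.
    apply Rmult_le_compat.
    + pose proof (Cmod_ge_0 (a - (1 - RtoC (2 * INR k)))). lra.
    + apply (series_nonneg (fun n => Rpower (INR (n + 1)) (r - Re (a + RtoC (2 * INR k))))).
      { intros j. left; apply exp_pos. }
      apply Series_correct. eapply ex_series_R_le; [|exact He]. intros j. cbv beta.
      rewrite Rabs_pos_eq by (left; apply exp_pos).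
      apply Rpower_anti; [apply INR_succ_ge_1|]. rewrite re_shift. lra.
    + replace (a - (1 - RtoC (2 * INR k)))%C with ((a - 1) + RtoC (2 * INR k))%C by ring.
      pose proof (Cmod_triangle (a - 1) (RtoC (2 * INR k))) as Ht.
      rewrite Cmod_R, (Rabs_pos_eq (2 * INR k)) in Ht by lra. nra.
    + apply Series_le; [|exact He]. intros j. split; [left; apply exp_pos|].
      apply Rpower_anti; [apply INR_succ_ge_1|]. rewrite re_shift. lra.
Qed.

(** The translate of index [k + 1] at [a] is the translate of index [k] at [a + 2], so only [eta]
    itself is new. It is [2^(s-1)] minus a series to which [pser_series] applies, the majorants
    [N k] being summable by [ex_series_eta_maj_lin]. *)
Lemma eta_bounded_step a : eta_bounded_at (a + RtoC 2) -> eta_bounded_at a.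
Proof.
  intros (r & M & Hr & HM & H).
  set (R := Cmod (a - 1) + r). assert (HR : 0 <= R) by (unfold R; pose proof (Cmod_ge_0 (a - 1)); lra).
  set (N := fun k => eta_maj R (S k) * (M * (INR k + 1))).
  assert (H' : forall k, pser (fun s => eta (s + RtoC (2 * INR (S k)))) a r (M * (INR k + 1))).
  { intros k. apply pser_ext with (fun s => eta (s + RtoC 2 + RtoC (2 * INR k))%C).
    - intros z _. f_equal. rewrite S_INR, <- Cplus_assoc, <- RtoC_plus. do 2 f_equal. ring.
    - exact (pser_translate (fun s => eta (s + RtoC (2 * INR k))) a (RtoC 2) r _ (H k)). }
  assert (HN : ex_series N).
  { assert (E := ex_series_eta_maj_lin R M 0 HR HM (Rle_refl 0)).
    apply ex_series_incr_1 in E. eapply ex_series_ext; [|exact E].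
    intros k. unfold N. cbv beta. rewrite S_INR, Rplus_0_r. reflexivity. }
  destruct (pser_series (fun k s => eta_coef s (S k) * eta (s + RtoC (2 * INR (S k))))%C a r N)
    as [Hs _]; [|exact HN|].
  { intros k. unfold N. apply pser_mult; [now apply pser_eta_coef|apply H']. }
  assert (HP : exists P, pser (fun s => Cpower 2 (s - 1)) a r P).
  { eexists. apply pser_ext with (fun s => Cpower 2 (- (1)) * Cexp (s * RtoC (ln 2)))%C.
    - intros z _. unfold Cpower. rewrite <- Cexp_plus. f_equal. ring.
    - apply pser_scal, pser_Cexp_lin. lra. }
  destruct HP as [P HP].
  assert (H0 : pser eta a r (P + Series N)).
  { apply pser_ext with (fun s => Cpower 2 (s - 1)
       + - (1) * CSeries (fun k => eta_coef s (S k) * eta (s + RtoC (2 * INR (S k)))))%C.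
    - intros z _. rewrite (eta_equation z). ring.
    - apply pser_plus; [exact HP|].
      eapply pser_weaken; [split; [apply Hr|apply Rle_refl]| |apply pser_scal, Hs].
      rewrite Cmod_m1. lra. }
  pose proof (pser_nonneg _ _ _ _ H0) as HPN.
  exists r, (P + Series N + M). split; [exact Hr|split; [lra|]].
  intros [|k].
  - simpl (INR 0). apply pser_ext with eta.
    { intros z _. f_equal. rewrite Rmult_0_r. ring. }
    eapply pser_weaken; [split; [apply Hr|apply Rle_refl]| |exact H0]. lra.
  - eapply pser_weaken; [split; [apply Hr|apply Rle_refl]| |apply H'].
    rewrite S_INR. pose proof (pos_INR k). nra.
Qed.

Lemma eta_entire a : analytic_at eta a.
Proof.
  assert (H : forall m a, 1 - 2 * INR m < Re a -> eta_bounded_at a).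
  { induction m as [|m IH]; intros b Hb.
    - simpl in Hb. apply eta_bounded_half. lra.
    - apply eta_bounded_step, IH. rewrite re_shift. rewrite S_INR in Hb. lra. }
  destruct (exists_INR_ge (2 - Re a)) as [m Hm].
  destruct (H m a) as (r & M & Hr & HM & Hk); [pose proof (pos_INR m); lra|].
  specialize (Hk 0%nat). apply pser_analytic in Hk.
  apply analytic_ext_loc with (fun s => eta (s + RtoC (2 * INR 0))) 1; [lra| |exact Hk].
  intros z _. f_equal. simpl (INR 0). rewrite Rmult_0_r. ring.
Qed.

(** * Values of [eta] at 1, 0 and the negative even integers *)

Lemma CS_single_at j (w : C) : CS (fun k => if Nat.eqb k j then w else RtoC 0) w.
Proof.
  induction j as [|j IH].
  - eapply CS_ext; [|apply (CS_single w)]. now intros [|k].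
  - pose proof (CS_decr (fun k => if Nat.eqb k (S j) then w else RtoC 0) w IH) as H.
    cbn [Nat.eqb] in H. now rewrite Cplus_0_l in H.
Qed.

Lemma rise_neg_fact N j : (j <= N)%nat ->
  (rise (- RtoC (INR N)) j * RtoC (INR (fact (N - j))) = RtoC ((-1) ^ j * INR (fact N)))%C.
Proof.
  induction j as [|j IH]; intros Hj.
  - rewrite Nat.sub_0_r. simpl. rewrite Rmult_1_l. ring.
  - specialize (IH ltac:(lia)).
    replace (N - j)%nat with (S (N - S j)) in IH by lia.
    rewrite fact_simpl, mult_INR, RtoC_mult in IH.
    replace (INR (S (N - S j))) with (INR N - INR j) in IH
      by (rewrite <- minus_INR by lia; f_equal; lia).
    cbn [rise pow]. rewrite (Rmult_assoc (-1)), RtoC_mult, <- IH, RtoC_minus.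
    replace (RtoC (-1)) with (- RtoC 1)%C by (now rewrite <- RtoC_opp). ring.
Qed.

Lemma rise_neg_zero N j : (N < j)%nat -> rise (- RtoC (INR N)) j = 0.
Proof.
  induction 1 as [|j Hj IH]; cbn [rise]; [|rewrite IH]; ring.
Qed.

(** The rising factorial of [-N] of length [2k > N] contains the factor 0. For [N <= 1] this already
    removes every term of the recursion beyond [2^(s-1)]. *)
Lemma eta_coef_neg_zero s N k : s = (1 - RtoC (INR N))%C -> (N < 2 * k)%nat -> eta_coef s k = 0.
Proof.
  intros -> H. unfold eta_coef.
  replace (1 - RtoC (INR N) - 1)%C with (- RtoC (INR N))%C by ring.
  rewrite rise_neg_zero by exact H. unfold Cdiv. ring.
Qed.

Lemma eta_special_value s N : s = (1 - RtoC (INR N))%C -> (N <= 1)%nat ->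
  eta s = Cpower 2 (s - 1).
Proof.
  intros Es HN. rewrite eta_equation.
  rewrite (CS_unique _ (RtoC 0)); [ring|].
  eapply CS_ext; [|apply CS_zero]. intros k. cbv beta.
  rewrite (eta_coef_neg_zero s N) by (exact Es || lia). ring.
Qed.

Lemma eta_1 : eta 1 = 1.
Proof.
  rewrite (eta_special_value 1 0); [|simpl; ring|lia].
  replace (1 - 1)%C with (RtoC 0) by ring. apply Cpower_0.
Qed.

Lemma eta_0 : eta 0 = RtoC (1/2).
Proof.
  rewrite (eta_special_value 0 1); [|simpl; ring|lia].
  replace (0 - 1)%C with (RtoC (-1)) by (now rewrite <- RtoC_minus; f_equal; ring).
  rewrite Cpower_R. f_equal. replace (-1) with (- (1)) by ring.
  rewrite Rpower_Ropp, Rpower_1 by lra. lra.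
Qed.

(** At [s = -2p] the translates strictly between [s] and 0 vanish by induction, and those beyond 0
    have zero coefficient. What remains is the value at 0: there the rising factorial equals
    [(2p+1)!], so the coefficient is [4^(-p)] and the term [4^(-p)/2] cancels [2^(s-1)] exactly. *)
Lemma eta_neg_even p : (1 <= p)%nat -> eta (RtoC (- (2 * INR p))) = 0.
Proof.
  induction p as [p IH] using (well_founded_induction Nat.lt_wf_0). intros Hp.
  set (s := RtoC (- (2 * INR p))).
  assert (EN : INR (2 * p + 1) = 2 * INR p + 1)
    by (rewrite plus_INR, mult_INR; simpl; ring).
  assert (Es : s = (1 - RtoC (INR (2 * p + 1)))%C).
  { rewrite EN. unfold s. rewrite <- RtoC_minus. f_equal. ring. }
  assert (E1 : Cpower 2 (s - 1) = RtoC (/ 4 ^ p * (1/2))).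
  { unfold s. rewrite <- RtoC_minus, Cpower_R. f_equal.
    replace (- (2 * INR p) - 1) with (- INR (2 * p + 1)) by (rewrite EN; ring).
    rewrite Rpower_Ropp, Rpower_pow, pow_add, pow_mult by lra.
    replace (2 ^ 2) with 4 by ring. rewrite pow_1. field. apply pow_nonzero; lra. }
  rewrite eta_equation, E1.
  rewrite (CS_unique _ (RtoC (/ 4 ^ p * (1/2)))); [ring|].
  eapply CS_ext; [|apply (CS_single_at (p - 1))]. intros k. cbv beta.
  destruct (Nat.eqb_spec k (p - 1)) as [->|Hk].
  - replace (S (p - 1)) with p by lia.
    replace (s + RtoC (2 * INR p))%C with (RtoC 0)
      by (unfold s; rewrite <- RtoC_plus; f_equal; ring).
    rewrite eta_0, RtoC_mult. f_equal.
    unfold eta_coef. rewrite Es at 1.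
    replace (1 - RtoC (INR (2 * p + 1)) - 1)%C with (- RtoC (INR (2 * p + 1)))%C by ring.
    pose proof (rise_neg_fact (2 * p + 1) (2 * p) ltac:(lia)) as H.
    replace (2 * p + 1 - 2 * p)%nat with 1%nat in H by lia.
    rewrite pow_1_even in H. change (INR (fact 1)) with 1 in H. rewrite Cmult_1_r in H.
    rewrite H. rewrite <- RtoC_div.
    + f_equal. field. split; [apply pow_nonzero; lra|apply not_0_INR, fact_neq_0].
    + apply Rmult_integral_contrapositive_currified;
        [apply not_0_INR, fact_neq_0|apply pow_nonzero; lra].
  - destruct (Nat.lt_ge_cases k (p - 1)) as [Hlt|Hge].
    + replace (s + RtoC (2 * INR (S k)))%C with (RtoC (- (2 * INR (p - S k)))).
      * rewrite IH by lia. ring.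
      * unfold s. rewrite <- RtoC_plus, minus_INR by lia. f_equal. ring.
    + rewrite (eta_coef_neg_zero s (2 * p + 1)) by (exact Es || lia). ring.
Qed.

(** * Reality on the real axis *)

Lemma real_plus z w : snd z = 0 -> snd w = 0 -> snd (z + w)%C = 0.
Proof. intros H H'. simpl. lra. Qed.

Lemma real_mult z w : snd z = 0 -> snd w = 0 -> snd (z * w)%C = 0.
Proof. intros H H'. simpl. rewrite H, H'. ring. Qed.

Lemma real_opp z : snd z = 0 -> snd (- z)%C = 0.
Proof. intros H. simpl. lra. Qed.

Lemma real_inv z : snd z = 0 -> snd (/ z)%C = 0.
Proof. intros H. simpl. rewrite H. unfold Rdiv. ring. Qed.

Lemma real_Cpower x z : snd z = 0 -> snd (Cpower x z) = 0.
Proof.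
  intros H. unfold Cpower, Cexp. cbn [snd]. unfold Im.
  rewrite real_mult by (exact H || reflexivity). rewrite sin_0. ring.
Qed.

Lemma real_CSeries a : (forall k, snd (a k) = 0) -> snd (CSeries a) = 0.
Proof.
  intros H. cbn [snd CSeries]. unfold CSeries. cbn [snd].
  (* Writing the zero term as [0 * 0] lets [Series_scal_l] pull a factor 0 out of the series. *)
  rewrite (Series_ext _ (fun _ => 0 * 0)), Series_scal_l by (intros; rewrite H; ring). ring.
Qed.

Lemma real_rise z k : snd z = 0 -> snd (rise z k) = 0.
Proof.
  intros H. induction k as [|k IH]; [reflexivity|]. cbn [rise].
  now apply real_mult, real_plus.
Qed.

Lemma real_eta_iter m s : snd s = 0 -> snd (eta_iter m s) = 0.
Proof.
  assert (H0 : forall s, snd s = 0 -> snd (eta_half s) = 0).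
  { intros z Hz. apply real_mult; [now apply real_plus; [|apply real_opp]|].
    apply real_CSeries. intros k. now apply real_Cpower, real_opp. }
  revert s; induction m as [|m IH]; intros s Hs; [now apply H0|].
  cbn [eta_iter]. destruct (Rlt_dec 1 (Re s)); [now apply H0|].
  apply real_plus.
  - apply real_Cpower, real_plus; [exact Hs|now apply real_opp].
  - apply real_opp, real_CSeries. intros k. apply real_mult.
    + apply real_mult; [|now apply real_inv].
      apply real_rise, real_plus; [exact Hs|now apply real_opp].
    + now apply IH, real_plus.
Qed.

(** * The identity theorem for meromorphic functions *)

(** By continuity a function whose zeros accumulate at [a] vanishes at [a], so [z - a] can be
    divided out, and the quotient has the same zeros off [a]. Repeating gives [h = (z - a)^m g] with
    [g] bounded by [M / r^m], hence [|h z| <= (|z - a| / r)^m M] for every [m]. *)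
Lemma isolated_zeros h a : analytic_at h a ->
  (forall d, 0 < d -> exists z, 0 < Cmod (z - a) < d /\ h z = 0) ->
  exists d, 0 < d /\ forall z, Cmod (z - a) < d -> h z = 0.
Proof.
  intros (r & M & Hh)%analytic_pser Hacc. assert (Hr : 0 < r) by apply Hh.
  assert (Step : forall m, exists g, pser g a r (M / r ^ m) /\
     (forall d, 0 < d -> exists z, 0 < Cmod (z - a) < d /\ g z = 0) /\
     forall z, Cmod (z - a) < r -> h z = ((z - a) ^ m * g z)%C).
  { induction m as [|m (g & Hg & Hacc' & E)].
    - exists h. split; [|split; [exact Hacc|intros; simpl; ring]].
      simpl. now rewrite Rdiv_1_r.
    - assert (G0 : g a = 0).
      { destruct (Ceq_dec (g a) 0) as [|Hn]; [assumption|]. exfalso.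
        destruct (analytic_continuous g a) with (e := Cmod (g a)) as (d & Hd & Hc).
        - now apply pser_analytic in Hg.
        - now apply Cmod_gt_0.
        - destruct (Hacc' d Hd) as (z & Hz & Hgz). specialize (Hc z (proj2 Hz)).
          rewrite Hgz in Hc. replace (0 - g a)%C with (- g a)%C in Hc by ring.
          rewrite Cmod_opp in Hc. lra. }
      destruct (pser_div _ _ _ _ Hg) as (g1 & Hg1 & E1). exists g1. split; [|split].
      + simpl. replace (M / (r * r ^ m)) with (M / r ^ m / r); [exact Hg1|].
        field; repeat split; try lra; apply pow_nonzero; lra.
      + intros d Hd. destruct (Hacc' (Rmin d r)) as (z & Hz & Hgz).
        { now apply Rmin_glb_lt. }
        pose proof (Rmin_l d r). pose proof (Rmin_r d r).
        exists z. split; [lra|].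
        assert (Hzr : Cmod (z - a) < r) by lra.
        specialize (E1 z Hzr). rewrite Hgz, G0, Cplus_0_l in E1.
        destruct (Ceq_dec (g1 z) 0) as [|Hn]; [assumption|]. exfalso.
        apply (Cmult_neq_0 (z - a) (g1 z)); [|exact Hn|now symmetry].
        apply Cmod_gt_0. apply Hz.
      + intros z Hz. rewrite (E z Hz), (E1 z Hz), G0, Cpow_S. ring. }
  exists r. split; [exact Hr|]. intros z Hz.
  apply Cmod_eq_0. apply Rle_antisym; [|apply Cmod_ge_0].
  set (q := Cmod (z - a) / r).
  assert (Hq : 0 <= q < 1).
  { unfold q. pose proof (Cmod_ge_0 (z - a)). split.
    - apply Rmult_le_pos; [assumption|left; now apply Rinv_0_lt_compat].
    - apply Rmult_lt_reg_r with r; [exact Hr|]. unfold Rdiv.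
      rewrite Rmult_assoc, Rinv_l; lra. }
  assert (Hle : forall m, Cmod (h z) <= q ^ m * M).
  { intros m. destruct (Step m) as (g & Hg & _ & E). rewrite (E z Hz), Cmod_mult, Cmod_pow.
    unfold q, Rdiv. rewrite Rpow_mult_distr, pow_inv, Rmult_assoc, (Rmult_comm (/ r ^ m)).
    apply Rmult_le_compat_l; [apply pow_le, Cmod_ge_0|].
    now apply (pser_bound _ _ _ _ _ Hg). }
  assert (L : is_lim_seq (fun m => q ^ m * M) (0 * M)).
  { apply is_lim_seq_mult'; [|apply is_lim_seq_const]. apply is_lim_seq_geom.
    rewrite Rabs_pos_eq; lra. }
  rewrite Rmult_0_l in L.
  exact (is_lim_seq_le _ _ (Cmod (h z)) 0 Hle (is_lim_seq_const _) L).
Qed.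

(** The centre is left out because the value stored at a pole is arbitrary. *)
Definition germ_eq (f g : C -> C) (a : C) : Prop :=
  exists d, 0 < d /\ forall z, 0 < Cmod (z - a) < d -> f z = g z.

Lemma germ_eq_sym f g a : germ_eq f g a -> germ_eq g f a.
Proof. intros (d & Hd & H). exists d. split; [exact Hd|]. intros z Hz. symmetry. now apply H. Qed.

Lemma meromorphic_local_quotient f a : meromorphic f ->
  exists m F d, 0 < d /\ analytic_at F a /\
    forall z, 0 < Cmod (z - a) < d -> f z = (F z / (z - a) ^ m)%C.
Proof.
  intros H. destruct (H a) as [Hf|(m & g & r & _ & Hg & _ & Hr & E)].
  - exists 0%nat, f, 1. split; [lra|split; [exact Hf|]]. intros z _. simpl. field.
  - exists m, g, r. auto.
Qed.

(** Clearing both denominators turns [f - g] near [a] into an analytic function to which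
    [isolated_zeros] applies. *)
Lemma germ_eq_of_accumulation f g a : meromorphic f -> meromorphic g ->
  (forall d, 0 < d -> exists z, 0 < Cmod (z - a) < d /\ f z = g z) -> germ_eq f g a.
Proof.
  intros Hf Hg Hacc.
  destruct (meromorphic_local_quotient f a Hf) as (m & F & d1 & Hd1 & HF & EF).
  destruct (meromorphic_local_quotient g a Hg) as (k & G & d2 & Hd2 & HG & EG).
  set (h := fun z => (F z * (z - a) ^ k + - (1) * (G z * (z - a) ^ m))%C).
  assert (Hh : analytic_at h a).
  { apply analytic_plus; [|apply analytic_mult; [apply analytic_const|]];
    apply analytic_mult; auto using analytic_lin_pow. }
  destruct (isolated_zeros h a Hh) as (d & Hd & H0).
  - intros d Hd. destruct (Hacc (Rmin d (Rmin d1 d2))) as (z & Hz & E).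
    { repeat apply Rmin_glb_lt; assumption. }
    pose proof (Rmin_l d (Rmin d1 d2)). pose proof (Rmin_r d (Rmin d1 d2)).
    pose proof (Rmin_l d1 d2). pose proof (Rmin_r d1 d2).
    exists z. split; [lra|].
    assert (Hza : (z - a)%C <> 0) by (apply Cmod_gt_0; lra).
    rewrite EF, EG in E by lra. unfold h.
    pose proof (Cpow_nz _ m Hza) as Hm. pose proof (Cpow_nz _ k Hza) as Hk.
    replace (F z) with (F z / (z - a) ^ m * (z - a) ^ m)%C by (field; exact Hm).
    rewrite E. field. exact Hk.
  - exists (Rmin d (Rmin d1 d2)). split; [repeat apply Rmin_glb_lt; assumption|].
    intros z Hz.
    pose proof (Rmin_l d (Rmin d1 d2)). pose proof (Rmin_r d (Rmin d1 d2)).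
    pose proof (Rmin_l d1 d2). pose proof (Rmin_r d1 d2).
    assert (Hza : (z - a)%C <> 0) by (apply Cmod_gt_0; lra).
    pose proof (Cpow_nz _ m Hza) as Hm. pose proof (Cpow_nz _ k Hza) as Hk.
    rewrite EF, EG by lra. specialize (H0 z ltac:(lra)). unfold h in H0.
    assert (E : (F z * (z - a) ^ k = G z * (z - a) ^ m)%C).
    { transitivity (F z * (z - a) ^ k + - (1) * (G z * (z - a) ^ m) + G z * (z - a) ^ m)%C;
        [ring|rewrite H0; ring]. }
    replace (F z / (z - a) ^ m)%C with (F z * (z - a) ^ k / ((z - a) ^ m * (z - a) ^ k))%C
      by (field; auto).
    rewrite E. field. auto.
Qed.

Lemma Cmod_horizontal t x y : Cmod ((t, y) - (x, y))%C = Rabs (t - x).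
Proof. rewrite <- Cmod_R. f_equal. unfold Cminus, Cplus, Copp, RtoC. simpl. f_equal; ring. Qed.

(** The horizontal line through [a] is followed from the right. Let [b] be the supremum of the
    abscissas where the germs differ. Agreement to the right of [b] accumulates at [b], so the germs
    agree there too, hence also slightly to the left of [b], which contradicts the choice of [b]. *)
Lemma germ_eq_everywhere f g sigma : meromorphic f -> meromorphic g ->
  (forall s, sigma < Re s -> f s = g s) -> forall a, germ_eq f g a.
Proof.
  intros Hf Hg H a. destruct a as [x y].
  assert (Hbig : forall t, sigma < t -> germ_eq f g (t, y)).
  { intros t Ht. exists (t - sigma). split; [lra|]. intros z Hz. apply H.
    pose proof (re_le_Cmod (z - (t, y))) as Hre. unfold Cminus in Hre at 1.
    rewrite re_plus, re_opp in Hre. simpl (Re (t, y)) in Hre.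
    apply Rabs_le_between in Hre. lra. }
  destruct (classic (germ_eq f g (x, y))) as [|Hx]; [assumption|]. exfalso.
  destruct (completeness (fun t => ~ germ_eq f g (t, y))) as [b [Hub Hlub]].
  { exists sigma. intros t Ht. apply Rnot_lt_le. intros Hlt. now apply Ht, Hbig. }
  { now exists x. }
  assert (Habove : forall t, b < t -> germ_eq f g (t, y)).
  { intros t Ht. apply NNPP. intros Hn. specialize (Hub t Hn). lra. }
  assert (Hb : germ_eq f g (b, y)).
  { apply germ_eq_of_accumulation; [exact Hf|exact Hg|]. intros d Hd.
    destruct (Habove (b + d / 2) ltac:(lra)) as (d' & Hd' & E).
    (* The germ at [b + d/2] says nothing about its own centre, so the point of agreement is taken
       [e] to the right of it. *)
    set (e := Rmin (d / 4) (d' / 2)).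
    assert (He : 0 < e /\ e <= d / 4 /\ e <= d' / 2).
    { split; [apply Rmin_glb_lt; lra|split; [apply Rmin_l|apply Rmin_r]]. }
    exists (b + d / 2 + e, y). split.
    - rewrite Cmod_horizontal, Rabs_pos_eq; lra.
    - apply E. rewrite Cmod_horizontal, Rabs_pos_eq; lra. }
  destruct Hb as (d & Hd & E).
  assert (b <= b - d / 2); [|lra].
  apply Hlub. intros t Hn. apply Rnot_lt_le. intros Ht.
  destruct (Rlt_le_dec b t) as [Hbt|Hbt]; [now apply Hn, Habove|].
  destruct (Req_dec b t) as [<-|Hne]; [apply Hn; now exists d|].
  (* The disc about [t] must stay within distance [d] of [b] and avoid [b], where agreement is not
     known. *)
  apply Hn. exists (Rmin (b - t) (d / 2)). split; [apply Rmin_glb_lt; lra|].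
  intros z Hz. pose proof (Rmin_l (b - t) (d / 2)). pose proof (Rmin_r (b - t) (d / 2)).
  apply E.
  assert (T1 := Cmod_triangle (z - (t, y)) ((t, y) - (b, y))).
  assert (T2 := Cmod_triangle (z - (b, y)) (- (z - (t, y)))).
  replace (z - (t, y) + ((t, y) - (b, y)))%C with (z - (b, y))%C in T1 by ring.
  replace (z - (b, y) + - (z - (t, y)))%C with ((t, y) - (b, y))%C in T2 by ring.
  rewrite Cmod_opp in T2. rewrite Cmod_horizontal, Rabs_left in T1, T2 by lra. lra.
Qed.

Lemma analytic_germ_eq_value f g a : analytic_at f a -> analytic_at g a ->
  germ_eq f g a -> f a = g a.
Proof.
  intros Hf Hg (d & Hd & E).
  destruct (isolated_zeros (fun z => f z + - (1) * g z)%C a) as (d' & Hd' & H0).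
  - apply analytic_plus; [exact Hf|]. apply analytic_mult; [apply analytic_const|exact Hg].
  - intros e He. set (x := Rmin d e / 2).
    assert (0 < Rmin d e) by (now apply Rmin_glb_lt).
    pose proof (Rmin_l d e). pose proof (Rmin_r d e).
    exists (a + RtoC x)%C. replace (a + RtoC x - a)%C with (RtoC x) by ring.
    rewrite Cmod_R, Rabs_pos_eq by (unfold x; lra). split; [unfold x; lra|].
    rewrite E; [ring|]. replace (a + RtoC x - a)%C with (RtoC x) by ring.
    rewrite Cmod_R, Rabs_pos_eq; unfold x; lra.
  - specialize (H0 a). rewrite Cmod_minus_self in H0. specialize (H0 Hd'). cbv beta in H0.
    transitivity (f a + - (1) * g a + g a)%C; [ring|]. rewrite H0. ring.
Qed.

Lemma germ_eq_has_pole f g a : germ_eq f g a -> has_pole f a -> has_pole g a.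
Proof.
  intros (d & Hd & E) (m & F & r & Hm & HF & H0 & Hr & EF).
  exists m, F, (Rmin d r). repeat split; auto; [now apply Rmin_glb_lt|].
  intros z Hz. pose proof (Rmin_l d r). pose proof (Rmin_r d r).
  rewrite <- E by lra. apply EF. lra.
Qed.

(** The numerator [F] agrees off [a] with the analytic function [f z * (z - a)^m], hence also at
    [a], where the latter is 0. *)
Lemma analytic_not_pole f a : analytic_at f a -> ~ has_pole f a.
Proof.
  intros Hf (m & F & r & Hm & HF & H0 & Hr & EF). apply H0.
  rewrite (analytic_germ_eq_value F (fun z => f z * (z - a) ^ m)%C a HF).
  - replace (a - a)%C with (RtoC 0) by ring. destruct m as [|m]; [lia|].
    rewrite Cpow_S. ring.
  - apply analytic_mult; [exact Hf|apply analytic_lin_pow].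
  - exists r. split; [exact Hr|]. intros z Hz. rewrite EF by exact Hz. field.
    apply Cpow_nz, Cmod_gt_0, Hz.
Qed.

Lemma mero_eq_of_half_plane f g sigma : meromorphic f -> meromorphic g ->
  (forall s, sigma < Re s -> f s = g s) -> mero_eq f g.
Proof.
  intros Hf Hg H. pose proof (germ_eq_everywhere f g sigma Hf Hg H) as G.
  split; [exact Hf|split; [exact Hg|split]].
  - intros s. split; apply germ_eq_has_pole; [|apply germ_eq_sym]; apply G.
  - intros s Hs. destruct (Hf s) as [Af|]; [|contradiction].
    destruct (Hg s) as [Ag|Pg].
    + now apply analytic_germ_eq_value.
    + exfalso. apply Hs, (germ_eq_has_pole g f); [apply germ_eq_sym, G|exact Pg].
Qed.

(** Exhibiting one continuation [g] is enough for [epsilon] to return a genuine one. On the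
    half-plane both are sums of the same series. *)
Lemma continuation_correct a sigma g : is_continuation a sigma g ->
  is_continuation a sigma (continuation a sigma) /\
  forall s, sigma < Re s -> continuation a sigma s = g s.
Proof.
  intros Hg.
  assert (Hc : is_continuation a sigma (continuation a sigma)).
  { unfold continuation. apply epsilon_spec. now exists g. }
  split; [exact Hc|]. intros s Hs.
  exact (CS_inj _ _ _ (proj2 Hc s Hs) (proj2 Hg s Hs)).
Qed.

Lemma continuation_spec a sigma g :
  is_continuation a sigma g -> mero_eq (continuation a sigma) g.
Proof.
  intros Hg. destruct (continuation_correct a sigma g Hg) as [Hc E].
  apply (mero_eq_of_half_plane _ _ sigma); [apply Hc|apply Hg|exact E].
Qed.

Lemma continuation_germ_eq a sigma g s :
  is_continuation a sigma g -> germ_eq (continuation a sigma) g s.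
Proof.
  intros Hg. destruct (continuation_correct a sigma g Hg) as [Hc E].
  apply (germ_eq_everywhere _ _ sigma); [apply Hc|apply Hg|exact E].
Qed.

Lemma CS_geom q : Cmod q < 1 -> CS (fun k => q ^ k)%C (/ (1 - q))%C.
Proof.
  intros Hq. assert (H : CS (fun k => q ^ k)%C (CSeries (fun k => q ^ k)%C)).
  { apply CS_abs. eapply ex_series_ext; [|apply (ex_series_geom (Cmod q))].
    - intros k. cbv beta. symmetry. apply Cmod_pow.
    - rewrite Rabs_pos_eq; [exact Hq|apply Cmod_ge_0]. }
  assert (Hn : (1 - q)%C <> 0).
  { intros E. assert (q = 1) as -> by (transitivity (1 - (1 - q))%C; [ring|rewrite E; ring]).
    rewrite Cmod_1 in Hq. lra. }
  set (L := CSeries _) in *.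
  assert (E : L = (1 + q * L)%C).
  { apply (CS_inj _ _ _ H). apply (CS_decr (fun k => q ^ k)%C).
    exact (CS_scal q _ _ H). }
  assert (E1 : ((1 - q) * L)%C = 1).
  { transitivity (L - q * L)%C; [ring|]. rewrite E at 1. ring. }
  replace (/ (1 - q))%C with L; [exact H|].
  transitivity ((1 - q) * L * / (1 - q))%C; [field; exact Hn|]. rewrite E1. ring.
Qed.

Lemma analytic_inv_lin b a : a <> b -> analytic_at (fun s => / (s - b))%C a.
Proof.
  intros Hab. assert (Hn : (a - b)%C <> 0).
  { intros E. apply Hab. transitivity (a - b + b)%C; [ring|rewrite E; ring]. }
  exists (fun k => (/ (a - b) * (- / (a - b)) ^ k)%C), (Cmod (a - b)).
  assert (Hp : 0 < Cmod (a - b)) by now apply Cmod_gt_0.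
  split; [exact Hp|]. intros z Hz.
  apply is_pseries_CS.
  assert (Hq : Cmod (- / (a - b) * (z - a)) < 1).
  { rewrite Cmod_mult, Cmod_opp, Cmod_inv by exact Hn.
    apply Rmult_lt_reg_l with (Cmod (a - b)); [exact Hp|].
    rewrite <- Rmult_assoc, Rinv_r by lra. lra. }
  assert (Hzb : (z - b)%C <> 0).
  { intros E. assert (Ez : (z - a)%C = (- (a - b))%C).
    { transitivity (z - b - (a - b))%C; [ring|rewrite E; ring]. }
    rewrite Ez, Cmod_opp in Hz. lra. }
  replace (/ (z - b))%C with (/ (a - b) * / (1 - - / (a - b) * (z - a)))%C.
  - eapply CS_ext; [|apply (CS_scal _ _ _ (CS_geom _ Hq))].
    intros k. cbv beta. rewrite Cpow_mult_l. ring.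
  - replace (1 - - / (a - b) * (z - a))%C with ((z - b) / (a - b))%C by (field; exact Hn).
    field. auto.
Qed.

(** * The Riemann zeta function and finite sums of its translates *)

Lemma Cminus_neq_0 (a b : C) : a <> b -> (a - b)%C <> 0.
Proof. intros H E. apply H. transitivity (a - b + b)%C; [ring|rewrite E; ring]. Qed.

Lemma zeta_quotient_meromorphic : meromorphic (fun s => eta s / (s - 1))%C.
Proof.
  intros a. destruct (Ceq_dec a 1) as [->|Ha].
  - right. exists 1%nat, eta, 1. repeat split; [lia|apply eta_entire| |lra|].
    + rewrite eta_1. intros E. apply RtoC_inj in E. lra.
    + intros z _. now rewrite Cpow_1_r.
  - left. apply (analytic_mult eta (fun s => / (s - 1))%C); [apply eta_entire|now apply analytic_inv_lin].
Qed.

Lemma zeta_quotient_continuation :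
  is_continuation (fun k s => Cpower (INR (k + 1)) (- s)%C) 1 (fun s => eta s / (s - 1))%C.
Proof.
  split; [apply zeta_quotient_meromorphic|]. intros s Hs.
  rewrite eta_half_eq by exact Hs.
  replace (eta_half s / (s - 1))%C with (dirichlet s); [now apply CS_dirichlet|].
  unfold eta_half. field. apply Cminus_neq_0. intros ->. rewrite re_RtoC in Hs. lra.
Qed.

(** [zeta] is a choice among continuations, but its value is forced wherever it has no pole, that
    is, off 1. *)
Lemma zeta_eq (s : C) : s <> 1 -> zeta s = (eta s / (s - 1))%C.
Proof.
  intros Hs. destruct (continuation_spec _ _ _ zeta_quotient_continuation) as (_ & _ & P & V).
  apply V. rewrite P. apply analytic_not_pole.
  apply (analytic_mult eta (fun s => / (s - 1))%C); [apply eta_entire|now apply analytic_inv_lin].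
Qed.

Lemma zeta_analytic (a : C) : a <> 1 -> analytic_at zeta a.
Proof.
  intros Ha. pose proof (Cminus_neq_0 _ _ Ha) as Hn.
  apply analytic_ext_loc with (fun s => eta s / (s - 1))%C (Cmod (a - 1)).
  - now apply Cmod_gt_0.
  - intros z Hz. symmetry. apply zeta_eq. intros ->.
    replace (1 - a)%C with (- (a - 1))%C in Hz by ring. rewrite Cmod_opp in Hz. lra.
  - apply (analytic_mult eta (fun s => / (s - 1))%C); [apply eta_entire|now apply analytic_inv_lin].
Qed.

Lemma CS_zeta s : 1 < Re s -> CS (fun k => Cpower (INR (k + 1)) (- s)) (zeta s).
Proof.
  intros Hs. rewrite zeta_eq; [now apply zeta_quotient_continuation|].
  intros ->. rewrite re_RtoC in Hs. lra.
Qed.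

Lemma zeta_real x : x <> 1 -> snd (zeta (RtoC x)) = 0.
Proof.
  intros Hx. rewrite zeta_eq by (intros E; apply RtoC_inj in E; contradiction).
  apply real_mult.
  - apply real_eta_iter. reflexivity.
  - apply real_inv. simpl. ring.
Qed.

Lemma zeta_0 : zeta 0 = RtoC (- (1/2)).
Proof.
  rewrite zeta_eq by (intros E; apply RtoC_inj in E; lra).
  rewrite eta_0. rewrite <- RtoC_minus, <- RtoC_div by lra. f_equal. field.
Qed.

Lemma zeta_neg_even p : (1 <= p)%nat -> zeta (RtoC (- (2 * INR p))) = 0.
Proof.
  intros Hp. pose proof (pos_INR p).
  rewrite zeta_eq by (intros E; apply RtoC_inj in E; lra).
  rewrite eta_neg_even by exact Hp. unfold Cdiv. ring.
Qed.

(** * Meromorphy of finite sums with arbitrary values at poles *)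

Definition mero_at (f : C -> C) (a : C) : Prop := analytic_at f a \/ has_pole f a.

Lemma has_pole_plus f g a : analytic_at f a -> has_pole g a ->
  has_pole (fun z => f z + g z)%C a.
Proof.
  intros Hf (m & G & r & Hm & HG & H0 & Hr & E).
  exists m, (fun z => f z * (z - a) ^ m + G z)%C, r. repeat split; [exact Hm| | |exact Hr|].
  - apply analytic_plus; [apply analytic_mult; [exact Hf|apply analytic_lin_pow]|exact HG].
  - replace (a - a)%C with (RtoC 0) by ring. destruct m as [|m]; [lia|]. rewrite Cpow_S.
    replace (f a * (0 * 0 ^ m) + G a)%C with (G a) by ring. exact H0.
  - intros z Hz. rewrite E by exact Hz. field. apply Cpow_nz, Cmod_gt_0, Hz.
Qed.

Lemma has_pole_ext f g a : (forall z, f z = g z) -> has_pole f a -> has_pole g a.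
Proof. intros E. apply germ_eq_has_pole. exists 1. split; [lra|]. intros; apply E. Qed.

Lemma mero_at_ext f g a : (forall z, f z = g z) -> mero_at f a -> mero_at g a.
Proof.
  intros E [H|H]; [left; now apply (analytic_ext_loc f g a 1 Rlt_0_1)|
                   right; now apply (has_pole_ext f)].
Qed.

Lemma mero_at_plus f g a : analytic_at f a -> mero_at g a -> mero_at (fun z => f z + g z)%C a.
Proof. intros Hf [Hg|Hg]; [left; now apply analytic_plus|right; now apply has_pole_plus]. Qed.

Lemma mero_at_mult f g a : analytic_at f a -> f a <> 0 -> mero_at g a ->
  mero_at (fun z => f z * g z)%C a.
Proof.
  intros Hf H0 [Hg|(m & G & r & Hm & HG & HG0 & Hr & E)]; [left; now apply analytic_mult|].
  right. exists m, (fun z => f z * G z)%C, r. repeat split; [exact Hm| | |exact Hr|].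
  - now apply analytic_mult.
  - now apply Cmult_neq_0.
  - intros z Hz. rewrite E by exact Hz. unfold Cdiv. ring.
Qed.

(** A zero of [h] at the pole of the translate would cancel it and leave a wrong value there. The
    second alternative covers a vanishing central factorial number. *)
Lemma mero_at_zeta_term h b a : analytic_at h a -> (h a <> 0 \/ forall s, h s = 0) ->
  mero_at (fun s => h s * zeta (s + b))%C a.
Proof.
  intros Hh [H0|H0].
  - apply mero_at_mult; [exact Hh|exact H0|].
    destruct (Ceq_dec (a + b)%C 1) as [E|E].
    + right. exists 1%nat, (fun s => eta (s + b)%C), 1.
      repeat split; [lia|apply analytic_shift, eta_entire| |lra|].
      * rewrite E, eta_1. intros E1. apply RtoC_inj in E1. lra.
      * intros z Hz. assert (Hza : (z - a)%C <> 0) by (apply Cmod_gt_0, Hz).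
        assert (E2 : (z + b - 1)%C = (z - a)%C) by (rewrite <- E; ring).
        rewrite zeta_eq, E2, Cpow_1_r; [reflexivity|].
        intros E3. apply Hza. rewrite <- E2, E3. ring.
    + left. now apply analytic_shift, zeta_analytic.
  - left. apply (analytic_ext_loc (fun _ => RtoC 0) _ a 1 Rlt_0_1);
      [intros; rewrite H0; ring|apply analytic_const].
Qed.

Notation csum a n := (sum_n_m (G := C_AbelianMonoid) a 1 n).

Lemma csum_0 (a : nat -> C) : csum a 0 = RtoC 0 :> C.
Proof. apply (sum_n_m_zero a). lia. Qed.

Lemma csum_S (a : nat -> C) n : csum a (S n) = (csum a n + a (S n))%C :> C.
Proof. apply (sum_n_Sm a 1 n). lia. Qed.

Lemma csum_ext (a b : nat -> C) n : (forall i, (1 <= i <= n)%nat -> a i = b i) ->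
  csum a n = csum b n :> C.
Proof. apply (sum_n_m_ext_loc a b 1 n). Qed.

Lemma csum_scal (c : C) (a : nat -> C) n : csum (fun i => c * a i)%C n = (c * csum a n)%C :> C.
Proof.
  induction n as [|n IH]; [rewrite !csum_0; ring|]. rewrite !csum_S, IH. ring.
Qed.

Lemma csum_RtoC (a : nat -> R) n : csum (fun i => RtoC (a i)) n = RtoC (sum_n_m a 1 n) :> C.
Proof.
  induction n as [|n IH].
  - rewrite csum_0, sum_n_m_zero by lia. reflexivity.
  - rewrite csum_S, IH, (sum_n_Sm a) by lia. now rewrite <- RtoC_plus.
Qed.

(** Two poles might cancel, so at most one summand may fail to be analytic at [a]. The induction
    therefore remembers an index of such a summand once one has occurred; all later ones are then
    analytic. *)
Lemma mero_at_csum (F : nat -> C -> C) a n :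
  (forall i, mero_at (F i) a) ->
  (forall i j, i <> j -> analytic_at (F i) a \/ analytic_at (F j) a) ->
  mero_at (fun s => csum (fun i => F i s) n) a.
Proof.
  intros H1 H2.
  assert (H : analytic_at (fun s => csum (fun i => F i s) n) a \/
    (mero_at (fun s => csum (fun i => F i s) n) a /\
     exists i, (i <= n)%nat /\ ~ analytic_at (F i) a)).
  { induction n as [|n IH].
    - left. apply (analytic_ext_loc (fun _ => RtoC 0) _ a 1 Rlt_0_1);
        [intros; now rewrite csum_0|apply analytic_const].
    - assert (E : forall s, (csum (fun i => F i s) n + F (S n) s)%C = csum (fun i => F i s) (S n))
        by (intros s; now rewrite csum_S).
      destruct IH as [IH|[IH (i & Hi & Hni)]].
      + destruct (classic (analytic_at (F (S n)) a)) as [A|A].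
        * left. apply (analytic_ext_loc _ _ a 1 Rlt_0_1 (fun s _ => E s)).
          now apply analytic_plus.
        * right. split; [|now exists (S n)].
          apply (mero_at_ext _ _ _ E). now apply mero_at_plus.
      + destruct (H2 i (S n)) as [A|A]; [lia|contradiction|].
        right. split; [|exists i; split; [lia|exact Hni]].
        apply mero_at_ext with (fun s => F (S n) s + csum (fun i => F i s) n)%C.
        * intros s. rewrite <- E. ring.
        * now apply mero_at_plus. }
  destruct H as [H|[H _]]; [now left|exact H].
Qed.

Lemma CS_csum (a : nat -> nat -> C) (l : nat -> C) n :
  (forall i, (1 <= i <= n)%nat -> CS (a i) (l i)) ->
  CS (fun k => csum (fun i => a i k) n) (csum l n).
Proof.
  induction n as [|n IH]; intros H.
  - rewrite csum_0. eapply CS_ext; [|apply CS_zero]. intros k. now rewrite csum_0.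
  - rewrite csum_S. eapply CS_ext; [|apply CS_plus; [apply IH|apply (H (S n))]].
    + intros k. now rewrite csum_S.
    + intros i Hi. apply H. lia.
    + lia.
Qed.

Lemma CS_drop (a : nat -> C) (l : C) N : (forall k, (k < N)%nat -> a k = 0) ->
  CS a l -> CS (fun k => a (N + k)%nat) l.
Proof.
  induction N as [|N IH]; intros H0 H; [exact H|].
  assert (H' := CS_incr _ _ (IH (fun k Hk => H0 k ltac:(lia)) H)). cbv beta in H'.
  rewrite Nat.add_0_r, H0 in H' by lia.
  replace (l - 0)%C with l in H' by ring.
  eapply CS_ext; [|exact H']. intros k. cbv beta. f_equal. lia.
Qed.

(** * Multiplicities as polynomials in the eigenvalue, and the Dirichlet series *)

Lemma fold_prod_app (f : nat -> R) l i :
  fold_right (fun i p => f i * p) 1 (l ++ i :: nil)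
  = fold_right (fun i p => f i * p) 1 l * f i.
Proof. induction l as [|j l IH]; simpl; [ring|]. rewrite IH. ring. Qed.

Lemma fold_prod_zero (f : nat -> R) l i : In i l -> f i = 0 ->
  fold_right (fun i p => f i * p) 1 l = 0.
Proof.
  intros Hi H0. induction l as [|j l IH]; [easy|]. simpl.
  destruct Hi as [->|Hi]; [rewrite H0; ring|]. rewrite IH by exact Hi. ring.
Qed.

(** Each factor splits as [(M - i)(M + i)]. The eigenvalue is [2M] with [M = n + k]; division by
    [M (2n-1)! (M-n)!] turns the right side into its multiplicity. *)
Lemma even_product n M : (1 <= n <= M)%nat ->
  fold_right (fun i p => (INR M ^ 2 - INR i ^ 2) * p) 1 (seq 0 n) * INR (fact (M - n))
  = INR M * INR (fact (M + n - 1)).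
Proof.
  intros [Hn HM]. revert HM. induction Hn as [|n Hn IH]; intros HM.
  - replace (M + 1 - 1)%nat with (S (M - 1)) by lia.
    rewrite fact_simpl, mult_INR. replace (S (M - 1)) with M by lia. simpl. ring.
  - specialize (IH ltac:(lia)). rewrite seq_S, fold_prod_app.
    replace (M + S n - 1)%nat with (S (M + n - 1)) by lia.
    rewrite fact_simpl, mult_INR. replace (S (M + n - 1)) with (M + n)%nat by lia.
    replace (M - n)%nat with (S (M - S n)) in IH by lia.
    rewrite fact_simpl, mult_INR in IH. replace (S (M - S n)) with (M - n)%nat in IH by lia.
    rewrite minus_INR in IH by lia. rewrite (plus_INR M). change (0 + n)%nat with n.
    set (P := fold_right _ _ _) in *.
    transitivity (P * ((INR M - INR n) * INR (fact (M - S n))) * (INR M + INR n)); [ring|].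
    rewrite IH. ring.
Qed.

(** Each factor is [4 (M - i + 1)(M + i)]. The eigenvalue is [2M + 1], and the lemma is used with
    [n - 1] in place of [n], for dimension [2n - 1]. *)
Lemma odd_product n M : (n <= M)%nat ->
  fold_right (fun i p => ((2 * INR M + 1) ^ 2 - (2 * INR i - 1) ^ 2) * p) 1 (seq 1 n)
    * INR (fact (M - n))
  = 4 ^ n * INR (fact (M + n)).
Proof.
  intros HM. induction n as [|n IH].
  - rewrite Nat.sub_0_r, Nat.add_0_r. simpl. ring.
  - specialize (IH ltac:(lia)). rewrite seq_S, fold_prod_app.
    rewrite Nat.add_succ_r, fact_simpl, mult_INR, <- Nat.add_succ_r, (plus_INR M).
    replace (M - n)%nat with (S (M - S n)) in IH by lia.
    rewrite fact_simpl, mult_INR in IH. replace (S (M - S n)) with (M - n)%nat in IH by lia.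
    rewrite minus_INR in IH by lia. change (1 + n)%nat with (S n). rewrite S_INR.
    set (P := fold_right _ _ _) in *. cbn [pow].
    transitivity (P * ((INR M - INR n) * INR (fact (M - S n))) * (4 * (INR M + (INR n + 1))));
      [ring|].
    rewrite IH. ring.
Qed.

Definition zeta_H_even (n : nat) (s : C) : C :=
  (Cpower 2 (- s) / RtoC (INR (fact (2 * n - 1)))
   * csum (fun i => RtoC (IZR (u n i)) * zeta (s - RtoC (2 * INR i) + 1)) n)%C.

Definition zeta_H_odd (n : nat) (s : C) : C :=
  (1 / RtoC (4 ^ n * INR (fact (2 * n - 2)))
   * csum (fun i => RtoC (IZR (v n i)) * (4 - Cpower 2 (- s + RtoC (2 * INR i)))
                    * zeta (s - RtoC (2 * INR i) + 2)) n)%C.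

(** Translating the argument of [zeta] by [-2k] multiplies a Dirichlet term by [(x^2)^k]. A
    combination of translates thus becomes a polynomial in [x^2], which [u_spec] and [v_spec]
    factor. *)
Lemma Cpower_shift x s k b : 0 < x ->
  Cpower x (- (s - RtoC (2 * INR k) + b)) = (Cpower x (- (s + b)) * RtoC ((x ^ 2) ^ k))%C.
Proof.
  intros Hx. rewrite <- pow_mult, <- Cpower_INR, <- Cpower_plus by exact Hx.
  f_equal. rewrite mult_INR. simpl (INR 2). replace (1 + 1) with 2 by ring. ring.
Qed.

Lemma zeta_H_even_series n s : (1 <= n)%nat -> INR (2 * n) < Re s ->
  CS (fun k => RtoC (Binomial.C (2 * n + k - 1) k) * Cpower (INR (2 * k + 2 * n)) (- s))%C
     (zeta_H_even n s).
Proof.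
  intros Hn Hs. unfold zeta_H_even.
  set (f := INR (fact (2 * n - 1))).
  assert (Hf : f <> 0) by apply not_0_INR, fact_neq_0.
  assert (H' := CS_csum (fun i k => RtoC (IZR (u n i))
                  * Cpower (INR (k + 1)) (- (s - RtoC (2 * INR i) + 1)))%C
                (fun i => RtoC (IZR (u n i)) * zeta (s - RtoC (2 * INR i) + 1))%C n).
  assert (H := fun h => CS_scal (Cpower 2 (- s) / RtoC f) _ _ (H' h)). clear H'.
  cbv beta in H. refine ((fun H0 => _) (H _)); clear H.
  - rename H0 into H. set (P := fun M : nat => fold_right (fun i p => (INR M ^ 2 - INR i ^ 2) * p) 1 (seq 0 n)).
    assert (E : forall k, (Cpower 2 (- s) / RtoC f * csum (fun i => RtoC (IZR (u n i))
                  * Cpower (INR (k + 1)) (- (s - RtoC (2 * INR i) + 1))) n)%C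
       = (RtoC (P (k + 1)%nat / (INR (k + 1) * f)) * Cpower (INR (2 * (k + 1))) (- s))%C).
    { intros k. pose proof (INR_succ_ge_1 k) as Hk. set (M := INR (k + 1)) in *.
      rewrite (csum_ext _ (fun i => Cpower M (- (s + 1)) * RtoC (IZR (u n i) * (M ^ 2) ^ i))%C).
      2: { intros i _. rewrite Cpower_shift by lra. rewrite RtoC_mult. ring. }
      rewrite csum_scal, csum_RtoC, u_spec by exact Hn. fold M.
      change (fold_right _ 1 (seq 0 n)) with (P (k + 1)%nat).
      rewrite mult_INR. simpl (INR 2). replace (1 + 1) with 2 by ring. fold M.
      rewrite Cpower_mult by lra.
      replace (Cpower M (- s)) with (Cpower M (- (s + 1)) * RtoC M)%C.
      - rewrite RtoC_div, RtoC_mult by nra. field.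
        split; apply RtoC_neq_0; [exact Hf|lra].
      - replace (- s)%C with (- (s + 1) + RtoC (INR 1))%C by (simpl (INR 1); ring).
        rewrite Cpower_plus, Cpower_INR by lra. now rewrite pow_1. }
    apply (CS_ext _ _ _ E) in H.
    (* The Dirichlet series starts at [M = 1], the spectrum at [M = n]: for [M < n] the product
       contains the factor [M^2 - M^2]. *)
    apply (CS_drop _ _ (n - 1)) in H.
    + eapply CS_ext; [|exact H]. intros k. cbv beta.
      replace (n - 1 + k + 1)%nat with (n + k)%nat by lia.
      replace (2 * (n + k))%nat with (2 * k + 2 * n)%nat by lia.
      f_equal. f_equal.
      pose proof (even_product n (n + k) ltac:(lia)) as EP. fold (P (n + k)%nat) in EP.
      replace (n + k - n)%nat with k in EP by lia.
      replace (n + k + n - 1)%nat with (2 * n + k - 1)%nat in EP by lia.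
      unfold Binomial.C. replace (2 * n + k - 1 - k)%nat with (2 * n - 1)%nat by lia. fold f.
      assert (INR (fact k) <> 0) by apply not_0_INR, fact_neq_0.
      assert (INR (n + k) <> 0) by (apply not_0_INR; lia).
      apply Rmult_eq_reg_r with (INR (fact k)); [|assumption].
      transitivity (P (n + k)%nat * INR (fact k) / (INR (n + k) * f)); [field; auto|].
      rewrite EP. field. auto.
    + intros k Hk. replace (P (k + 1)%nat) with 0; [unfold Rdiv; rewrite Rmult_0_l; ring|].
      symmetry. apply fold_prod_zero with (k + 1)%nat; [apply in_seq; lia|ring].
  - intros i Hi. apply CS_scal, CS_zeta. unfold Cminus.
    rewrite !re_plus, re_opp, !re_RtoC. rewrite mult_INR in Hs. simpl (INR 2) in Hs.
    assert (INR i <= INR n) by (apply le_INR; lia). lra.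
Qed.

(** The terms are grouped in pairs [2k+1], [2k+2], and the even one is removed as a term of
    [2^(-s) zeta s]. *)
Lemma CS_odd_zeta s : 1 < Re s ->
  CS (fun k => Cpower (INR (2 * k + 1)) (- s)) ((1 - Cpower 2 (- s)) * zeta s)%C.
Proof.
  intros Hs. assert (H := CS_zeta s Hs).
  assert (H2 := CS_minus _ _ _ _ (CS_pair _ _ H) (CS_scal (Cpower 2 (- s)) _ _ H)).
  replace ((1 - Cpower 2 (- s)) * zeta s)%C with (zeta s - Cpower 2 (- s) * zeta s)%C by ring.
  eapply CS_ext; [|exact H2]. intros k. cbv beta.
  rewrite <- Cpower_mult by (pose proof (INR_succ_ge_1 k); lra).
  replace (INR (2 * k + 1 + 1)) with (2 * INR (k + 1)); [ring|].
  replace (2 * k + 1 + 1)%nat with (2 * (k + 1))%nat by lia. rewrite (mult_INR 2). simpl (INR 2). ring.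
Qed.

Lemma zeta_H_odd_series n s : (1 <= n)%nat -> INR (2 * n - 1) < Re s ->
  CS (fun k => RtoC (Binomial.C (2 * n - 1 + k - 1) k)
               * Cpower (INR (2 * k + (2 * n - 1))) (- s))%C
     (zeta_H_odd n s).
Proof.
  intros Hn Hs. unfold zeta_H_odd.
  set (f := INR (fact (2 * n - 2))).
  assert (Hf : f <> 0) by apply not_0_INR, fact_neq_0.
  assert (H4 : 4 ^ n <> 0) by (apply pow_nonzero; lra).
  assert (H' := CS_csum (fun i k => RtoC (IZR (v n i)) * 4
                  * Cpower (INR (2 * k + 1)) (- (s - RtoC (2 * INR i) + 2)))%C
                (fun i => RtoC (IZR (v n i)) * (4 - Cpower 2 (- s + RtoC (2 * INR i)))
                   * zeta (s - RtoC (2 * INR i) + 2))%C n).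
  assert (H := fun h => CS_scal (1 / RtoC (4 ^ n * f)) _ _ (H' h)). clear H'.
  cbv beta in H. refine ((fun H0 => _) (H _)); clear H.
  - rename H0 into H. set (P := fun M : nat =>
      fold_right (fun i p => ((2 * INR M + 1) ^ 2 - (2 * INR i - 1) ^ 2) * p) 1 (seq 1 (n - 1))).
    assert (E : forall k, (1 / RtoC (4 ^ n * f) * csum (fun i => RtoC (IZR (v n i)) * 4
                  * Cpower (INR (2 * k + 1)) (- (s - RtoC (2 * INR i) + 2))) n)%C
       = (RtoC (4 * P k / (4 ^ n * f)) * Cpower (INR (2 * k + 1)) (- s))%C).
    { intros k. pose proof (INR_succ_ge_1 (2 * k)) as Hk. set (M := INR (2 * k + 1)) in *.
      assert (EM : M = 2 * INR k + 1)
        by (unfold M; rewrite plus_INR, mult_INR; simpl; ring).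
      rewrite (csum_ext _ (fun i => (4 * Cpower M (- (s + 2)))
                             * RtoC (IZR (v n i) * (M ^ 2) ^ i))%C).
      2: { intros i _. rewrite Cpower_shift by lra. rewrite RtoC_mult. ring. }
      rewrite csum_scal, csum_RtoC, v_spec by exact Hn.
      replace (fold_right _ 1 (seq 1 (n - 1))) with (P k) by (unfold P; now rewrite EM).
      replace (Cpower M (- s)) with (Cpower M (- (s + 2)) * RtoC (M ^ 2))%C.
      - rewrite (RtoC_div (4 * P k)), !RtoC_mult
          by (apply Rmult_integral_contrapositive_currified; assumption).
        field. split; apply RtoC_neq_0; assumption.
      - replace (- s)%C with (- (s + 2) + RtoC (INR 2))%C
          by (simpl (INR 2); replace (1 + 1) with 2 by ring; ring).
        rewrite Cpower_plus, Cpower_INR by lra. reflexivity. }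
    apply (CS_ext _ _ _ E) in H.
    (* The odd numbers [1, 3, ..., 2n - 3] lie below the spectrum, and the product vanishes at each
       of them. *)
    apply (CS_drop _ _ (n - 1)) in H.
    + eapply CS_ext; [|exact H]. intros k. cbv beta.
      replace (2 * (n - 1 + k) + 1)%nat with (2 * k + (2 * n - 1))%nat by lia.
      f_equal. f_equal.
      pose proof (odd_product (n - 1) (n - 1 + k) ltac:(lia)) as EP.
      fold (P (n - 1 + k)%nat) in EP.
      replace (n - 1 + k - (n - 1))%nat with k in EP by lia.
      replace (n - 1 + k + (n - 1))%nat with (2 * n - 1 + k - 1)%nat in EP by lia.
      unfold Binomial.C.
      replace (2 * n - 1 + k - 1 - k)%nat with (2 * n - 2)%nat by lia. fold f.
      assert (INR (fact k) <> 0) by apply not_0_INR, fact_neq_0.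
      assert (E4 : 4 ^ n = 4 * 4 ^ (n - 1)).
      { replace n with (S (n - 1)) at 1 by lia. reflexivity. }
      rewrite E4 in *. assert (4 ^ (n - 1) <> 0) by (apply pow_nonzero; lra).
      apply Rmult_eq_reg_r with (INR (fact k)); [|assumption].
      transitivity (4 * (P (n - 1 + k)%nat * INR (fact k)) / (4 * 4 ^ (n - 1) * f));
        [field; auto|].
      rewrite EP. field. auto.
    + intros k Hk. replace (P k) with 0; [unfold Rdiv; rewrite Rmult_0_r, Rmult_0_l; ring|].
      symmetry. apply fold_prod_zero with (k + 1)%nat; [apply in_seq; lia|].
      rewrite plus_INR. simpl (INR 1). ring.
  - intros i Hi.
    assert (Hre : 1 < Re (s - RtoC (2 * INR i) + 2)).
    { unfold Cminus. rewrite !re_plus, re_opp, !re_RtoC.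
      rewrite minus_INR, mult_INR in Hs by lia. simpl (INR 2) in Hs. simpl (INR 1) in Hs.
      assert (INR i <= INR n) by (apply le_INR; lia). lra. }
    (* [4 - 2^(-s+2i) = 4 (1 - 2^(-(s-2i+2)))], the factor that restricts the translate of [zeta] to
       odd integers. *)
    replace (RtoC (IZR (v n i)) * (4 - Cpower 2 (- s + RtoC (2 * INR i)))
                   * zeta (s - RtoC (2 * INR i) + 2))%C
      with (RtoC (IZR (v n i)) * 4 * ((1 - Cpower 2 (- (s - RtoC (2 * INR i) + 2)))
                   * zeta (s - RtoC (2 * INR i) + 2)))%C.
    + now apply CS_scal, CS_odd_zeta.
    + replace (- s + RtoC (2 * INR i))%C
        with (- (s - RtoC (2 * INR i) + 2) + RtoC (INR 2))%C
        by (simpl (INR 2); replace (1 + 1) with 2 by ring; ring).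
      rewrite Cpower_plus, Cpower_INR by lra.
      replace (RtoC (2 ^ 2)) with (RtoC 4) by (f_equal; ring). ring.
Qed.

Lemma analytic_zeta_term h b a : analytic_at h a -> (a + b)%C <> 1 ->
  analytic_at (fun s => h s * zeta (s + b))%C a.
Proof.
  intros Hh Hab. apply analytic_mult; [exact Hh|]. now apply analytic_shift, zeta_analytic.
Qed.

Lemma analytic_outer (c : C) a : analytic_at (fun s => Cpower 2 (- s) / c)%C a.
Proof.
  apply (analytic_ext_loc (fun s => Cpower 2 (- s + 0) * / c)%C _ a 1 Rlt_0_1).
  - intros z _. now rewrite Cplus_0_r.
  - apply analytic_mult; [apply analytic_Cpower_opp|apply analytic_const].
Qed.

(** The summand of index [i] can have a pole only at [s = 2i], and these points are distinct. *)
Lemma zeta_H_even_meromorphic n : meromorphic (zeta_H_even n).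
Proof.
  intros a. unfold zeta_H_even. apply mero_at_mult.
  - apply analytic_outer.
  - assert (Hf : RtoC (INR (fact (2 * n - 1))) <> 0) by apply RtoC_INR_neq_0, lt_O_fact.
    apply Cmult_neq_0; [apply Cpower_neq_0|].
    intros E. apply Hf. rewrite <- (Cmult_1_r (RtoC (INR _))).
    apply (f_equal (Cmult (RtoC (INR (fact (2 * n - 1)))))) in E.
    rewrite Cinv_r in E by exact Hf. rewrite E at 1. ring.
  - set (F := fun (i : nat) s => (RtoC (IZR (u n i)) * zeta (s + (- RtoC (2 * INR i) + 1)))%C).
    apply mero_at_ext with (fun s => csum (fun i => F i s) n).
    { intros z. apply csum_ext. intros i _. unfold F. do 2 f_equal. ring. }
    apply mero_at_csum.
    + intros i. apply mero_at_zeta_term; [apply analytic_const|].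
      destruct (Ceq_dec (RtoC (IZR (u n i))) 0); auto.
    + assert (A : forall i, a <> RtoC (2 * INR i) -> analytic_at (F i) a).
      { intros i Hi. apply analytic_zeta_term; [apply analytic_const|]. intros E. apply Hi.
        transitivity (a + (- RtoC (2 * INR i) + 1) + (RtoC (2 * INR i) - 1))%C; [ring|].
        rewrite E. ring. }
      intros i j Hij. destruct (Ceq_dec a (RtoC (2 * INR i))) as [->|Ha]; [|now left; apply A].
      right. apply A. intros E. apply RtoC_inj in E. apply Hij, INR_eq. lra.
Qed.

Lemma zeta_H_odd_meromorphic n : meromorphic (zeta_H_odd n).
Proof.
  intros a. unfold zeta_H_odd. apply mero_at_mult.
  - apply analytic_const.
  - rewrite <- RtoC_div.
    + apply RtoC_neq_0. unfold Rdiv. rewrite Rmult_1_l. apply Rinv_neq_0_compat.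
      apply Rmult_integral_contrapositive_currified;
        [apply pow_nonzero; lra|apply not_0_INR, fact_neq_0].
    + apply Rmult_integral_contrapositive_currified;
        [apply pow_nonzero; lra|apply not_0_INR, fact_neq_0].
  - set (h := fun (i : nat) s => (RtoC (IZR (v n i)) * (4 - Cpower 2 (- s + RtoC (2 * INR i))))%C).
    set (F := fun (i : nat) s => (h i s * zeta (s + (- RtoC (2 * INR i) + 2)))%C).
    apply mero_at_ext with (fun s => csum (fun i => F i s) n).
    { intros z. apply csum_ext. intros i _. unfold F, h. f_equal. f_equal. ring. }
    assert (Hh : forall i, analytic_at (h i) a).
    { intros i. apply analytic_mult; [apply analytic_const|].
      apply (analytic_ext_loc (fun s => 4 + - (1) * Cpower 2 (- s + RtoC (2 * INR i)))%C _ a 1 Rlt_0_1).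
      - intros; ring.
      - apply analytic_plus; [apply analytic_const|].
        apply analytic_mult; [apply analytic_const|apply analytic_Cpower_opp]. }
    assert (A : forall i, a <> RtoC (2 * INR i - 1) -> analytic_at (F i) a).
    { intros i Hi. apply analytic_zeta_term; [apply Hh|]. intros E. apply Hi.
      rewrite RtoC_minus.
      transitivity (a + (- RtoC (2 * INR i) + 2) + (RtoC (2 * INR i) - 2))%C; [ring|].
      rewrite E. ring. }
    apply mero_at_csum.
    + intros i. destruct (Ceq_dec a (RtoC (2 * INR i - 1))) as [Ea|Ea]; [|now left; apply A].
      apply mero_at_zeta_term; [apply Hh|].
      destruct (Ceq_dec (RtoC (IZR (v n i))) 0) as [E0|E0].
      * right. intros s. unfold h. rewrite E0. ring.
      * left. apply Cmult_neq_0; [exact E0|].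
        (* At the pole [a = 2i - 1] the power is [2^1], so the factor is [4 - 2] and does not
           vanish. *)
        replace (- a + RtoC (2 * INR i))%C with (RtoC 1).
        -- rewrite Cpower_R, Rpower_1, <- RtoC_minus by lra. apply RtoC_neq_0. lra.
        -- rewrite Ea, <- RtoC_opp, <- RtoC_plus. f_equal. ring.
    + intros i j Hij. destruct (Ceq_dec a (RtoC (2 * INR i - 1))) as [->|Ha]; [|now left; apply A].
      right. apply A. intros E. apply RtoC_inj in E. apply Hij, INR_eq. lra.
Qed.

Lemma zeta_H_even_continuation n : (1 <= n)%nat ->
  is_continuation (fun k s => RtoC (Binomial.C (2 * n + k - 1) k)
                              * Cpower (INR (2 * k + 2 * n)) (- s))%C
    (INR (2 * n)) (zeta_H_even n).
Proof.
  intros Hn. split; [apply zeta_H_even_meromorphic|].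
  intros s Hs. now apply zeta_H_even_series.
Qed.

Lemma zeta_H_odd_continuation n : (1 <= n)%nat ->
  is_continuation (fun k s => RtoC (Binomial.C (2 * n - 1 + k - 1) k)
                              * Cpower (INR (2 * k + (2 * n - 1))) (- s))%C
    (INR (2 * n - 1)) (zeta_H_odd n).
Proof.
  intros Hn. split; [apply zeta_H_odd_meromorphic|].
  intros s Hs. now apply zeta_H_odd_series.
Qed.

(** The derivative in the form of Carathéodory: the difference quotient extends to an analytic
    function with value [l] at [a]. The rules of differentiation become identities between
    quotients. *)
Definition has_der (f : C -> C) (a l : C) : Prop :=
  exists g d, 0 < d /\ analytic_at g a /\ g a = l /\
    forall z, Cmod (z - a) < d -> f z = (f a + (z - a) * g z)%C.

(** [C_derive] takes the limits of the two components along the horizontal line through [a];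
    continuity of the quotient [g] at [a] gives both. *)
Lemma has_der_C_derive f a l : has_der f a l -> C_derive f a = l.
Proof.
  intros (g & d & Hd & Hg & <- & E).
  assert (Q : forall e, 0 < e -> exists d', 0 < d' /\ forall x, Rabs (x - fst a) < d' ->
     x <> fst a ->
     Cmod (((f (x, snd a) - f a) / ((x, snd a) - a)) - g a)%C < e).
  { intros e He. destruct (analytic_continuous g a Hg e He) as (d' & Hd' & Hc).
    exists (Rmin d d'). split; [now apply Rmin_glb_lt|]. intros x Hx Hne.
    pose proof (Rmin_l d d'). pose proof (Rmin_r d d').
    assert (Em : Cmod ((x, snd a) - a) = Rabs (x - fst a)).
    { destruct a as [p q]. apply Cmod_horizontal. }
    rewrite (E (x, snd a)) by lra.
    replace (((f a + ((x, snd a) - a) * g (x, snd a)) - f a) / ((x, snd a) - a))%C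
      with (g (x, snd a)).
    - apply Hc. lra.
    - field. apply Cmod_gt_0. rewrite Em. apply Rabs_pos_lt. lra. }
  unfold C_derive, C_lim. rewrite (surjective_pairing (g a)) at 1. f_equal.
  - refine (f_equal real (is_lim_unique _ _ (Finite (fst (g a))) _)).
    apply is_lim_spec. intros [e He]. destruct (Q e He) as (d' & Hd' & H).
    exists (mkposreal d' Hd'). intros x Hx Hne. simpl.
    eapply Rle_lt_trans; [|apply (H x Hx Hne)].
    exact (fst_le_Cmod (((f (x, snd a) - f a) / ((x, snd a) - a)) - g a)%C).
  - refine (f_equal real (is_lim_unique _ _ (Finite (snd (g a))) _)).
    apply is_lim_spec. intros [e He]. destruct (Q e He) as (d' & Hd' & H).
    exists (mkposreal d' Hd'). intros x Hx Hne. simpl.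
    eapply Rle_lt_trans; [|apply (H x Hx Hne)].
    exact (snd_le_Cmod (((f (x, snd a) - f a) / ((x, snd a) - a)) - g a)%C).
Qed.

Lemma analytic_has_der f a : analytic_at f a -> has_der f a (C_derive f a).
Proof.
  intros Hf. destruct (analytic_quotient f a Hf) as (g & d & Hd & Hg & E).
  assert (H : has_der f a (g a)) by (exists g, d; auto).
  now rewrite (has_der_C_derive _ _ _ H).
Qed.

Lemma has_der_ext_loc f g a l d : 0 < d -> (forall z, Cmod (z - a) < d -> f z = g z) ->
  has_der f a l -> has_der g a l.
Proof.
  intros Hd Efg (q & d' & Hd' & Hq & E0 & E). exists q, (Rmin d d').
  split; [now apply Rmin_glb_lt|split; [exact Hq|split; [exact E0|]]].
  intros z Hz. pose proof (Rmin_l d d'). pose proof (Rmin_r d d').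
  rewrite <- Efg, <- Efg by (rewrite ?Cmod_minus_self; lra). apply E. lra.
Qed.

Lemma has_der_const w a : has_der (fun _ => w) a 0.
Proof.
  exists (fun _ => RtoC 0), 1. split; [lra|split; [apply analytic_const|split; [reflexivity|]]].
  intros; ring.
Qed.

Lemma has_der_plus f g a l m : has_der f a l -> has_der g a m ->
  has_der (fun z => f z + g z)%C a (l + m)%C.
Proof.
  intros (p & d & Hd & Hp & <- & E) (q & d' & Hd' & Hq & <- & E').
  exists (fun z => p z + q z)%C, (Rmin d d').
  split; [now apply Rmin_glb_lt|split; [now apply analytic_plus|split; [reflexivity|]]].
  intros z Hz. pose proof (Rmin_l d d'). pose proof (Rmin_r d d').
  rewrite (E z), (E' z) by lra. ring.
Qed.

Lemma has_der_mult f g a l m : has_der f a l -> has_der g a m ->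
  has_der (fun z => f z * g z)%C a (l * g a + f a * m)%C.
Proof.
  intros (p & d & Hd & Hp & <- & E) (q & d' & Hd' & Hq & <- & E').
  exists (fun z => p z * g a + f a * q z + (z - a) * (p z * q z))%C, (Rmin d d').
  split; [now apply Rmin_glb_lt|split; [|split; [ring|]]].
  - apply analytic_plus; [apply analytic_plus|]; apply analytic_mult;
      auto using analytic_const, analytic_lin, analytic_mult.
  - intros z Hz. pose proof (Rmin_l d d'). pose proof (Rmin_r d d').
    rewrite (E z), (E' z) by lra. ring.
Qed.

Lemma has_der_comp_shift f a b w l : w = (a + b)%C -> has_der f w l ->
  has_der (fun z => f (z + b)%C) a l.
Proof.
  intros -> (p & d & Hd & Hp & <- & E). exists (fun z => p (z + b)%C), d.
  split; [exact Hd|split; [now apply analytic_shift|split; [reflexivity|]]].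
  intros z Hz. replace (z - a)%C with (z + b - (a + b))%C in * by ring. now apply E.
Qed.

Lemma has_der_csum (F : nat -> C -> C) (l : nat -> C) a n :
  (forall i, (1 <= i <= n)%nat -> has_der (F i) a (l i)) ->
  has_der (fun s => csum (fun i => F i s) n) a (csum l n).
Proof.
  induction n as [|n IH]; intros H.
  - rewrite csum_0. apply (has_der_ext_loc (fun _ => RtoC 0) _ a _ 1 Rlt_0_1);
      [intros; now rewrite csum_0|apply has_der_const].
  - rewrite csum_S.
    apply (has_der_ext_loc (fun s => csum (fun i => F i s) n + F (S n) s)%C _ a _ 1 Rlt_0_1);
      [intros; now rewrite csum_S|].
    apply has_der_plus; [apply IH; intros i Hi|]; apply H; lia.
Qed.

(** The derivative of [x^(-s)] at 0 is the coefficient of index 1 in the exponential series of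
    [- s ln x]. *)
Lemma has_der_Cpower_opp x b : has_der (fun s => Cpower x (- s + b)) 0
  (- RtoC (ln x) * Cpower x b)%C.
Proof.
  assert (Hs : has_der (fun s => Cpower x (- s)) 0 (- RtoC (ln x))%C).
  { set (c := exp_coef (- RtoC (ln x))%C).
    assert (Hser : is_series (fun k => Cmod (c k) * 1 ^ k) (exp (Cmod (- RtoC (ln x))))).
    { eapply is_series_R_ext; [|apply exp_series_R]. intros k. cbv beta. unfold c.
      rewrite Cmod_exp_coef, pow1. ring. }
    destruct (pser_div_coef c (fun s => Cpower x (- s)) 0 1 (exp (Cmod (- RtoC (ln x)))))
      as (g & Hg & Eg & E); [lra| | |].
    - intros K. apply sum_n_le_series; [|exact Hser].
      intros k. rewrite pow1, Rmult_1_r. apply Cmod_ge_0.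
    - intros s _. unfold Cpower.
      replace (- s * RtoC (ln x))%C with (- RtoC (ln x) * (s - 0))%C by ring.
      eapply CS_ext; [|apply Cexp_series]. intros k. unfold c, exp_coef.
      rewrite Cpow_mult_l. unfold Cdiv. ring.
    - exists g, 1. split; [lra|split; [now apply pser_analytic in Hg|split; [|exact E]]].
      rewrite Eg. unfold c, exp_coef. simpl. field. }
  apply (has_der_ext_loc (fun s => Cpower x (- s) * Cpower x b)%C _ 0 _ 1 Rlt_0_1).
  - intros z _. symmetry. apply Cpower_plus.
  - replace (- RtoC (ln x) * Cpower x b)%C
      with (- RtoC (ln x) * Cpower x b + Cpower x (- 0) * 0)%C by ring.
    apply (has_der_mult (fun s => Cpower x (- s)) (fun _ => Cpower x b) 0); [exact Hs|apply has_der_const].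
Qed.

(** * Derivatives at the origin and determinants *)

Lemma has_der_analytic f a l : has_der f a l -> analytic_at f a.
Proof.
  intros (g & d & Hd & Hg & _ & E).
  apply (analytic_ext_loc (fun z => f a + (z - a) * g z)%C f a d Hd).
  - intros z Hz. symmetry. now apply E.
  - apply analytic_plus; [apply analytic_const|].
    apply analytic_mult; [apply analytic_lin|exact Hg].
Qed.

(** The germs agree off [s]. At [s] itself [g] is analytic, so there is no pole and the chosen
    continuation takes the same value. *)
Lemma continuation_C_derive a sigma g s l : is_continuation a sigma g ->
  has_der g s l -> C_derive (continuation a sigma) s = l.
Proof.
  intros Hg Hd. apply has_der_C_derive.
  destruct (continuation_germ_eq a sigma g s Hg) as (d & Hd0 & E).
  destruct (continuation_spec a sigma g Hg) as (_ & _ & P & V).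
  apply (has_der_ext_loc g _ s l d Hd0); [|exact Hd]. intros z Hz. symmetry.
  destruct (Ceq_dec z s) as [->|Hne].
  - apply V. rewrite P. apply analytic_not_pole, (has_der_analytic _ _ _ Hd).
  - apply E. split; [|exact Hz]. apply Cmod_gt_0. now apply Cminus_neq_0.
Qed.

(** At a real point [C_derive] tests real increments, so every difference quotient involved is
    real. *)
Lemma C_derive_zeta_real x : x <> 1 -> snd (C_derive zeta (RtoC x)) = 0.
Proof.
  intros Hx. unfold C_derive, C_lim. cbn [snd].
  refine (f_equal real (is_lim_unique _ _ (Finite 0) _)).
  apply is_lim_ext_loc with (fun _ => 0); [|apply is_lim_const].
  (* The radius [|x - 1|] keeps the increments away from the pole, where the value of [zeta] is
     arbitrary. *)
  assert (Hd : 0 < Rabs (x - 1)) by (apply Rabs_pos_lt; lra).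
  exists (mkposreal _ Hd). intros y Hy _.
  assert (Hy1 : y <> 1).
  { intros ->. unfold ball in Hy. cbn in Hy. unfold AbsRing_ball, abs, minus, plus, opp in Hy.
    cbn in Hy. replace (1 + - x) with (- (x - 1)) in Hy by ring. rewrite Rabs_Ropp in Hy. lra. }
  symmetry. change (y, snd (RtoC x)) with (RtoC y).
  apply real_mult; [|apply real_inv; simpl; ring].
  apply real_plus; [now apply zeta_real|apply real_opp; now apply zeta_real].
Qed.

Lemma real_sum_n_m (a : nat -> C) m n : (forall i, (m <= i <= n)%nat -> snd (a i) = 0) ->
  snd (sum_n_m (G := C_AbelianMonoid) a m n) = 0.
Proof.
  intros H. destruct (Nat.lt_ge_cases n m) as [Hlt|Hge].
  - rewrite sum_n_m_zero by exact Hlt. reflexivity.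
  - induction Hge as [|n Hge IH].
    + rewrite sum_n_n. apply H. lia.
    + rewrite sum_n_Sm by lia. apply real_plus; [apply IH; intros i Hi|]; apply H; lia.
Qed.

Lemma Clog_Cexp_real z : snd z = 0 -> Clog (Cexp z) = z.
Proof.
  intros Hz. destruct z as [x y]. simpl in Hz. subst y. change (x, 0) with (RtoC x).
  rewrite Cexp_R. unfold Clog, Carg.
  rewrite Cmod_R, Rabs_pos_eq by (left; apply exp_pos).
  rewrite ln_exp, re_RtoC.
  destruct (Rle_dec 0 (Im (RtoC (exp x)))) as [_|H]; [|exfalso; apply H; simpl; lra].
  replace (exp x / exp x) with 1 by (field; pose proof (exp_pos x); lra).
  rewrite acos_1. reflexivity.
Qed.

Lemma log_det (z : C) : snd z = 0 -> (- Clog (Cexp (- z)))%C = z.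
Proof. intros Hz. rewrite Clog_Cexp_real by now apply real_opp. ring. Qed.

Lemma has_der_zeta_shift x b w : w = RtoC x -> (0 + b)%C = w -> x <> 1 ->
  has_der (fun s => zeta (s + b)) 0 (C_derive zeta (RtoC x)).
Proof.
  intros -> Hb Hx. apply (has_der_comp_shift zeta 0 b (RtoC x)); [now symmetry|].
  apply analytic_has_der, zeta_analytic. intros E. now apply RtoC_inj in E.
Qed.

Lemma csum_plus (a b : nat -> C) n :
  csum (fun i => a i + b i)%C n = (csum a n + csum b n)%C :> C.
Proof. exact (sum_n_m_plus a b 1 n). Qed.

(** The product rule on the outer factor [2^(-s)] produces the terms with [ln 2]; the points
    [1 - 2i] are all different from 1. *)
Lemma has_der_zeta_H_even n : has_der (zeta_H_even n) 0
  (1 / RtoC (INR (fact (2 * n - 1)))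
   * csum (fun i => RtoC (IZR (u n i))
          * (C_derive zeta (RtoC (- (2 * INR i) + 1))
             - RtoC (ln 2) * zeta (RtoC (- (2 * INR i) + 1)))) n)%C.
Proof.
  set (c := RtoC (INR (fact (2 * n - 1)))).
  assert (Hc : c <> 0) by apply RtoC_INR_neq_0, lt_O_fact.
  assert (HK : has_der (fun s => Cpower 2 (- s) / c)%C 0 (- RtoC (ln 2) / c)%C).
  { apply (has_der_ext_loc (fun s => Cpower 2 (- s + 0) * / c)%C _ 0 _ 1 Rlt_0_1).
    - intros z _. now rewrite Cplus_0_r.
    - replace (- RtoC (ln 2) / c)%C
        with (- RtoC (ln 2) * Cpower 2 0 * / c + Cpower 2 (- 0 + 0) * 0)%C
        by (rewrite Cpower_0; field; exact Hc).
      apply (has_der_mult (fun s => Cpower 2 (- s + 0)) (fun _ => / c)%C);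
        [apply has_der_Cpower_opp|apply has_der_const]. }
  set (pt := fun i => - (2 * INR i) + 1).
  assert (Ept : forall i, (0 + (- RtoC (2 * INR i) + 1))%C = RtoC (pt i)).
  { intros i. unfold pt. rewrite RtoC_plus, RtoC_opp. ring. }
  assert (HS : has_der (fun s => csum (fun i => RtoC (IZR (u n i))
                          * zeta (s - RtoC (2 * INR i) + 1))%C n) 0
    (csum (fun i => RtoC (IZR (u n i)) * C_derive zeta (RtoC (pt i)))%C n)).
  { apply has_der_csum. intros i Hi.
    apply (has_der_ext_loc (fun s => RtoC (IZR (u n i))
             * zeta (s + (- RtoC (2 * INR i) + 1)))%C _ 0 _ 1 Rlt_0_1).
    - intros z _. do 2 f_equal. ring.
    - replace (RtoC (IZR (u n i)) * C_derive zeta (RtoC (pt i)))%C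
        with (0 * zeta (0 + (- RtoC (2 * INR i) + 1))
              + RtoC (IZR (u n i)) * C_derive zeta (RtoC (pt i)))%C by ring.
      apply (has_der_mult (fun _ => RtoC (IZR (u n i)))
               (fun s => zeta (s + (- RtoC (2 * INR i) + 1))) 0); [apply has_der_const|].
      apply (has_der_zeta_shift _ _ (RtoC (pt i)) eq_refl (Ept i)).
      unfold pt. assert (1 <= INR i) by (apply (le_INR 1); lia). lra. }
  pose proof (has_der_mult _ _ 0 _ _ HK HS) as H.
  unfold zeta_H_even. fold c.
  match goal with |- has_der _ _ ?x => match type of H with has_der _ _ ?y =>
    replace x with y; [exact H|] end end.
  cbv beta. clear H HS HK.
  assert (E0 : Cpower 2 (- 0) = 1).
  { replace (- 0)%C with (RtoC 0) by ring. apply Cpower_0. }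
  rewrite E0.
  rewrite (csum_ext (fun i => RtoC (IZR (u n i))
      * (C_derive zeta (RtoC (- (2 * INR i) + 1)) - RtoC (ln 2) * zeta (RtoC (- (2 * INR i) + 1))))%C
    (fun i => RtoC (IZR (u n i)) * C_derive zeta (RtoC (pt i))
       + - RtoC (ln 2) * (RtoC (IZR (u n i)) * zeta (0 - RtoC (2 * INR i) + 1)))%C).
  - rewrite (csum_plus (fun i => RtoC (IZR (u n i)) * C_derive zeta (RtoC (pt i)))%C), csum_scal.
    field. exact Hc.
  - intros i _. fold (pt i). replace (0 - RtoC (2 * INR i) + 1)%C with (RtoC (pt i)); [ring|].
    rewrite <- Ept. ring.
Qed.

Lemma prod_coef_0 (c : nat -> Z) l :
  IZR (prod_coef (map c l) 0) = fold_right (fun i p => - IZR (c i) * p) 1 l.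
Proof.
  induction l as [|i l IH]; [reflexivity|]. cbn [map prod_coef fold_right].
  rewrite minus_IZR, mult_IZR, IH. simpl. ring.
Qed.

(** The product of the first [m] odd numbers is [(2m)! / (2^m m!)]. *)
Lemma odd_squares_product m :
  fold_right (fun i p => - IZR ((2 * Z.of_nat i - 1) ^ 2) * p) 1 (seq 1 m)
  = (-1) ^ m * (INR (fact (2 * m)) / (2 ^ m * INR (fact m))) ^ 2.
Proof.
  induction m as [|m IH]; [simpl; field|].
  rewrite seq_S, fold_prod_app, IH.
  replace (2 * S m)%nat with (S (S (2 * m))) by lia.
  rewrite (fact_simpl (S (2 * m))), (fact_simpl (2 * m)), (fact_simpl m), !mult_INR.
  rewrite Z.pow_2_r, mult_IZR, minus_IZR, mult_IZR, <- INR_IZR_INZ.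
  change (1 + m)%nat with (S m). rewrite !S_INR, mult_INR. simpl (INR 2). cbn [pow].
  pose proof (pos_INR m). field. repeat split; try lra.
  - apply not_0_INR, fact_neq_0.
  - apply pow_nonzero. lra.
Qed.

(** Once the factor [x] is split off, this is the constant term of the product of the
    [x - (2i-1)^2]. *)
Lemma v_1 n : IZR (v n 1)
  = (-1) ^ (n - 1) * (INR (fact (2 * (n - 1))) / (2 ^ (n - 1) * INR (fact (n - 1)))) ^ 2.
Proof.
  rewrite <- odd_squares_product, <- prod_coef_0. unfold v. cbn [prod_coef].
  f_equal. ring.
Qed.

Lemma has_der_zeta_H_odd n : (1 <= n)%nat -> has_der (zeta_H_odd n) 0
  (1 / RtoC (4 ^ n * INR (fact (2 * n - 2)))
   * sum_n_m (G := C_AbelianMonoid)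
       (fun i => RtoC ((4 - 4 ^ i) * IZR (v n i))
          * C_derive zeta (RtoC (- (2 * INR i) + 2))) 2 n
   + RtoC ((-1) ^ n * 8 * ln 2 * INR (fact (2 * n - 2))
           / (16 ^ n * INR (fact (n - 1)) ^ 2)))%C.
Proof.
  intros Hn. set (f := INR (fact (2 * n - 2))).
  assert (Hf : f <> 0) by apply not_0_INR, fact_neq_0.
  assert (H4 : 4 ^ n <> 0) by (apply pow_nonzero; lra).
  assert (H4f : 4 ^ n * f <> 0) by now apply Rmult_integral_contrapositive_currified.
  set (pt := fun i => - (2 * INR i) + 2).
  assert (Ept : forall i, (0 + (- RtoC (2 * INR i) + 2))%C = RtoC (pt i)).
  { intros i. unfold pt. rewrite RtoC_plus, RtoC_opp. ring. }
  assert (EP : forall i, Cpower 2 (RtoC (2 * INR i)) = RtoC (4 ^ i)).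
  { intros i. replace (2 * INR i) with (INR (2 * i)) by (rewrite mult_INR; simpl; ring).
    rewrite Cpower_INR, pow_mult by lra. do 2 f_equal. ring. }
  (* The two halves of the product rule. For [i >= 2] the first vanishes at a trivial zero of
     [zeta]; for [i = 1] the second vanishes because [4 - 4^1 = 0]. *)
  set (D := fun i => (RtoC (IZR (v n i)) * (RtoC (ln 2) * RtoC (4 ^ i)) * zeta (RtoC (pt i))
      + RtoC (IZR (v n i)) * (4 - RtoC (4 ^ i)) * C_derive zeta (RtoC (pt i)))%C).
  assert (HS : has_der (fun s => csum (fun i => RtoC (IZR (v n i))
                    * (4 - Cpower 2 (- s + RtoC (2 * INR i)))
                    * zeta (s - RtoC (2 * INR i) + 2))%C n) 0 (csum D n)).
  { apply has_der_csum. intros i Hi.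
    apply (has_der_ext_loc (fun s => (RtoC (IZR (v n i)) *
             (4 + - (1) * Cpower 2 (- s + RtoC (2 * INR i))))
             * zeta (s + (- RtoC (2 * INR i) + 2)))%C _ 0 _ 1 Rlt_0_1).
    - intros z _. replace (z - RtoC (2 * INR i) + 2)%C with (z + (- RtoC (2 * INR i) + 2))%C by ring.
      ring.
    - assert (Hh : has_der (fun s => RtoC (IZR (v n i)) *
             (4 + - (1) * Cpower 2 (- s + RtoC (2 * INR i))))%C 0
             (RtoC (IZR (v n i)) * (RtoC (ln 2) * RtoC (4 ^ i)))%C).
      { assert (H := has_der_mult (fun _ => RtoC (IZR (v n i))) _ 0 _ _ (has_der_const _ 0)
          (has_der_plus (fun _ => RtoC 4) _ 0 _ _ (has_der_const _ 0)
            (has_der_mult (fun _ => - RtoC 1)%C _ 0 _ _ (has_der_const _ 0)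
               (has_der_Cpower_opp 2 (RtoC (2 * INR i)))))).
        cbv beta in H. rewrite EP in H.
        match goal with |- has_der _ _ ?x => match type of H with has_der _ _ ?y =>
          replace x with y; [exact H|ring] end end. }
      assert (Hz : has_der (fun s => zeta (s + (- RtoC (2 * INR i) + 2))) 0
                     (C_derive zeta (RtoC (pt i)))).
      { apply (has_der_zeta_shift _ _ (RtoC (pt i)) eq_refl (Ept i)).
        unfold pt. assert (1 <= INR i) by (apply (le_INR 1); lia). lra. }
      assert (H := has_der_mult _ _ 0 _ _ Hh Hz). cbv beta in H.
      replace (- 0 + RtoC (2 * INR i))%C with (RtoC (2 * INR i)) in H by ring.
      rewrite Ept, EP in H.
      match goal with |- has_der _ _ ?x => match type of H with has_der _ _ ?y =>
          replace x with y; [exact H|unfold D; ring] end end. }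
  assert (HK := has_der_mult (fun _ => 1 / RtoC (4 ^ n * f))%C _ 0 _ _ (has_der_const _ 0) HS).
  unfold zeta_H_odd. fold f.
  match goal with |- has_der _ _ ?x => match type of HK with has_der _ _ ?y =>
    replace x with y; [exact HK|] end end.
  clear HK HS. rewrite Cmult_0_l, Cplus_0_l.
  rewrite (sum_Sn_m D 1 n Hn).
  rewrite (sum_n_m_ext_loc D
    (fun i => RtoC ((4 - 4 ^ i) * IZR (v n i)) * C_derive zeta (RtoC (- (2 * INR i) + 2)))%C 2 n).
  2: { intros i Hi. unfold D.
    replace (RtoC (pt i)) with (RtoC (- (2 * INR (i - 1)))).
    - rewrite zeta_neg_even by lia.
      replace (- (2 * INR (i - 1))) with (- (2 * INR i) + 2)
        by (rewrite minus_INR by lia; simpl; ring).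
      rewrite RtoC_mult, RtoC_minus. match goal with |- ?a = ?b => change (a = b :> C) end. ring.
    - unfold pt. f_equal. rewrite minus_INR by lia. simpl. ring. }
  set (T := sum_n_m _ 2 n).
  (* The constant is [4 zeta 0 = -2]. *)
  assert (E1 : D 1%nat = RtoC (- (2) * ln 2 * IZR (v n 1))).
  { unfold D, pt. replace (- (2 * INR 1) + 2) with 0 by (simpl; ring).
    rewrite zeta_0. rewrite pow_1.
    replace (4 - RtoC 4)%C with (RtoC 0) by ring.
    transitivity (RtoC (IZR (v n 1)) * (RtoC (ln 2) * RtoC 4) * RtoC (- (1 / 2)))%C; [ring|].
    rewrite <- !RtoC_mult. f_equal. field. }
  change (plus (D 1%nat) T) with (D 1%nat + T)%C. rewrite E1, Cmult_plus_distr_l, Cplus_comm.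
  f_equal. rewrite <- RtoC_div by exact H4f. rewrite <- RtoC_mult. f_equal.
  rewrite v_1. replace (2 * (n - 1))%nat with (2 * n - 2)%nat by lia. fold f.
  assert (En : forall x : R, x ^ n = x * x ^ (n - 1)).
  { intros x. replace n with (S (n - 1)) at 1 by lia. reflexivity. }
  rewrite !En.
  set (m := (n - 1)%nat). cbn [pow].
  assert (INR (fact m) <> 0) by apply not_0_INR, fact_neq_0.
  assert (2 ^ m <> 0) by (apply pow_nonzero; lra).
  (* All powers are reduced to powers of 2, so that [field] can compare [16^n] with [4^n] and the
     square of [2^(n-1)] from [v_1]. *)
  replace 16 with (2 * 2 * (2 * 2)) by ring. replace 4 with (2 * 2) by ring.
  rewrite !Rpow_mult_distr. field. auto.
Qed.

Theorem theorem3p4 (n : nat) (hn : (1 <= n)%nat) :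
  mero_eq (zeta_H (2 * n))
    (fun s : C =>
       (Cpower 2 (- s) / RtoC (INR (fact (2 * n - 1)))
        * sum_n_m (G := C_AbelianMonoid)
            (fun i : nat =>
               RtoC (IZR (u n i)) * zeta (s - RtoC (2 * INR i) + 1)) 1 n)%C) /\
  mero_eq (zeta_H (2 * n - 1))
    (fun s : C =>
       (1 / RtoC (4 ^ n * INR (fact (2 * n - 2)))
        * sum_n_m (G := C_AbelianMonoid)
            (fun i : nat =>
               RtoC (IZR (v n i)) * (4 - Cpower 2 (- s + RtoC (2 * INR i)))
               * zeta (s - RtoC (2 * INR i) + 2)) 1 n)%C) /\
  (- Clog (det_H (2 * n)) =
   1 / RtoC (INR (fact (2 * n - 1)))
   * sum_n_m (G := C_AbelianMonoid)
       (fun i : nat =>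
          RtoC (IZR (u n i))
          * (C_derive zeta (RtoC (- (2 * INR i) + 1))
             - RtoC (ln 2) * zeta (RtoC (- (2 * INR i) + 1)))) 1 n)%C /\
  (- Clog (det_H (2 * n - 1)) =
   1 / RtoC (4 ^ n * INR (fact (2 * n - 2)))
   * sum_n_m (G := C_AbelianMonoid)
       (fun i : nat =>
          RtoC ((4 - 4 ^ i) * IZR (v n i))
          * C_derive zeta (RtoC (- (2 * INR i) + 2))) 2 n
   + RtoC ((-1) ^ n * 8 * ln 2 * INR (fact (2 * n - 2))
           / (16 ^ n * INR (fact (n - 1)) ^ 2)))%C.
Proof.
  (* Keeps the points [1 - 2i] and [2 - 2i] away from the pole 1 in the reality arguments. *)
  assert (Hpt : forall i, (1 <= i)%nat -> 1 <= INR i) by (intros i Hi; now apply (le_INR 1)).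
  split; [|split; [|split]].
  - exact (continuation_spec _ _ _ (zeta_H_even_continuation n hn)).
  - exact (continuation_spec _ _ _ (zeta_H_odd_continuation n hn)).
  - assert (D := continuation_C_derive _ _ _ _ _ (zeta_H_even_continuation n hn)
                   (has_der_zeta_H_even n)).
    change (continuation _ _) with (zeta_H (2 * n)) in D.
    unfold det_H. rewrite log_det; [exact D|]. rewrite D.
    apply real_mult; [apply real_mult; [reflexivity|apply real_inv; reflexivity]|].
    apply real_sum_n_m. intros i Hi. specialize (Hpt i (proj1 Hi)).
    apply real_mult; [reflexivity|]. apply real_plus; [apply C_derive_zeta_real; lra|].
    apply real_opp, real_mult; [reflexivity|]. apply zeta_real; lra.
  - assert (D := continuation_C_derive _ _ _ _ _ (zeta_H_odd_continuation n hn)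
                   (has_der_zeta_H_odd n hn)).
    change (continuation _ _) with (zeta_H (2 * n - 1)) in D.
    unfold det_H. rewrite log_det; [exact D|]. rewrite D.
    apply real_plus; [|reflexivity].
    apply real_mult; [apply real_mult; [reflexivity|apply real_inv; reflexivity]|].
    apply real_sum_n_m. intros i Hi. specialize (Hpt i ltac:(lia)).
    apply real_mult; [reflexivity|]. apply C_derive_zeta_real; lra.
Qed.
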